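(* $g\pi=\sigma'g$ as rational maps $X(3,6)/S_3\dashrightarrow Y(6)$.
   Context: Let $F$ be an algebraically closed field of characteristic zero. ''GIT moduli space of 6-dimensional representations'' means the affine GIT quotient by $GL(6)$, acting by conjugation, of the affine variety of the representations in question. All algebras are unital, associative over $F$. - $B_{3,6}$: generators $p_1,p_2,p_3,q_1,\dots,q_6$; relations $p_i^2=p_i$, $q_j^2=q_j$, $p_ip_{i'}=0$ for $i\ne i'$, $q_jq_{j'}=0$ for $j\neq j'$, $p_iq_jp_i=\frac16p_i$, $q_jp_iq_j=\frac16q_j$, $\sum_{j=1}^6q_j=1$. $X(3,6)$ is the GIT moduli space of its 6-dimensional representations in which all $p_i,q_j$ are rank 1 projectors. The group $S_3$ acts on $X(3,6)$ by permuting $p_1,p_2,p_3$; $X(3,6)$ (hence $X(3,6)/S_3$) is irreducible. - $A(6)$: generators $P,q_1,\dots,q_6$; relations $P^2=P$, $q_j^2=q_j$, $q_iq_j=0$ for $i\ne j$, $q_jPq_j=\frac12q_j$, $\sum_{j=1}^6 q_j=1$. $Y(6)$ is the GIT moduli space of its 6-dimensional representations with $P$ a rank 3 projector and each $q_j$ a rank 1 projector. The involution $\sigma':Y(6)\to Y(6)$ is induced by $P\mapsto1-P$, $q_j\mapsto q_j$. The map $g:X(3,6)/S_3\to Y(6)$ is induced by $A(6)\to B_{3,6}$, $P\mapsto p_1+p_2+p_3$, $q_j\mapsto q_j$. - $A_3$: generators $P,q_1,q_2,q_3$; relations $P^2=P$, $q_j^2=q_j$, $q_iq_j=0$ for $i\neq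 j$, $q_jPq_j=\frac12q_j$. $Y$ is the GIT moduli space of its 6-dimensional representations with $P$ of rank 3 and each $q_j$ of rank 1; $\sigma:Y\to Y$ is induced by $P\mapsto 1-P$, $q_j\mapsto q_j$. - $C$: generators $P,Q$; relations $P^2=P$, $Q^2=Q$. $S$ is the GIT moduli space of its 6-dimensional representations with $P,Q$ of rank 3 and $\mathrm{Tr}\,PQ=\frac32$. The fiber product $Y\times_SY$ is formed with respect to the map $Y\to S$ induced by $P\mapsto P,\ Q\mapsto q_1+q_2+q_3$ on the first factor and the map induced by $P\mapsto P,\ Q\mapsto1-q_1-q_2-q_3$ on the second. The involution $(\sigma,\sigma)$ acts on $Y\times_SY$. Let $\varphi_0:X(3,6)/S_3\to Y\times_SY$ be the morphism sending a representation of $B_{3,6}$ to the pair of representations of $A_3$ given by $(p_1+p_2+p_3;q_1,q_2,q_3)$ and $(p_1+p_2+p_3;q_4,q_5,q_6)$. The morphism $\varphi_0$ maps some nonempty Zariski open subset of $X(3,6)/S_3$ isomorphically onto its image, and its image contains a nonempty Zariski open subset invariant under $(\sigma,\sigma)$. Hence there is a unique involution $\pi$, defined on a nonempty Zariski open subset of $X(3,6)/S_3$, with $\varphi_0\pi=(\sigma,\sigma)\varphi_0$; this is the $\pi$ of the claim. *)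

(* Defs.v *)
From mathcomp Require Import all_boot all_order all_algebra perm.

Set Implicit Arguments.
Unset Strict Implicit.
Unset Printing Implicit Defensive.

Import GRing.Theory.
Local Open Scope ring_scope.

(* Affine varieties over an algebraically closed field, given by a carrier and *)
(* an algebra of F-valued functions on it.  The carrier may be redundant: the  *)
(* points of the variety are the classes of [eqpt], two elements being the     *)
(* same point when no regular function separates them.  An affine GIT quotient *)
(* V // G is thus V itself with F[V] replaced by F[V]^G: for G reductive       *)
(* V -> Spec F[V]^G is onto, and its fibres are the classes of [eqpt].         *)
Section Geometry.

Variable F : closedFieldType.

Record variety := Variety {
  pt :> Type;
  reg : (pt -> F) -> Prop }.

Definition eqpt (X : variety) (x y : X) : Prop :=
  forall f, reg f -> f x = f y.

(* The subalgebra of functions generated by G; [gen_ext] only spares the use  *)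
(* of functional extensionality.                                              *)
Inductive gen_alg (T : Type) (G : (T -> F) -> Prop) : (T -> F) -> Prop :=
| gen_in f : G f -> gen_alg G f
| gen_const c : gen_alg G (fun=> c)
| gen_add f g : gen_alg G f -> gen_alg G g -> gen_alg G (fun x => f x + g x)
| gen_mul f g : gen_alg G f -> gen_alg G g -> gen_alg G (fun x => f x * g x)
| gen_ext f g : f =1 g -> gen_alg G f -> gen_alg G g.

Definition quotient (X : variety) (orb : X -> X -> Prop) : variety :=
  @Variety X (fun f => reg f /\ forall x y, orb x y -> f x = f y).

Definition morphism (X Y : variety) (h : X -> Y) : Prop :=
  forall f, reg f -> reg (fun x => f (h x)).

Definition zopen (X : variety) (U : X -> Prop) : Prop :=
  exists D : (X -> F) -> Prop, (forall f, D f -> reg f) /\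
    forall x, U x <-> exists2 f, D f & f x <> 0.

Definition open_in (X : variety) (E W : X -> Prop) : Prop :=
  exists2 O : X -> Prop, zopen O & forall x, W x <-> E x /\ O x.

Definition nonempty (T : Type) (U : T -> Prop) : Prop := exists x, U x.

Definition irreducible (X : variety) : Prop :=
  nonempty (fun _ : X => True) /\
  forall U V : X -> Prop, zopen U -> zopen V -> nonempty U -> nonempty V ->
    nonempty (fun x => U x /\ V x).

(* [h], of which only the values on E matter, is a morphism from E (with the  *)
(* structure induced from X) to Y: pulled back functions are locally on E     *)
(* quotients of regular functions.                                            *)
Definition regular_on (X Y : variety) (E : X -> Prop) (h : X -> Y) : Prop :=
  forall f : Y -> F, reg f -> forall x, E x ->
    exists a b : X -> F, [/\ reg a, reg b, b x <> 0 &
      forall z, E z -> b z <> 0 -> f (h z) = a z / b z].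

Definition image_of (X Y : variety) (h : X -> Y) (U : X -> Prop) : Y -> Prop :=
  fun y => exists2 x, U x & eqpt (h x) y.

Definition iso_onto_image (X Y : variety) (U : X -> Prop) (h : X -> Y) : Prop :=
  regular_on U h /\
  exists k : Y -> X, [/\ regular_on (image_of h U) k,
    forall y, image_of h U y -> U (k y) & forall x, U x -> eqpt (k (h x)) x].

(* Equality, as rational maps, of maps regular on the open set U.             *)
Definition eq_ratmap (X Y : variety) (U : X -> Prop) (h k : X -> Y) : Prop :=
  exists W : X -> Prop, [/\ zopen W, nonempty W,
    forall x, W x -> U x & forall x, W x -> eqpt (h x) (k x)].

Definition involution_on (X : variety) (U : X -> Prop) (h : X -> X) : Prop :=
  [/\ regular_on U h, forall x, U x -> U (h x)
    & forall x, U x -> eqpt (h (h x)) x].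

(* The reduced fibre product: its algebra is the image of F[X] (x) F[Y].      *)
Definition fprod (X Y Z : variety) (a : X -> Z) (b : Y -> Z) : variety :=
  @Variety {z : X * Y | eqpt (a z.1) (b z.2)}
    (gen_alg (fun f => (exists2 u : X -> F, reg u & forall z, f z = u (sval z).1)
                    \/ (exists2 v : Y -> F, reg v & forall z, f z = v (sval z).2))).

Lemma eqpt_refl (X : variety) (x : X) : eqpt x x.
Proof. by []. Qed.

Lemma morphism_eqpt (X Y : variety) (h : X -> Y) (x y : X) :
  morphism h -> eqpt x y -> eqpt (h x) (h y).
Proof. by move=> mh xy f rf; apply: (xy (fun x => f (h x))); apply: mh. Qed.

Lemma gen_alg_comp (S T : Type) (G : (T -> F) -> Prop) (H : (S -> F) -> Prop)
    (h : S -> T) :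
  (forall f, G f -> gen_alg H (fun x => f (h x))) ->
  forall f, gen_alg G f -> gen_alg H (fun x => f (h x)).
Proof.
move=> GH f; elim=> {f} [f /GH //|c|f g _ fH _ gH|f g _ fH _ gH|f g fg _ fH].
- exact: gen_const.
- exact: (gen_add fH gH).
- exact: (gen_mul fH gH).
- by apply: (gen_ext _ fH) => x; apply: fg.
Qed.

Lemma gen_alg_sum (T I : Type) (G : (T -> F) -> Prop) (r : seq I) (f : I -> T -> F) :
  (forall i, gen_alg G (f i)) -> gen_alg G (fun x => \sum_(i <- r) f i x).
Proof.
move=> Gf; elim: r => [|i r IH].
  by apply: (gen_ext _ (gen_const G 0)) => x; rewrite big_nil.
by apply: (gen_ext _ (gen_add (Gf i) IH)) => x; rewrite big_cons.
Qed.

End Geometry.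

Arguments reg {F v}.

Lemma mxtrace_idem (K : fieldType) n (A : 'M[K]_n) :
  A *m A = A -> \tr A = (\rank A)%:R.
Proof.
move=> AA.
move: (col_base A) (row_base A) (col_base_full A) (row_base_free A) (mulmx_base A).
move: (\rank A) => r C D /row_fullP [L LC] /row_freeP [R DR] CD.
suff DC : D *m C = 1%:M by rewrite -CD mxtrace_mulC DC mxtrace1.
have := congr1 (fun B => L *m B *m R) AA.
by rewrite /= -CD !mulmxA LC !mul1mx -!mulmxA DR !mulmx1.
Qed.

Section Representations.

Variable F : closedFieldType.
Hypothesis charF : [pchar F] =i pred0.

Lemma natr_inj_char0 (m n : nat) : m%:R = n%:R :> F -> m = n.
Proof.
have/pcharf0P nat0 := charF.
wlog le_mn : m n / (m <= n)%N.
  by move=> W; case: (leqP m n) => [/W//|/ltnW/W H /esym/H].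
move=> /eqP; rewrite eq_sym -subr_eq0 -natrB // nat0 subn_eq0 => le_nm.
by apply/eqP; rewrite eqn_leq le_mn.
Qed.

Lemma idem_rank (n r : nat) (A : 'M[F]_n) :
  A *m A = A -> \tr A = r%:R -> \rank A = r.
Proof. by move=> AA trA; apply: natr_inj_char0; rewrite -mxtrace_idem. Qed.

(* A representation on F^6 of an algebra presented with generators indexed by *)
(* I is the family of the images of the generators.                           *)
Section RepVariety.

Variables (I : finType) (R : (I -> 'M[F]_6) -> Prop).

Definition entry (f : {x : I -> 'M[F]_6 | R x} -> F) : Prop :=
  exists i a b, forall x, f x = sval x i a b.

Definition rep_variety : variety F := @Variety F {x | R x} (gen_alg entry).

Definition conjugate (x y : rep_variety) : Prop :=
  exists2 u : 'M[F]_6, u \in unitmx &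
    forall i, sval y i = u *m sval x i *m invmx u.

Definition rep_moduli : variety F := quotient conjugate.

Lemma eqpt_rep (x y : rep_moduli) : sval x =1 sval y -> eqpt x y.
Proof.
move=> xy f [_ fconj]; apply: fconj; exists 1%:M; first exact: unitmx1.
by move=> i; rewrite invmx1 mulmx1 mul1mx xy.
Qed.

End RepVariety.

Lemma rep_moduli_morphism (I J : finType) (R : (I -> 'M[F]_6) -> Prop)
    (R' : (J -> 'M[F]_6) -> Prop) (h : rep_moduli R -> rep_moduli R') :
  (forall j a b, gen_alg (@entry I R) (fun x => sval (h x) j a b)) ->
  (forall x y : rep_variety R, conjugate x y ->
     conjugate (h x : rep_variety R') (h y)) ->
  morphism h.
Proof.
move=> hreg hconj f [freg fconj]; split; last by move=> x y /hconj/fconj.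
apply: gen_alg_comp freg => {f fconj} f [j [a [b fE]]].
by apply: (gen_ext _ (hreg j a b)) => x; rewrite fE.
Qed.

Lemma conjmxD n (u A B : 'M[F]_n) :
  u *m (A + B) *m invmx u = u *m A *m invmx u + u *m B *m invmx u.
Proof. by rewrite mulmxDr mulmxDl. Qed.

Lemma conjmxB n (u A B : 'M[F]_n) :
  u *m (A - B) *m invmx u = u *m A *m invmx u - u *m B *m invmx u.
Proof. by rewrite mulmxBr mulmxBl. Qed.

Lemma conjmx1 n (u : 'M[F]_n) : u \in unitmx -> u *m 1%:M *m invmx u = 1%:M.
Proof. by move=> uU; rewrite mulmx1 mulmxV. Qed.

Lemma conjmx_sum n (T : finType) (u : 'M[F]_n) (A : T -> 'M[F]_n) :
  u *m (\sum_i A i) *m invmx u = \sum_i u *m A i *m invmx u.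
Proof. by rewrite mulmx_sumr mulmx_suml. Qed.

Lemma gen_entry_sum (T0 : Type) (G : (T0 -> F) -> Prop) (T : finType)
    (A : T -> T0 -> 'M[F]_6) a b :
  (forall t, gen_alg G (fun x => A t x a b)) ->
  gen_alg G (fun x => (\sum_t A t x) a b).
Proof.
move=> GA; apply: (gen_ext _ (gen_alg_sum (index_enum T) GA)) => x.
by rewrite summxE.
Qed.

Lemma gen_entry_compl (T0 : Type) (G : (T0 -> F) -> Prop) (A : T0 -> 'M[F]_6) a b :
  gen_alg G (fun x => A x a b) -> gen_alg G (fun x => (1%:M - A x) a b).
Proof.
move=> GA.
apply: (gen_ext _ (gen_add (gen_const G (1%:M a b)) (gen_mul (gen_const G (-1)) GA))).
by move=> x; rewrite !mxE mulN1r.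
Qed.

(* Generators of B_{3,6}: [inl i] is p_i, [inr j] is q_j. *)

Definition B36_rep (x : 'I_3 + 'I_6 -> 'M[F]_6) : Prop :=
  let p i := x (inl i) in let q j := x (inr j) in
  [/\ (forall i, p i *m p i = p i) /\ (forall j, q j *m q j = q j),
      (forall i i', i != i' -> p i *m p i' = 0) /\
        (forall j j', j != j' -> q j *m q j' = 0),
      (forall i j, p i *m q j *m p i = 6^-1 *: p i) /\
        (forall i j, q j *m p i *m q j = 6^-1 *: q j),
      \sum_j q j = 1%:M
    & (forall i, \rank (p i) = 1%N) /\ (forall j, \rank (q j) = 1%N)].

Definition X36 : variety F := rep_moduli B36_rep.

(* 'S_3 acts on representatives, relabelling the p_i; the second quotient is  *)
(* X(3,6) with its algebra of functions replaced by the S_3-invariants.       *)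
Definition S3_orbit (x y : X36) : Prop :=
  exists s : 'S_3, (forall i, sval y (inl i) = sval x (inl (s i))) /\
                   (forall j, sval y (inr j) = sval x (inr j)).

Definition X36_S3 : variety F := quotient S3_orbit.

(* A_3 is n = 3; A(6) is n = 6 with the extra relation \sum_j q_j = 1.        *)
(* Generators: [None] is P, [Some j] is q_j.                                  *)

Definition A_rep (n : nat) (x : option 'I_n -> 'M[F]_6) : Prop :=
  let P := x None in let q j := x (Some j) in
  [/\ P *m P = P /\ (forall j, q j *m q j = q j),
      (forall i j, i != j -> q i *m q j = 0),
      (forall j, q j *m P *m q j = 2^-1 *: q j)
    & \rank P = 3%N /\ (forall j, \rank (q j) = 1%N)].

Definition A6_rep (x : option 'I_6 -> 'M[F]_6) : Prop :=
  A_rep x /\ \sum_j x (Some j) = 1%:M.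

Definition Y_A3 : variety F := rep_moduli (@A_rep 3).
Definition Y_A6 : variety F := rep_moduli A6_rep.

(* Generators of C: [true] is P, [false] is Q. *)

Definition C_rep (x : bool -> 'M[F]_6) : Prop :=
  let P := x true in let Q := x false in
  [/\ P *m P = P, Q *m Q = Q, \rank P = 3%N /\ \rank Q = 3%N
    & \tr (P *m Q) = 3 / 2].

Definition S_C : variety F := rep_moduli C_rep.

Definition compl_tuple (n : nat) (x : option 'I_n -> 'M[F]_6) :
    option 'I_n -> 'M[F]_6 :=
  fun i => if i is Some j then x (Some j) else 1%:M - x None.

Lemma natF_neq0 n : (n.+1%:R : F) != 0.
Proof. by have/pcharf0P -> := charF. Qed.

Lemma idem_compl n (P : 'M[F]_n) : P *m P = P ->
  (1%:M - P) *m (1%:M - P) = 1%:M - P.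
Proof. by move=> PP; rewrite mulmxBr mulmx1 mulmxBl mul1mx PP subrr subr0. Qed.

Lemma rank3_compl (P : 'M[F]_6) : P *m P = P -> \rank P = 3%N ->
  \rank (1%:M - P) = 3%N.
Proof.
move=> PP rP; apply: idem_rank; first exact: idem_compl.
by rewrite raddfB /= mxtrace1 (mxtrace_idem PP) rP -natrB.
Qed.

Lemma half_compl : 1 - 2^-1 = 2^-1 :> F.
Proof. by rewrite -[X in X - _](@mulfV _ 2%:R) ?natF_neq0 // mulrDl mul1r addrK. Qed.

Lemma A_compl n (x : option 'I_n -> 'M[F]_6) : A_rep x -> A_rep (compl_tuple x).
Proof.
case=> -[PP qq] qq0 qPq [rP rq]; split=> //=.
- by split=> //; apply: idem_compl.
- move=> j; rewrite mulmxBr mulmx1 mulmxBl qq qPq -{1}[x (Some j)]scale1r -scalerBl.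
  by rewrite half_compl.
- by split=> //; apply: rank3_compl.
Qed.

Lemma A6_compl (x : option 'I_6 -> 'M[F]_6) : A6_rep x -> A6_rep (compl_tuple x).
Proof. by case=> /A_compl. Qed.

Definition sigma (y : Y_A3) : Y_A3 := exist _ _ (A_compl (proj2_sig y)).
Definition sigma' (y : Y_A6) : Y_A6 := exist _ _ (A6_compl (proj2_sig y)).

Lemma compl_tuple_gen n (R : (option 'I_n -> 'M[F]_6) -> Prop) i a b :
  gen_alg (@entry _ R) (fun x => compl_tuple (sval x) i a b).
Proof.
case: i => [j|]; first by apply: gen_in; exists (Some j), a, b.
by apply: gen_entry_compl; apply: gen_in; exists None, a, b.
Qed.

Lemma sigma_morphism : morphism sigma.
Proof.
apply: rep_moduli_morphism => [i a b|x y [u uU xy]]; first exact: compl_tuple_gen.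
by exists u => // -[j|] /=; rewrite xy // conjmxB conjmx1.
Qed.

Lemma sigma'_morphism : morphism sigma'.
Proof.
apply: rep_moduli_morphism => [i a b|x y [u uU xy]]; first exact: compl_tuple_gen.
by exists u => // -[j|] /=; rewrite xy // conjmxB conjmx1.
Qed.

Section ToS.

Variables (x : option 'I_3 -> 'M[F]_6) (Ax : A_rep x).

Let P := x None.
Let Q := \sum_j x (Some j).

Lemma sumq_idem : Q *m Q = Q.
Proof.
case: Ax => -[_ qq] qq0 _ _.
rewrite mulmx_suml; apply: eq_bigr => i _; rewrite mulmx_sumr (bigD1 i) //= qq.
by rewrite big1 ?addr0 // => j ji; apply: qq0; rewrite eq_sym.
Qed.

Lemma sumq_tr : \tr Q = 3.
Proof.
case: Ax => -[_ qq] _ _ [_ rq].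
rewrite raddf_sum /= (eq_bigr (fun=> 1)) ?sumr_const ?card_ord // => j _.
by rewrite mxtrace_idem // rq.
Qed.

Lemma sumq_rank : \rank Q = 3%N.
Proof. exact: idem_rank sumq_idem sumq_tr. Qed.

Lemma sumq_trP : \tr (P *m Q) = 3 / 2.
Proof.
case: Ax => -[_ qq] _ qPq [_ rq].
rewrite mulmx_sumr raddf_sum /= (eq_bigr (fun=> 2^-1)) => [|j _].
  by rewrite sumr_const card_ord mulr_natl.
rewrite -(qq j) mulmxA mxtrace_mulC mulmxA qPq mxtraceZ (mxtrace_idem (qq j)) rq.
by rewrite mulr1.
Qed.

Lemma C_of_A : C_rep (fun c => if c then P else Q).
Proof.
case: (Ax) => -[PP _] _ _ [rP _]; split=> //=; first exact: sumq_idem.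
- by split=> //; apply: sumq_rank.
- exact: sumq_trP.
Qed.

Lemma C_of_A_compl : C_rep (fun c => if c then P else 1%:M - Q).
Proof.
case: (Ax) => -[PP _] _ _ [rP _]; split=> //=; first exact: idem_compl sumq_idem.
- by split=> //; apply: rank3_compl sumq_rank; apply: sumq_idem.
- rewrite mulmxBr mulmx1 raddfB /= sumq_trP (mxtrace_idem PP) rP.
  by rewrite -{1}[3%:R]mulr1 -mulrBr half_compl.
Qed.

End ToS.

Definition toS1 (y : Y_A3) : S_C := exist _ _ (C_of_A (proj2_sig y)).
Definition toS2 (y : Y_A3) : S_C := exist _ _ (C_of_A_compl (proj2_sig y)).

Lemma toS1_morphism : morphism toS1.
Proof.
apply: rep_moduli_morphism => [[] a b|x y [u uU xy]] /=.
- by apply: gen_in; exists None, a, b.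
- by apply: gen_entry_sum => j; apply: gen_in; exists (Some j), a, b.
- exists u => // -[] //=; rewrite conjmx_sum; apply: eq_bigr => j _; exact: xy.
Qed.

Lemma toS2_morphism : morphism toS2.
Proof.
apply: rep_moduli_morphism => [[] a b|x y [u uU xy]] /=.
- by apply: gen_in; exists None, a, b.
- apply: gen_entry_compl.
  by apply: gen_entry_sum => j; apply: gen_in; exists (Some j), a, b.
- exists u => // -[] //=; rewrite conjmxB conjmx1 // conjmx_sum.
  by congr (_ - _); apply: eq_bigr => j _; apply: xy.
Qed.

Definition Y_x_Y : variety F := fprod toS1 toS2.

(* (sigma, sigma) preserves the fibre product because P |-> 1 - P, Q |-> Q    *)
(* acts on S_C, compatibly with both maps Y_A3 -> S_C.                        *)
Definition compl_pair (x : bool -> 'M[F]_6) : bool -> 'M[F]_6 :=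
  fun c => if c then 1%:M - x true else x false.

Lemma C_compl (x : bool -> 'M[F]_6) : C_rep x -> C_rep (compl_pair x).
Proof.
case=> PP QQ [rP rQ] trPQ; split=> //=; first exact: idem_compl.
- by split=> //; apply: rank3_compl.
- rewrite mulmxBl mul1mx raddfB /= trPQ (mxtrace_idem QQ) rQ.
  by rewrite -{1}[3%:R]mulr1 -mulrBr half_compl.
Qed.

Definition sigmaS (s : S_C) : S_C := exist _ _ (C_compl (proj2_sig s)).

Lemma sigmaS_morphism : morphism sigmaS.
Proof.
apply: rep_moduli_morphism => [[] a b|x y [u uU xy]] /=.
- by apply: gen_entry_compl; apply: gen_in; exists true, a, b.
- by apply: gen_in; exists false, a, b.
- by exists u => // -[] /=; rewrite xy // conjmxB conjmx1.
Qed.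

Lemma sigma_fprod (z : Y_A3 * Y_A3) :
  eqpt (toS1 z.1) (toS2 z.2) -> eqpt (toS1 (sigma z.1)) (toS2 (sigma z.2)).
Proof.
move=> e f rf.
have E1 : eqpt (toS1 (sigma z.1)) (sigmaS (toS1 z.1)) by apply: eqpt_rep; case.
have E2 : eqpt (toS2 (sigma z.2)) (sigmaS (toS2 z.2)) by apply: eqpt_rep; case.
by rewrite E1 // E2 //; apply: morphism_eqpt rf; [apply: sigmaS_morphism|].
Qed.

Definition sigma_sigma (z : Y_x_Y) : Y_x_Y :=
  exist _ (sigma (sval z).1, sigma (sval z).2) (sigma_fprod (proj2_sig z)).

Section FromX.

Variables (x : 'I_3 + 'I_6 -> 'M[F]_6) (Bx : B36_rep x).

Let P := \sum_i x (inl i).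

Lemma sump_idem : P *m P = P.
Proof.
case: Bx => -[pp _] [pp0 _] _ _ _.
rewrite mulmx_suml; apply: eq_bigr => i _; rewrite mulmx_sumr (bigD1 i) //= pp.
by rewrite big1 ?addr0 // => j ji; apply: pp0; rewrite eq_sym.
Qed.

Lemma sump_rank : \rank P = 3%N.
Proof.
case: Bx => -[pp _] _ _ _ [rp _]; apply: idem_rank sump_idem _.
rewrite raddf_sum /= (eq_bigr (fun=> 1)) ?sumr_const ?card_ord // => j _.
by rewrite mxtrace_idem // rp.
Qed.

Lemma sump_qPq j : x (inr j) *m P *m x (inr j) = 2^-1 *: x (inr j).
Proof.
case: Bx => _ _ [_ qpq] _ _.
rewrite mulmx_sumr mulmx_suml (eq_bigr (fun=> 6^-1 *: x (inr j))) => [|i _] //.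
rewrite sumr_const card_ord -scaler_nat scalerA; congr (_ *: _).
have -> : 6%:R = 3%:R * 2%:R :> F by rewrite -natrM.
by rewrite invfM mulrA divff ?natF_neq0 // mul1r.
Qed.

Definition A_of_B (n : nat) (k : 'I_n -> 'I_6) : option 'I_n -> 'M[F]_6 :=
  fun i => if i is Some j then x (inr (k j)) else P.

Lemma A_of_B_rep (n : nat) (k : 'I_n -> 'I_6) :
  injective k -> A_rep (A_of_B k).
Proof.
case: (Bx) => -[_ qq] [_ qq0] _ _ [_ rq] kI; split=> /=.
- by split=> //; apply: sump_idem.
- by move=> i j ij; apply: qq0; rewrite (inj_eq kI).
- by move=> j; apply: sump_qPq.
- by split=> //; apply: sump_rank.
Qed.

Lemma A6_of_B : A6_rep (A_of_B id).
Proof. by split; [apply: A_of_B_rep | case: Bx]. Qed.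

End FromX.

(* q_1, q_2, q_3 and q_4, q_5, q_6, reading 'I_6 as 'I_(3 + 3).               *)
Definition q123 : 'I_3 -> 'I_6 := @lshift 3 3.
Definition q456 : 'I_3 -> 'I_6 := @rshift 3 3.

Lemma q123_inj : injective q123. Proof. exact: (@lshift_inj 3 3). Qed.
Lemma q456_inj : injective q456. Proof. exact: (@rshift_inj 3 3). Qed.

Definition g_map (x : X36_S3) : Y_A6 := exist _ _ (A6_of_B (proj2_sig x)).

Definition left_half (x : X36_S3) : Y_A3 :=
  exist _ _ (A_of_B_rep (proj2_sig x) q123_inj).
Definition right_half (x : X36_S3) : Y_A3 :=
  exist _ _ (A_of_B_rep (proj2_sig x) q456_inj).

Lemma halves_fprod (x : X36_S3) :
  eqpt (toS1 (left_half x)) (toS2 (right_half x)).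
Proof.
apply: eqpt_rep; case=> //=.
case: (proj2_sig x) => _ _ _ sq _.
by apply/eqP; rewrite eq_sym subr_eq -sq (@big_split_ord _ _ _ 3 3).
Qed.

Definition phi0 (x : X36_S3) : Y_x_Y :=
  exist _ (left_half x, right_half x) (halves_fprod x).

Lemma from_X_morphism n (R : (option 'I_n -> 'M[F]_6) -> Prop)
    (h : X36_S3 -> rep_moduli R) (k : 'I_n -> 'I_6) :
  (forall x i, sval (h x) i = A_of_B (sval x) k i) -> morphism h.
Proof.
move=> hE f rf; split.
  suff m : morphism (h : X36 -> rep_moduli R) by apply: m.
  apply: rep_moduli_morphism => [i a b|x y [u uU xy]].
    apply: (@gen_ext _ _ _ (fun x => A_of_B (sval x) k i a b)).
      by move=> x; rewrite hE.
    case: i => [j|]; first by apply: gen_in; exists (inr (k j)), a, b.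
    by apply: gen_entry_sum => i; apply: gen_in; exists (inl i), a, b.
  exists u => // -[j|]; rewrite !hE /= ?xy // conjmx_sum.
  by apply: eq_bigr => i _; apply: xy.
move=> x y [s [yp yq]]; apply: (eqpt_rep _ rf) => -[j|]; rewrite !hE /=.
  by rewrite yq.
rewrite (reindex_inj (@perm_inj _ s)) /=; apply: eq_bigr => i _.
by rewrite yp.
Qed.

Lemma g_map_morphism : morphism g_map.
Proof. exact: (@from_X_morphism 6 _ _ id). Qed.

Lemma phi0_morphism : morphism phi0.
Proof.
have mL : morphism left_half by apply: (@from_X_morphism 3 _ _ q123).
have mR : morphism right_half by apply: (@from_X_morphism 3 _ _ q456).
move=> f; elim=> {f} [f|c|f1 f2 _ [r1 i1] _ [r2 i2]|f1 f2 _ [r1 i1] _ [r2 i2]|].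
- case=> -[u ru fE].
  + have [[r c] i] := mL _ ru; split; last by move=> x y /i; rewrite !fE.
    split; last by move=> x y /c; rewrite !fE.
    by apply: (gen_ext _ r) => x; rewrite fE.
  + have [[r c] i] := mR _ ru; split; last by move=> x y /i; rewrite !fE.
    split; last by move=> x y /c; rewrite !fE.
    by apply: (gen_ext _ r) => x; rewrite fE.
- by split=> //; split=> //; apply: gen_const.
- case: r1 r2 => r1 c1 [r2 c2]; split; last by move=> x y xy /=; rewrite (i1 x y) // (i2 x y).
  by split; [apply: gen_add | move=> x y xy /=; rewrite (c1 x y) // (c2 x y)].
- case: r1 r2 => r1 c1 [r2 c2]; split; last by move=> x y xy /=; rewrite (i1 x y) // (i2 x y).
  by split; [apply: gen_mul | move=> x y xy /=; rewrite (c1 x y) // (c2 x y)].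
- move=> f1 f2 e _ [[r c] i]; split; last by move=> x y /i; rewrite !e.
  split; last by move=> x y /c; rewrite !e.
  by apply: (gen_ext _ r) => x; apply: e.
Qed.

End Representations.

(* Main.v *)
(* A representation of B_{3,6} is, up to conjugation, q_j = E_jj and
   p_i = (x_ik / (6 x_ij))_jk for a 3 x 6 matrix x = (E B) with
   sum_j x_ij / x_kj = 0 for i <> k.  The key point is that a generic x has a
   complement: a point y of X(3,6) with the same q_j and with
   sum p_i(y) = 1 - sum p_i(x).  Then phi_0(y) = (sigma, sigma) phi_0(x), which
   is also phi_0(pi(x)); since phi_0 is birational onto its image, y = pi(x), so
   that g(pi(x)) = g(y) = sigma'(g(x)).

   To find y, look for two commuting traceless operators on the image of 1 - P
   whose matrices have zero diagonal: their common spectral projectors are then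
   three projectors of constant diagonal 1/6.  The first three diagonal entries
   vanish by construction, with an explicit family of operators R depending on
   the column Gram matrix t of the missing block and on parameters k_z which are
   the roots of alpha k^2 + gamma k + beta mu = 0.  The row structure of B
   provides one square root of the common discriminant gamma^2 - 4 alpha beta mu
   (which is the same for rows and columns of E), and with this choice the last
   three diagonal entries vanish as well.  The identities between Laurent
   polynomials in the entries of E or B are checked by computation. *)
Require Import Defs.
From Stdlib Require Import ZArith.
From Stdlib Require QArith Qreduction.
From mathcomp Require Import all_boot all_order all_algebra perm.
From mathcomp Require Import ssrZ ring.

Set Implicit Arguments.
Unset Strict Implicit.
Unset Printing Implicit Defensive.

Import GRing.Theory.
Local Open Scope ring_scope.

(** * Laurent polynomials *)

(** Why constant diagonals: the j-th diagonal entries of the three projectors form a vector of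
    length 3. If the two operators have zero diagonal, this vector is orthogonal to their two
    eigenvalue vectors, which are traceless and generically independent; so it is constant, and it
    sums to the entry 1/2 of 1 - P. The last three diagonal entries of an operator are treated in
    the same way: they are orthogonal to the eigenvalues of two operators L, built by the formula of
    R from the row Gram matrix of B, with the columns of the entrywise inverse of B as eigenvectors;
    hence they are equal, and the trace makes them 0. The obstacle is that the orthogonality
    involves E and B at once. But B enters only through its row Gram matrix, which E determines, and
    through the roots l of quadratic equations over E. Relations between k and l remove the products
    k l, and what remains are identities in the nine entries of E alone. This costs divisions. All
    the quantities that must not vanish are multiplied into one polynomial; as X(3,6) is
    irreducible, a single rational point shows that it is not identically zero. *)

(* Laurent polynomials in n variables: lists of (exponent of the first variable, *)
(* coefficient), by increasing exponents, the coefficients being Laurent         *)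
(* polynomials in the other variables.                                           *)
Fixpoint lpoly (n : nat) : Type :=
  if n is m.+1 then seq (Z * lpoly m) else Z.

(** Zero is not always the empty list, since [lconst] keeps a zero coefficient; hence a recursive
    test, of which only the soundness [lev0] is used. *)
Fixpoint lzero (n : nat) : lpoly n -> bool :=
  match n return lpoly n -> bool with
  | 0 => Z.eqb 0
  | m.+1 => all (fun t => lzero t.2)
  end.

Definition ladd_seq (T : Type) (add : T -> T -> T) (is0 : T -> bool) :=
  fix add1 (p q : seq (Z * T)) {struct p} : seq (Z * T) :=
  if p is (d, a) :: p' then
    (fix add2 (q : seq (Z * T)) : seq (Z * T) :=
      if q is (e, b) :: q' then
        match Z.compare d e with
        | Lt => (d, a) :: add1 p' q
        | Gt => (e, b) :: add2 q'
        | Eq => let c := add a b in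
                if is0 c then add1 p' q' else (d, c) :: add1 p' q'
        end
      else p) q
  else q.

Fixpoint ladd (n : nat) : lpoly n -> lpoly n -> lpoly n :=
  match n return lpoly n -> lpoly n -> lpoly n with
  | 0 => Z.add
  | m.+1 => ladd_seq (@ladd m) (@lzero m)
  end.

Fixpoint lmul (n : nat) : lpoly n -> lpoly n -> lpoly n :=
  match n return lpoly n -> lpoly n -> lpoly n with
  | 0 => Z.mul
  | m.+1 => fun p q =>
      foldr (fun t => ladd (n := m.+1) [seq (Z.add t.1 s.1, lmul t.2 s.2) | s <- q])
        [::] p
  end.

Fixpoint lopp (n : nat) : lpoly n -> lpoly n :=
  match n return lpoly n -> lpoly n with
  | 0 => Z.opp
  | m.+1 => map (fun t => (t.1, lopp t.2))
  end.

Fixpoint lconst (n : nat) (z : Z) : lpoly n :=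
  if n is m.+1 then [:: (Z0, lconst m z)] else z.

Fixpoint lvar (n i : nat) (d : Z) : lpoly n :=
  match n return lpoly n with
  | 0 => Zpos xH
  | m.+1 => if i is j.+1 then [:: (Z0, lvar m j d)] else [:: (d, lconst m (Zpos xH))]
  end.

Section Eval.
Variable F : fieldType.
Definition Z_to_F (z : Z) : F := (int_of_Z z)%:~R.
Lemma Z_to_FD a b : Z_to_F (a + b) = Z_to_F a + Z_to_F b.
Proof. by rewrite /Z_to_F -intrD -rmorphD. Qed.
Lemma Z_to_FM a b : Z_to_F (a * b) = Z_to_F a * Z_to_F b.
Proof. by rewrite /Z_to_F -intrM -rmorphM. Qed.
Lemma Z_to_FN a : Z_to_F (- a) = - Z_to_F a.
Proof. by rewrite /Z_to_F -intrN -rmorphN. Qed.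

Fixpoint lev (v : nat -> F) (n : nat) : lpoly n -> F :=
  match n return lpoly n -> F with
  | 0 => Z_to_F
  | m.+1 => fun p => \sum_(t <- p) v 0%N ^ int_of_Z t.1 * lev (fun i => v i.+1) t.2
  end.

Lemma lev0 n v (p : lpoly n) : lzero p -> lev v p = 0.
Proof.
elim: n v p => [|n IH] v p /=; first by case: p.
elim: p => [|t p IHp] /=; first by rewrite big_nil.
by move=> /andP[/IH t0 /IHp p0]; rewrite big_cons p0 t0 mulr0 addr0.
Qed.

Lemma levD n (p q : lpoly n) v : lev v (ladd p q) = lev v p + lev v q.
Proof.
elim: n p q v => [|n IH] p q v /=; first exact: Z_to_FD.
elim: p q => [|[d a] p IHp] q; first by rewrite big_nil add0r.
elim: q => [|[e b] q IHq]; first by rewrite big_nil addr0.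
cbn [ladd_seq]; rewrite 2!big_cons.
case: Z.compare_spec => [->|de|ed] /=.
- case: ifP => [/(lev0 (fun i => v i.+1)) ab0|_].
    by rewrite addrACA -mulrDr -IH ab0 mulr0 add0r IHp.
  by rewrite big_cons IHp IH /= mulrDr addrACA.
- by rewrite big_cons IHp big_cons addrA.
- by rewrite big_cons IHq big_cons /= addrCA.
Qed.

Lemma levN n (p : lpoly n) v : lev v (lopp p) = - lev v p.
Proof.
elim: n p v => [|n IH] p v /=; first exact: Z_to_FN.
by rewrite big_map -sumrN; apply: eq_bigr => t _; rewrite IH mulrN.
Qed.

(** Exponents of opposite signs may be added, so the variables must be invertible. *)
Lemma levM n (p q : lpoly n) v : (forall i, (i < n)%N -> v i != 0) ->
  lev v (lmul p q) = lev v p * lev v q.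
Proof.
elim: n p q v => [|n IH] p q v v0; first exact: Z_to_FM.
have {}IH a b : lev (fun i => v i.+1) (lmul a b) = _ := IH a b _ (fun i => v0 i.+1).
elim: p => [|t p IHp] /=; first by rewrite big_nil mul0r.
etransitivity; first exact: (levD (n := n.+1)).
rewrite big_cons mulrDl -IHp /=; congr (_ + _); rewrite big_map mulr_sumr; apply: eq_bigr => s _ /=.
by rewrite IH rmorphD expfzDr ?v0 // mulrACA.
Qed.

Lemma lev_const n z v : lev v (lconst n z) = Z_to_F z.
Proof. by elim: n v => [|n IH] v //=; rewrite big_seq1 IH expr0z mul1r. Qed.

Lemma lev_var n i d v : (i < n)%N -> lev v (lvar n i d) = v i ^ int_of_Z d.
Proof.
elim: n i v => [//|n IH] [|i] v lt_in /=; rewrite big_seq1 /=.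
  by rewrite lev_const mulr1.
by rewrite IH // expr0z mul1r.
Qed.
End Eval.

(** * Formulas and their identities *)

Fixpoint llead (n : nat) : lpoly n -> lpoly n :=
  match n return lpoly n -> lpoly n with
  | 0 => id
  | m.+1 => fun p => if p is (d, a) :: _ then [:: (d, llead a)] else [::]
  end.

Fixpoint lquo1 (n : nat) : lpoly n -> lpoly n -> lpoly n :=
  match n return lpoly n -> lpoly n -> lpoly n with
  | 0 => Z.div
  | m.+1 => fun p q => if (p, q) is ((d, a) :: _, (e, b) :: _)
                       then [:: (Z.sub d e, lquo1 a b)] else [::]
  end.

(* The quotient only when the division is exact and the fuel k suffices: the    *)
(* result is always checked by multiplying back.                                *)
Fixpoint ldiv (k n : nat) (p q : lpoly n) : lpoly n :=
  if k is k'.+1 then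
    if lzero p then p else
    let m := lquo1 (llead p) (llead q) in
    ladd m (ldiv k' (ladd p (lopp (lmul m q))) q)
  else p.

Inductive I3 := i0 | i1 | i2.

(* The formulas of the proof are evaluated in the base field, on Laurent        *)
(* polynomials and on rational numbers (to decide identities and nonvanishing   *)
(* by computation), and on regular functions: only operations are needed.       *)
Record ops := Ops {
  car :> Type;
  oadd : car -> car -> car;
  omul : car -> car -> car;
  oopp : car -> car;
  onat : nat -> car }.

Arguments onat : clear implicits.

Declare Scope ops_scope.
Delimit Scope ops_scope with O.
Bind Scope ops_scope with car.
Notation "x + y" := (oadd x y) : ops_scope.
Notation "x * y" := (omul x y) : ops_scope.
Notation "- x" := (oopp x) : ops_scope.
Notation "x - y" := (oadd x (oopp y)) : ops_scope.

(* Computes each value of t once. *)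
Definition memo (T : Type) (t : I3 -> I3 -> T) : I3 -> I3 -> T :=
  let a := t i0 i0 in let b := t i0 i1 in let c := t i0 i2 in
  let d := t i1 i0 in let f := t i1 i1 in let g := t i1 i2 in
  let h := t i2 i0 in let i := t i2 i1 in let j := t i2 i2 in
  fun x y => match x, y with
    | i0, i0 => a | i0, i1 => b | i0, i2 => c
    | i1, i0 => d | i1, i1 => f | i1, i2 => g
    | i2, i0 => h | i2, i1 => i | i2, i2 => j end.

Lemma memoE T (t : I3 -> I3 -> T) i j : memo t i j = t i j.
Proof. by case: i j => -[]. Qed.

Section Formulas.
Variable A : ops.
Local Open Scope ops_scope.
Local Notation "n %:c" := (onat A n) (at level 2, format "n %:c").
Implicit Types (e ei t : I3 -> I3 -> A).

(* Throughout, ei stands for the entrywise inverse of the matrix e.             *)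
Definition sum3 (f : I3 -> A) := f i0 + f i1 + f i2.

(** The Gram matrix of the rows for the pairing of a row with the entrywise inverse of another. *)
Definition rowgram e ei : I3 -> I3 -> A :=
  fun m n => sum3 (fun j => e m j * ei n j).
(** A literal 3 avoids cancelling [e] against [ei] on the diagonal; since 6 - 3 = 3, it serves the
    Gram matrix of either block. *)
Definition diag3 t : I3 -> I3 -> A := fun i j => match i, j with
  | i0, i0 | i1, i1 | i2, i2 => 3%:c | _, _ => t i j end.
Definition transp t : I3 -> I3 -> A := fun i j => t j i.
Definition opp_fun t : I3 -> I3 -> A := fun i j => - t i j.

(* Let t x y = sum_i M i x / M i y for a 3 x 3 matrix M, and put               *)
(* k z = K_z perm(1/M), l z = perm(M) / K_z, where K_z is the product of        *)
(* column z.  With beta = alpha of the transpose, {x, y, z} = {0, 1, 2}:        *)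
(*   alpha k z + beta l z + gamma = 0 and k z * l z = mu,                       *)
(* and j = 2 alpha k z + gamma is the same for all z.                           *)
Definition alpha t x y z :=
  3%:c * (t x z * t y z) + t x z * t x z * t y x + t y z * t y z * t x y
  - t x z * t y z * (t x y * t y x).

Definition sig2 t := t i0 i1 * t i1 i0 + t i0 i2 * t i2 i0 + t i1 i2 * t i2 i1.
Definition sig3 t :=
  t i0 i1 * t i1 i2 * t i2 i0 + t i0 i2 * t i2 i1 * t i1 i0.
Definition mu t := 9%:c - sig2 t + sig3 t.
(** The determinant of [t] when its diagonal is 3. *)
Definition gdet t := 27%:c - 3%:c * sig2 t + sig3 t.

Definition gamma t x y z :=
  let a := t x z * t z x in let b := t y z * t z y in let c := t x y * t y x in
  let s := t x y * t y z * t z x + t x z * t z y * t y x in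
  a * a + b * b - c * c + a * b - a * c - b * c - 9%:c * (a + b - c)
  - (3%:c + a + b - c) * s + a * b * c.

Definition rmat0 t : I3 -> I3 -> A := fun i j => match i, j with
  | i0, i0 => 3%:c * (t i0 i1 * t i1 i0 + t i0 i2 * t i2 i0)
           - t i0 i1 * t i1 i2 * t i2 i0 - t i0 i2 * t i2 i1 * t i1 i0
  | i0, i1 => 3%:c * (t i0 i2 * t i2 i1 - 3%:c * t i0 i1)
  | i0, i2 => 3%:c * (t i0 i1 * t i1 i2 - 3%:c * t i0 i2)
  | i1, i0 => 3%:c * (t i1 i2 * t i2 i0 + 3%:c * t i1 i0)
  | i1, i1 => 2%:c * (t i0 i2 * t i2 i1 * t i1 i0)
           - t i0 i1 * t i1 i2 * t i2 i0 - 3%:c * (t i0 i1 * t i1 i0)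
  | i1, i2 => - (6%:c * (t i0 i2 * t i1 i0))
  | i2, i0 => 3%:c * (t i2 i1 * t i1 i0 + 3%:c * t i2 i0)
  | i2, i1 => - (6%:c * (t i0 i1 * t i2 i0))
  | i2, i2 => 2%:c * (t i0 i1 * t i1 i2 * t i2 i0)
           - t i0 i2 * t i2 i1 * t i1 i0 - 3%:c * (t i0 i2 * t i2 i0)
  end.

(* For M, t, k as above, rmat t 1 (k 1) (k 2) has the rows of M as eigenvectors;   *)
(* d is a homogenising factor.  lR0, lR1, lR2 list the coefficients of d, k1, k2. *)
Definition rmat t d k1 k2 : I3 -> I3 -> A := fun i j => match i, j with
  | i1, i0 => d * rmat0 t i1 i0 - k1 * (3%:c * t i2 i1)
  | i1, i2 => d * rmat0 t i1 i2 + k1 * (3%:c * t i0 i1)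
  | i2, i0 => d * rmat0 t i2 i0 - k2 * (3%:c * t i1 i2)
  | i2, i1 => d * rmat0 t i2 i1 + k2 * (3%:c * t i0 i2)
  | _, _ => d * rmat0 t i j
  end.

Definition lR0 t : seq (I3 * I3 * A) :=
  [:: (i0, i0, rmat0 t i0 i0); (i0, i1, rmat0 t i0 i1); (i0, i2, rmat0 t i0 i2);
      (i1, i0, rmat0 t i1 i0); (i1, i1, rmat0 t i1 i1); (i1, i2, rmat0 t i1 i2);
      (i2, i0, rmat0 t i2 i0); (i2, i1, rmat0 t i2 i1); (i2, i2, rmat0 t i2 i2)].
Definition lR1 t : seq (I3 * I3 * A) :=
  [:: (i1, i0, - (3%:c * t i2 i1)); (i1, i2, 3%:c * t i0 i1)].
Definition lR2 t : seq (I3 * I3 * A) :=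
  [:: (i2, i0, - (3%:c * t i1 i2)); (i2, i1, 3%:c * t i0 i2)].

Definition lsum (s : seq A) : A :=
  if s is a :: s' then foldl (@oadd A) a s' else 0%:c.

Definition pairing e ei (R L : seq (I3 * I3 * A)) : A :=
  lsum [seq lsum [seq r.2 * (e l.1.1 r.1.2 * ei l.1.2 r.1.1) | r <- R] * l.2 | l <- L].

(* gamma of the columns minus gamma of the rows of e (with opposite signs off     *)
(* the diagonal) is 2 mu link; this ties k for the columns to l for the rows.   *)
Definition link e ei z c1 c2 m r1 r2 :=
  (e r1 c1 * e r2 c2 + e r1 c2 * e r2 c1) * (ei r1 z * ei r2 z)
  * (e m c2 * e r1 z * ei r1 c2 - e m c1 * e r2 z * ei r2 c1)
  * (e m c2 * e r2 z * ei r2 c2 - e m c1 * e r1 z * ei r1 c1)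
  * (ei m c1 * ei m c2).

Definition perm3 e :=
  e i0 i0 * (e i1 i1 * e i2 i2 + e i1 i2 * e i2 i1)
  + e i0 i1 * (e i1 i0 * e i2 i2 + e i1 i2 * e i2 i0)
  + e i0 i2 * (e i1 i0 * e i2 i1 + e i1 i1 * e i2 i0).

Definition dot2 t t' := sum3 (fun x => sum3 (fun y => t x y * t' y x)).
Definition det3 t :=
  t i0 i0 * (t i1 i1 * t i2 i2 - t i1 i2 * t i2 i1)
  - t i0 i1 * (t i1 i0 * t i2 i2 - t i1 i2 * t i2 i0)
  + t i0 i2 * (t i1 i0 * t i2 i1 - t i1 i1 * t i2 i0).
Definition gram2 t t' := dot2 t t * dot2 t' t' - dot2 t t' * dot2 t t'.
(** For traceless [t], twice the discriminant of the characteristic polynomial. *)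
Definition disc3 t := dot2 t t * dot2 t t * dot2 t t
  - onat A 54 * (det3 t * det3 t).

(** This is k for the matrix M inverse, entry by entry, to the transpose of [e]; the matrix t of
    that M is the transposed row Gram matrix of [e]. *)
Definition lval e ei m := perm3 e * (ei m i0 * ei m i1 * ei m i2).

Section Polys.
Variables (e ei tG tB tC : I3 -> I3 -> A).

Definition gram_polys : seq A :=
  let uu := link e ei i0 i1 i2 i0 i1 i2 in
  let m := mu tC in
  [:: m - mu tB; gamma tC i1 i2 i0 - (gamma tB i1 i2 i0 + 2%:c * m * uu);
    alpha tB i1 i2 i0 * alpha (transp tB) i1 i2 i0
     - alpha tC i1 i2 i0 * alpha (transp tC) i1 i2 i0
     + uu * (gamma tC i1 i2 i0 - m * uu)].

Definition struct_polys : seq A :=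
  let l0 := lval e ei i0 in let l1 := lval e ei i1 in let l2 := lval e ei i2 in
  let R := memo (rmat (transp tG) 1%:c l1 l2) in
  let w l := sum3 (fun m => R i0 m * e i0 l * ei m l) in
  let eig n l := sum3 (fun m => R n m * ei m l) - w l * ei n l in
  [:: alpha (transp tG) i1 i2 i0 * l0 * l0 + gamma tG i1 i2 i0 * l0
          + alpha tG i1 i2 i0 * mu tG;
   2%:c * alpha (transp tG) i1 i2 i0 * l0 + gamma tG i1 i2 i0
       - (2%:c * alpha (transp tG) i0 i2 i1 * l1 + gamma tG i0 i2 i1);
   2%:c * alpha (transp tG) i1 i2 i0 * l0 + gamma tG i1 i2 i0
       - (2%:c * alpha (transp tG) i0 i1 i2 * l2 + gamma tG i0 i1 i2);
   eig i1 i0; eig i1 i1; eig i1 i2; eig i2 i0; eig i2 i1; eig i2 i2].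

Definition pairing_coef x y : A :=
  let sel t c := match c with i0 => lR0 t | i1 => lR1 t | i2 => lR2 t end in
  pairing e ei (sel tC x) (sel (transp tB) y).
Let u11 := link e ei i1 i0 i2 i1 i0 i2.
Let u12 := link e ei i1 i0 i2 i2 i0 i1.
Let u21 := link e ei i2 i0 i1 i1 i0 i2.
Let u22 := link e ei i2 i0 i1 i2 i0 i1.

Definition elim_numers : seq A :=
  [:: pairing_coef i1 i0 * (u11 * u12) + pairing_coef i1 i1 * (alpha tB i0 i2 i1 * u12)
        + pairing_coef i1 i2 * (alpha tB i0 i1 i2 * u11);
      pairing_coef i2 i0 * (u21 * u22) + pairing_coef i2 i1 * (alpha tB i0 i2 i1 * u22)
        + pairing_coef i2 i2 * (alpha tB i0 i1 i2 * u21);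
      pairing_coef i0 i1 * (u11 * u21) - pairing_coef i1 i1 * (alpha (transp tC) i0 i2 i1 * u21)
        - pairing_coef i2 i1 * (alpha (transp tC) i0 i1 i2 * u11);
      pairing_coef i0 i2 * (u12 * u22) - pairing_coef i1 i2 * (alpha (transp tC) i0 i2 i1 * u22)
        - pairing_coef i2 i2 * (alpha (transp tC) i0 i1 i2 * u12)].
Definition elim_denoms : seq A :=
  [:: alpha tC i0 i2 i1; alpha tC i0 i1 i2; alpha (transp tB) i0 i2 i1;
      alpha (transp tB) i0 i1 i2].
(* The pairing is c00 + sum c_x0 k_x + sum c_0y l_y + sum c_xy k_x l_y; after   *)
(* elimination of the products k_x l_y, the coefficients of k_x and l_y become  *)
(* divisible by alpha and beta, with quotients v.                               *)
Definition elim_polys (n v : seq A) : seq A :=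
  if (n, v) is ([:: n1; n2; n1'; n2'], [:: v1; v2; v1'; v2']) then
  [:: n1 - v1 * alpha tC i0 i2 i1; n2 - v2 * alpha tC i0 i1 i2;
      n1' - v1' * alpha (transp tB) i0 i2 i1; n2' - v2' * alpha (transp tB) i0 i1 i2;
      v1 * (u21 * u22) + v2 * (u11 * u12) + v1' * (u12 * u22) + v2' * (u11 * u21);
      pairing_coef i0 i0 * (u21 * u22)
        + mu tC * ((u11 - u21) * v2 + u22 * v1' + u21 * v2')]
  else [::].
End Polys.
End Formulas.

(** * Transport of the formulas along maps preserving the operations *)

Section Hom.
Variables (A B : ops) (h : A -> B).
Definition hom := [/\ {morph h : x y / oadd x y}, {morph h : x y / omul x y},
  {morph h : x / oopp x} & forall n, h (onat A n) = onat B n].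
Hypothesis hh : hom.
Let hD : {morph h : x y / oadd x y}. Proof. by case: hh. Qed.
Let hM : {morph h : x y / omul x y}. Proof. by case: hh. Qed.
Let hN : {morph h : x / oopp x}. Proof. by case: hh. Qed.
Let hK n : h (onat A n) = onat B n. Proof. by case: hh. Qed.
Let homE := (hD, hM, hN, hK).

Definition img (t : I3 -> I3 -> A) (t' : I3 -> I3 -> B) :=
  forall i j, h (t i j) = t' i j.

Lemma rowgram_hom e ei e' ei' : img e e' -> img ei ei' ->
  img (rowgram e ei) (rowgram e' ei').
Proof. by move=> He Hi i j; rewrite /rowgram /sum3 !homE !He !Hi. Qed.

Lemma transp_hom t t' : img t t' -> img (transp t) (transp t').
Proof. by move=> Ht i j; apply: Ht. Qed.

Lemma opp_fun_hom t t' : img t t' -> img (opp_fun t) (opp_fun t').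
Proof. by move=> Ht i j; rewrite /opp_fun hN Ht. Qed.

Lemma diag3_hom t t' : img t t' -> img (diag3 t) (diag3 t').
Proof. by move=> Ht; case=> -[]; rewrite /= ?hK ?Ht. Qed.

Lemma link_hom e ei e' ei' z c1 c2 m r1 r2 : img e e' -> img ei ei' ->
  h (link e ei z c1 c2 m r1 r2) = link e' ei' z c1 c2 m r1 r2.
Proof. by move=> He Hi; rewrite /link !homE !He !Hi. Qed.

Lemma lval_hom e ei e' ei' m : img e e' -> img ei ei' ->
  h (lval e ei m) = lval e' ei' m.
Proof. by move=> He Hi; rewrite /lval /perm3 !homE !He !Hi. Qed.

Lemma dot2_hom t t' s s' : img t t' -> img s s' -> h (dot2 t s) = dot2 t' s'.
Proof. by move=> Ht Hs; rewrite /dot2 /sum3 !homE !Ht !Hs. Qed.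
Lemma gram2_hom t t' s s' : img t t' -> img s s' -> h (gram2 t s) = gram2 t' s'.
Proof.
by move=> Ht Hs; rewrite /gram2 !(dot2_hom Ht Ht, dot2_hom Ht Hs, dot2_hom Hs Hs, homE).
Qed.
Lemma disc3_hom t t' : img t t' -> h (disc3 t) = disc3 t'.
Proof. by move=> Ht; rewrite /disc3 /det3 !(dot2_hom Ht Ht, homE) !Ht. Qed.

Section T.
Variables (t : I3 -> I3 -> A) (t' : I3 -> I3 -> B).
Hypothesis Ht : img t t'.
Lemma alpha_hom x y z : h (alpha t x y z) = alpha t' x y z.
Proof. by rewrite /alpha !homE !Ht. Qed.
Lemma mu_hom : h (mu t) = mu t'.
Proof. by rewrite /mu /sig2 /sig3 !homE !Ht. Qed.
Lemma gdet_hom : h (gdet t) = gdet t'.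
Proof. by rewrite /gdet /sig2 /sig3 !homE !Ht. Qed.
Lemma gamma_hom x y z : h (gamma t x y z) = gamma t' x y z.
Proof. by rewrite /gamma /= !homE !Ht. Qed.
Lemma rmat0_hom : img (rmat0 t) (rmat0 t').
Proof. by case=> -[]; rewrite /rmat0 !homE !Ht. Qed.
Lemma rmat_hom d k1 k2 : img (rmat t d k1 k2) (rmat t' (h d) (h k1) (h k2)).
Proof. by case=> -[]; rewrite /rmat !(rmat0_hom, homE) ?Ht. Qed.
Definition himg (s : seq (I3 * I3 * A)) := [seq (x.1, h x.2) | x <- s].
Lemma lR0_hom : himg (lR0 t) = lR0 t'.
Proof. by rewrite /himg /lR0 -!rmat0_hom. Qed.
Lemma lR1_hom : himg (lR1 t) = lR1 t'.
Proof. by rewrite /himg /lR1 /= !homE !Ht. Qed.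
Lemma lR2_hom : himg (lR2 t) = lR2 t'.
Proof. by rewrite /himg /lR2 /= !homE !Ht. Qed.
End T.

Lemma lsum_hom s : h (lsum s) = lsum [seq h x | x <- s].
Proof.
case: s => [|a s] /=; first exact: hK.
by elim: s a => //= b s IH a; rewrite IH hD.
Qed.

Lemma pairing_hom e ei e' ei' R L : img e e' -> img ei ei' ->
  h (pairing e ei R L) = pairing e' ei' (himg R) (himg L).
Proof.
move=> He Hi; rewrite /pairing lsum_hom /himg -!map_comp; congr lsum.
apply: eq_map => l /=; rewrite hM lsum_hom -!map_comp; congr (omul (lsum _) _).
by apply: eq_map => r /=; rewrite !hM He Hi.
Qed.

Section Polys.
Variables (e ei tG tB tC : I3 -> I3 -> A) (e' ei' tG' tB' tC' : I3 -> I3 -> B).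
Hypotheses (He : img e e') (Hei : img ei ei') (HG : img tG tG')
  (HB : img tB tB') (HC : img tC tC').
Let tE := (alpha_hom HG, alpha_hom HB, alpha_hom HC, alpha_hom (transp_hom HG),
  alpha_hom (transp_hom HB), alpha_hom (transp_hom HC), gamma_hom HG, gamma_hom HB, gamma_hom HC,
  mu_hom HG, mu_hom HB, mu_hom HC, fun m => lval_hom m He Hei,
  fun z c1 c2 m r1 r2 => link_hom z c1 c2 m r1 r2 He Hei, He, Hei).

Lemma gram_polys_hom :
  [seq h p | p <- gram_polys e ei tB tC] = gram_polys e' ei' tB' tC'.
Proof. by rewrite /gram_polys /= !(tE, homE). Qed.

Lemma struct_polys_hom : [seq h p | p <- struct_polys e ei tG] = struct_polys e' ei' tG'.
Proof.
rewrite /struct_polys /sum3; set R := memo _; set R' := memo _.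
have HR n m : h (R n m) = R' n m.
  by rewrite /R /R' !memoE (rmat_hom (transp_hom HG)) !tE hK.
by move: R R' HR => R R' HR /=; rewrite !(tE, homE) !HR.
Qed.

Lemma pairing_coef_hom x y : h (pairing_coef e ei tB tC x y) = pairing_coef e' ei' tB' tC' x y.
Proof.
rewrite /pairing_coef (pairing_hom _ _ He Hei); case: x; case: y;
  by rewrite ?(lR0_hom HC, lR1_hom HC, lR2_hom HC, lR0_hom (transp_hom HB),
               lR1_hom (transp_hom HB), lR2_hom (transp_hom HB)).
Qed.

Lemma elim_numers_hom :
  [seq h p | p <- elim_numers e ei tB tC] = elim_numers e' ei' tB' tC'.
Proof. by rewrite /elim_numers /= !(pairing_coef_hom, tE, homE). Qed.

Lemma elim_polys_hom n v : [seq h p | p <- elim_polys e ei tB tC n v] =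
  elim_polys e' ei' tB' tC' [seq h p | p <- n] [seq h p | p <- v].
Proof.
rewrite /elim_polys.
case: n => [|n1 [|n2 [|n3 [|n4 [|]]]]] //=.
case: v => [|v1 [|v2 [|v3 [|v4 [|]]]]] //=.
by rewrite !(pairing_coef_hom, tE, homE).
Qed.
End Polys.
End Hom.

(** * The Laurent polynomial identities, by computation and in a field *)

Definition code i : nat := match i with i0 => 0 | i1 => 1 | i2 => 2 end.
Definition lops : ops := @Ops (lpoly 9) (@ladd 9) (@lmul 9) (@lopp 9)
  (fun n => lconst 9 (Z.of_nat n)).
Definition le : I3 -> I3 -> lops :=
  memo (fun i j => lvar 9 (3 * code i + code j) (Zpos xH)).
Definition lei : I3 -> I3 -> lops :=
  memo (fun i j => lvar 9 (3 * code i + code j) (Zneg xH)).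
Definition lrow_gram : I3 -> I3 -> lops := memo (diag3 (rowgram le lei)).
Definition lco_row_gram : I3 -> I3 -> lops := memo (diag3 (opp_fun (rowgram le lei))).
Definition lco_col_gram : I3 -> I3 -> lops := memo (diag3 (opp_fun (rowgram (transp le) (transp lei)))).

Lemma gram_polys0 : all (@lzero 9) (gram_polys le lei lco_row_gram lco_col_gram).
Proof. by vm_compute. Qed.

Lemma struct_polys0 : all (@lzero 9) (struct_polys le lei lrow_gram).
Proof. by vm_compute. Qed.

Lemma elim_polys0 : exists v : seq lops,
  size v = 4 /\
  all (@lzero 9) (elim_polys le lei lco_row_gram lco_col_gram (elim_numers le lei lco_row_gram lco_col_gram) v).
Proof.
(* The quotients come from the unverified [ldiv]; the first four entries of [elim_polys] certify
   them. *)
exists [seq ldiv 100 (x.1 : lpoly 9) x.2 | x <- zip (elim_numers le lei lco_row_gram lco_col_gram) (elim_denoms lco_row_gram lco_col_gram)].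
split; vm_compute; exact: erefl.
Qed.

Definition fops (F : pzRingType) : ops :=
  @Ops F +%R *%R -%R (fun n => n%:R).

Definition I3_of_nat (n : nat) : I3 := match n with 0 => i0 | 1 => i1 | _ => i2 end.

Section Identities.
Variable F : fieldType.
Local Notation A := (fops F).
Implicit Types (e ei t : I3 -> I3 -> A) (k l : I3 -> A).

Definition inv_fun e : I3 -> I3 -> A := fun i j => (e i j)^-1.
Definition nonvanishing e := forall i j, e i j != 0.
Definition row_gram e := diag3 (rowgram e (inv_fun e)).
(* The row Gram of any b such that (e b) has rows x_i with                      *)
(* sum_j x_ij / x_kj = 0 for i <> k.                                            *)
Definition co_row_gram e := diag3 (opp_fun (rowgram e (inv_fun e))).
Definition co_col_gram e := co_row_gram (transp e).

Definition env e (n : nat) : F := e (I3_of_nat (n %/ 3)) (I3_of_nat (n %% 3)).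

Definition lev9 e : lops -> A := lev (env e) (n := 9).

Section Eval.
Variables (e : I3 -> I3 -> A) (e0 : nonvanishing e).

Lemma lev_hom : hom (lev9 e).
Proof.
split=> [p q|p q|p|n].
- exact: levD.
- by apply: levM => i _; apply: e0.
- exact: levN.
- by rewrite /lev9 lev_const /Z_to_F /=; case: n => //= n; rewrite SuccNat2Pos.id_succ.
Qed.

Lemma le_img : img (lev9 e) le e.
Proof. by case=> -[]; rewrite /le memoE /lev9 lev_var. Qed.

Lemma lei_img : img (lev9 e) lei (inv_fun e).
Proof. by case=> -[]; rewrite /lei memoE /lev9 lev_var. Qed.

Lemma memo_img (T : Type) (h : T -> A) t (t' : I3 -> I3 -> T) :
  (forall i j, h (t' i j) = t i j) -> forall i j, h (memo t' i j) = t i j.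
Proof. by move=> H i j; rewrite memoE H. Qed.

Lemma lrow_gram_img : img (lev9 e) lrow_gram (row_gram e).
Proof.
apply: memo_img; apply: (diag3_hom lev_hom); apply: (rowgram_hom lev_hom).
- exact: le_img.
- exact: lei_img.
Qed.

Lemma lco_row_gram_img : img (lev9 e) lco_row_gram (co_row_gram e).
Proof.
apply: memo_img; apply: (diag3_hom lev_hom); apply: (opp_fun_hom lev_hom); apply: (rowgram_hom lev_hom).
- exact: le_img.
- exact: lei_img.
Qed.

Lemma lco_col_gram_img : img (lev9 e) lco_col_gram (co_col_gram e).
Proof.
apply: memo_img; apply: (diag3_hom lev_hom); apply: (opp_fun_hom lev_hom); apply: (rowgram_hom lev_hom);
  apply: transp_hom; [exact: le_img|exact: lei_img].
Qed.

Local Open Scope ops_scope.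
Local Notation "n %:c" := (onat A n) (at level 2, format "n %:c").

Lemma lev9_all (s : seq lops) :
  all (@lzero 9) s -> [seq lev9 e p | p <- s] = nseq (size s) 0%R.
Proof. by elim: s => [//|p s IH] /andP[p0 /IH /= ->]; rewrite /lev9 (lev0 (env e) p0). Qed.

(** Given the second identity, the third one multiplied by 4 m says that gamma^2 - 4 alpha beta m is
    the same for rows and columns. *)
Lemma row_col_gram :
  let uu := link e (inv_fun e) i0 i1 i2 i0 i1 i2 in let m := mu (co_col_gram e) in
  [/\ m = mu (co_row_gram e), gamma (co_col_gram e) i1 i2 i0 = gamma (co_row_gram e) i1 i2 i0 + 2%:c * m * uu &
    alpha (co_row_gram e) i1 i2 i0 * alpha (transp (co_row_gram e)) i1 i2 i0
     - alpha (co_col_gram e) i1 i2 i0 * alpha (transp (co_col_gram e)) i1 i2 i0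
     + uu * (gamma (co_col_gram e) i1 i2 i0 - m * uu) = 0%R].
Proof.
have := lev9_all gram_polys0.
rewrite (gram_polys_hom lev_hom le_img lei_img lco_row_gram_img lco_col_gram_img) => -[H1 H2 H3].
by split; [exact: subr0_eq H1 | exact: subr0_eq H2 | exact: H3].
Qed.

(** The first relation makes [l] a root of the quadratic equation, the next two give all rows the
    same square root of the discriminant, and the last makes the columns of the inverse of [e]
    eigenvectors of R. *)
Lemma row_struct :
  let l m := lval e (inv_fun e) m in
  let R := rmat (transp (row_gram e)) 1%:c (l i1) (l i2) in
  [/\ alpha (transp (row_gram e)) i1 i2 i0 * l i0 * l i0 + gamma (row_gram e) i1 i2 i0 * l i0
          + alpha (row_gram e) i1 i2 i0 * mu (row_gram e) = 0%R,
      2%:c * alpha (transp (row_gram e)) i1 i2 i0 * l i0 + gamma (row_gram e) i1 i2 i0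
       = 2%:c * alpha (transp (row_gram e)) i0 i2 i1 * l i1 + gamma (row_gram e) i0 i2 i1,
      2%:c * alpha (transp (row_gram e)) i1 i2 i0 * l i0 + gamma (row_gram e) i1 i2 i0
       = 2%:c * alpha (transp (row_gram e)) i0 i1 i2 * l i2 + gamma (row_gram e) i0 i1 i2 &
     forall n j, sum3 (fun m => R n m * inv_fun e m j)
       = sum3 (fun m => R i0 m * e i0 j * inv_fun e m j) * inv_fun e n j].
Proof.
have := lev9_all struct_polys0.
rewrite (struct_polys_hom lev_hom le_img lei_img lrow_gram_img).
move=> [B1 B2 B3 B4 B5 B6 B7 B8 B9].
split; [exact: B1|exact: subr0_eq B2|exact: subr0_eq B3|].
case=> j; last by case: j; [exact: subr0_eq B7|exact: subr0_eq B8|exact: subr0_eq B9].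
  (* Row [i0] is not among the computed identities: the eigenvalue is read off there, so that
     [e i0 j] cancels its inverse. *)
  rewrite /sum3; move: (rmat _ _ _ _) => R; rewrite /inv_fun /=.
  rewrite !(mulrAC _ (e i0 j)) -!mulrDl -mulrA mulfV ?mulr1 //; exact: e0.
by case: j; [exact: subr0_eq B4|exact: subr0_eq B5|exact: subr0_eq B6].
Qed.

Lemma pairing_reduction : exists v1 v2 v1' v2' : A,
  let u11 := link e (inv_fun e) i1 i0 i2 i1 i0 i2 in
  let u12 := link e (inv_fun e) i1 i0 i2 i2 i0 i1 in
  let u21 := link e (inv_fun e) i2 i0 i1 i1 i0 i2 in
  let u22 := link e (inv_fun e) i2 i0 i1 i2 i0 i1 in
  let c := pairing_coef e (inv_fun e) (co_row_gram e) (co_col_gram e) in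
  let tB := co_row_gram e in let tC := co_col_gram e in
  [/\ c i1 i0 * (u11 * u12) + c i1 i1 * (alpha tB i0 i2 i1 * u12)
        + c i1 i2 * (alpha tB i0 i1 i2 * u11) = v1 * alpha tC i0 i2 i1,
      c i2 i0 * (u21 * u22) + c i2 i1 * (alpha tB i0 i2 i1 * u22)
        + c i2 i2 * (alpha tB i0 i1 i2 * u21) = v2 * alpha tC i0 i1 i2,
      c i0 i1 * (u11 * u21) - c i1 i1 * (alpha (transp tC) i0 i2 i1 * u21)
        - c i2 i1 * (alpha (transp tC) i0 i1 i2 * u11) = v1' * alpha (transp tB) i0 i2 i1,
      c i0 i2 * (u12 * u22) - c i1 i2 * (alpha (transp tC) i0 i2 i1 * u22)
        - c i2 i2 * (alpha (transp tC) i0 i1 i2 * u12) = v2' * alpha (transp tB) i0 i1 i2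
    & v1 * (u21 * u22) + v2 * (u11 * u12) + v1' * (u12 * u22) + v2' * (u11 * u21) = 0%R
      /\ c i0 i0 * (u21 * u22)
        + mu tC * ((u11 - u21) * v2 + u22 * v1' + u21 * v2') = 0%R].
Proof.
have [v [sv /lev9_all]] := elim_polys0.
rewrite (elim_polys_hom lev_hom le_img lei_img lco_row_gram_img lco_col_gram_img).
rewrite (elim_numers_hom lev_hom le_img lei_img lco_row_gram_img lco_col_gram_img).
case: v sv => [|v1 [|v2 [|v3 [|v4 []]]]] // _ [H1 H2 H3 H4 H5 H6].
exists (lev9 e v1), (lev9 e v2), (lev9 e v3), (lev9 e v4) => /=.
split; [exact: subr0_eq H1|exact: subr0_eq H2|exact: subr0_eq H3|exact: subr0_eq H4|].
by split; [exact: H5|exact: H6].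
Qed.
End Eval.
End Identities.

(** * Existence of k for the column Gram matrix *)

Section Perm.
Variable F : fieldType.
Local Notation A := (fops F).
Implicit Types (e ei t : I3 -> I3 -> A) (k l : I3 -> A) (p q : I3 -> I3).

(** With the identity as map, every transport lemma becomes a congruence for pointwise equality, in
    place of functional extensionality. *)
Lemma id_hom : hom (@id A). Proof. by []. Qed.

Lemma sum3_perm p (f : I3 -> A) : injective p -> sum3 (fun i => f (p i)) = sum3 f.
Proof.
move=> pI; rewrite /sum3 /=; move: (pI i0 i1) (pI i0 i2) (pI i1 i2).
by case: (p i0); case: (p i1); case: (p i2) => // P Q R;
  do ?[by have := P erefl|by have := Q erefl|by have := R erefl]; ring.
Qed.

Lemma diag3_perm p t i j : injective p ->
  diag3 t (p i) (p j) = diag3 (fun i j => t (p i) (p j)) i j.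
Proof.
move=> pI; have off_diag x : diag3 t x x = 3%:R by case: x.
have off_ndiag x y : x <> y -> diag3 t x y = t x y by case: x y => -[].
by case: i j => -[] /=; rewrite ?off_diag // off_ndiag // => /pI.
Qed.

Lemma co_row_gram_perm p q e i j : injective p -> injective q ->
  co_row_gram (fun i j => e (p i) (q j)) i j = co_row_gram e (p i) (p j).
Proof.
move=> pI qI; rewrite /co_row_gram diag3_perm //; apply: (diag3_hom id_hom) => {i j}.
move=> m n; congr (- _); apply: (@sum3_perm q (fun r => e (p m) r * inv_fun e (p n) r)) => //.
Qed.

Lemma co_col_gram_perm p q e i j : injective p -> injective q ->
  co_col_gram (fun i j => e (p i) (q j)) i j = co_col_gram e (q i) (q j).
Proof. by move=> pI qI; apply: (@co_row_gram_perm q p (transp e)). Qed.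

Lemma mu_perm p t : injective p -> mu (fun i j => t (p i) (p j)) = mu t.
Proof.
move=> pI; rewrite /mu /sig2 /sig3 /=; move: (pI i0 i1) (pI i0 i2) (pI i1 i2).
by case: (p i0); case: (p i1); case: (p i2) => // P Q R;
  do ?[by have := P erefl|by have := Q erefl|by have := R erefl]; ring.
Qed.

Definition triple (x y z : I3) : I3 -> I3 :=
  fun i => match i with i0 => x | i1 => y | i2 => z end.

Lemma triple_inj x y z : x <> y -> x <> z -> y <> z -> injective (triple x y z).
Proof. by move=> xy xz yz [] [] //= E; congruence. Qed.

Lemma alpha_sym t x y z : alpha t x y z = alpha t y x z.
Proof. by rewrite /alpha /=; ring. Qed.
Lemma gamma_sym t x y z : gamma t x y z = gamma t y x z.
Proof. by rewrite /gamma /=; ring. Qed.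
Lemma transp_ext t t' : t =2 t' -> transp t =2 transp t'.
Proof. by move=> H i j; apply: H. Qed.
Lemma alpha_ext t t' x y z : t =2 t' -> alpha t x y z = alpha t' x y z.
Proof. by move=> H; exact: (alpha_hom id_hom H). Qed.
Lemma gamma_ext t t' x y z : t =2 t' -> gamma t x y z = gamma t' x y z.
Proof. by move=> H; exact: (gamma_hom id_hom H). Qed.
Lemma mu_ext t t' : t =2 t' -> mu t = mu t'.
Proof. by move=> H; exact: (mu_hom id_hom H). Qed.

(** One position is computed; permuting the rows and columns of [e] carries it to all others. *)
Lemma row_col_gram_at e z c1 c2 m r1 r2 : nonvanishing e ->
  injective (triple z c1 c2) -> injective (triple m r1 r2) ->
  let uu : F := link e (inv_fun e) z c1 c2 m r1 r2 in
  [/\ mu (co_col_gram e) = mu (co_row_gram e) :> F,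
      gamma (co_col_gram e) c1 c2 z = gamma (co_row_gram e) r1 r2 m + 2%:R * mu (co_col_gram e) * uu :> F &
      alpha (co_row_gram e) r1 r2 m * alpha (transp (co_row_gram e)) r1 r2 m
     - alpha (co_col_gram e) c1 c2 z * alpha (transp (co_col_gram e)) c1 c2 z
     + uu * (gamma (co_col_gram e) c1 c2 z - mu (co_col_gram e) * uu) = 0 :> F].
Proof.
move=> e0 cI rI uu; pose q := triple z c1 c2; pose p := triple m r1 r2.
pose e' i j := e (p i) (q j).
have e'0 : nonvanishing e' by move=> i j; apply: e0.
have HC : co_col_gram e' =2 fun i j => co_col_gram e (q i) (q j) by move=> i j; apply: co_col_gram_perm.
have HB : co_row_gram e' =2 fun i j => co_row_gram e (p i) (p j) by move=> i j; apply: co_row_gram_perm.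
have [] := row_col_gram e'0.
rewrite !(mu_ext HC, mu_ext HB) !mu_perm //.
rewrite !(alpha_ext _ _ _ HC, alpha_ext _ _ _ HB, gamma_ext _ _ _ HC, gamma_ext _ _ _ HB,
  alpha_ext _ _ _ (transp_ext HC), alpha_ext _ _ _ (transp_ext HB)).
by [].
Qed.
End Perm.

Definition oth1 z := if z is i0 then i1 else i0.
Definition oth2 z := if z is i2 then i1 else i2.

Lemma triple_oth z c1 c2 : injective (triple z c1 c2) ->
  (c1 = oth1 z /\ c2 = oth2 z) \/ (c1 = oth2 z /\ c2 = oth1 z).
Proof.
move=> I; move: (I i0 i1) (I i0 i2) (I i1 i2) => {I}.
case: z c1 c2 => -[] [] //= P Q R; (try by [left|right]);
  by [move: (P erefl)|move: (Q erefl)|move: (R erefl)].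
Qed.

Lemma oth_inj z : injective (triple z (oth1 z) (oth2 z)).
Proof. by case: z; apply: triple_inj. Qed.

(** After multiplication by all four u, the products k l become linear. The terms alpha k and beta l
    that remain agree up to multiples of m: the coefficient of their common value is the sum of the
    v, and the constant left over is the last relation, both zero. *)
Lemma bilinear_elimination (F : fieldType)
    (c00 c10 c20 c01 c02 c11 c12 c21 c22 u11 u12 u21 u22 v1 v2 v1' v2' m : F)
    (a1C a2C b1C b2C a1B a2B b1B b2B k1 k2 l1 l2 : F) :
  u11 != 0 -> u12 != 0 -> u21 != 0 -> u22 != 0 ->
  c10 * (u11 * u12) + c11 * (a1B * u12) + c12 * (a2B * u11) = v1 * a1C ->
  c20 * (u21 * u22) + c21 * (a1B * u22) + c22 * (a2B * u21) = v2 * a2C ->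
  c01 * (u11 * u21) - c11 * (b1C * u21) - c21 * (b2C * u11) = v1' * b1B ->
  c02 * (u12 * u22) - c12 * (b1C * u22) - c22 * (b2C * u12) = v2' * b2B ->
  v1 * (u21 * u22) + v2 * (u11 * u12) + v1' * (u12 * u22) + v2' * (u11 * u21) = 0 ->
  c00 * (u21 * u22) + m * ((u11 - u21) * v2 + u22 * v1' + u21 * v2') = 0 ->
  a1C * k1 = b1B * l1 - m * u11 -> a1C * k1 = b2B * l2 - m * u12 ->
  a2C * k2 = b1B * l1 - m * u21 ->
  u11 * (k1 * l1) = a1B * k1 - b1C * l1 -> u12 * (k1 * l2) = a2B * k1 - b1C * l2 ->
  u21 * (k2 * l1) = a1B * k2 - b2C * l1 -> u22 * (k2 * l2) = a2B * k2 - b2C * l2 ->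
  c00 + k1 * c10 + k2 * c20 + l1 * c01 + l2 * c02
  + k1 * l1 * c11 + k1 * l2 * c12 + k2 * l1 * c21 + k2 * l2 * c22 = 0.
Proof.
move=> U11 U12 U21 U22 N1 N2 N1' N2' S0 S1 L11 L12 L21 V11 V12 V21 V22.
apply: (mulfI (mulf_neq0 (mulf_neq0 U11 U12) (mulf_neq0 U21 U22))); rewrite mulr0.
have l2E : b2B * l2 = a1C * k1 + m * u12 by rewrite L12 subrK.
transitivity (c00 * (u11 * u12 * (u21 * u22))
  + k1 * (u21 * u22) * (c10 * (u11 * u12) + c11 * (a1B * u12) + c12 * (a2B * u11))
  + k2 * (u11 * u12) * (c20 * (u21 * u22) + c21 * (a1B * u22) + c22 * (a2B * u21))
  + l1 * (u12 * u22) * (c01 * (u11 * u21) - c11 * (b1C * u21) - c21 * (b2C * u11))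
  + l2 * (u11 * u21) * (c02 * (u12 * u22) - c12 * (b1C * u22) - c22 * (b2C * u12))
  + c11 * (u12 * u21 * u22) * (u11 * (k1 * l1) - (a1B * k1 - b1C * l1))
  + c12 * (u11 * u21 * u22) * (u12 * (k1 * l2) - (a2B * k1 - b1C * l2))
  + c21 * (u11 * u12 * u22) * (u21 * (k2 * l1) - (a1B * k2 - b2C * l1))
  + c22 * (u11 * u12 * u21) * (u22 * (k2 * l2) - (a2B * k2 - b2C * l2))); first by ring.
rewrite V11 V12 V21 V22 !subrr !mulr0 !addr0 N1 N2 N1' N2'.
transitivity (c00 * (u11 * u12 * (u21 * u22)) + (u21 * u22) * v1 * (a1C * k1)
  + (u11 * u12) * v2 * (a2C * k2) + (u12 * u22) * v1' * (b1B * l1)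
  + (u11 * u21) * v2' * (b2B * l2)); first by ring.
rewrite l2E L11 L21.
transitivity ((b1B * l1 - m * u11) *
    (v1 * (u21 * u22) + v2 * (u11 * u12) + v1' * (u12 * u22) + v2' * (u11 * u21))
  + u11 * u12 * (c00 * (u21 * u22) + m * ((u11 - u21) * v2 + u22 * v1' + u21 * v2')));
  first by ring.
by rewrite S0 S1 !mulr0 addr0.
Qed.

Section Pair.
Variable F : fieldType.
Hypothesis two_neq0 : (2%:R : F) != 0.
Local Notation A := (fops F).
Implicit Types (t : I3 -> I3 -> A).
Variables (e b : I3 -> I3 -> A).
Hypotheses (e0 : nonvanishing e) (b0 : nonvanishing b) (eb : co_row_gram e =2 row_gram b).

Let l m : F := lval b (inv_fun b) m.
Let tB := co_row_gram e.
Let tC := co_col_gram e.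
Let m_ : F := mu tC.
Let al t x y z : F := alpha t x y z.
Let bt t x y z : F := alpha (transp t) x y z.
Let gm t x y z : F := gamma t x y z.
Let uu z c1 c2 m r1 r2 : F := link e (inv_fun e) z c1 c2 m r1 r2.

(** The square root of the common discriminant that [b] provides; which root is taken decides the
    roots [kval]. *)
Definition jinv : F := 2%:R * bt tB i1 i2 i0 * l i0 + gm tB i1 i2 i0.

Let eb2 := transp_ext eb.

Lemma lval_jinv m r1 r2 : injective (triple m r1 r2) ->
  2%:R * bt tB r1 r2 m * l m + gm tB r1 r2 m = jinv.
Proof.
move=> /triple_oth H; have [_ H1 H2 _] := row_struct b0.
have {H1 H2} E : 2%:R * bt tB (oth1 m) (oth2 m) m * l m + gm tB (oth1 m) (oth2 m) m = jinv.
  rewrite /jinv /bt /gm !(alpha_ext _ _ _ eb2) !(gamma_ext _ _ _ eb).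
  by case: m H => _; [|exact: (esym H1)|exact: (esym H2)].
by case: H => -[-> ->] //; rewrite /bt /gm alpha_sym gamma_sym.
Qed.

Lemma lval_perm p m : injective p -> lval (fun i j => b (p i) j) (inv_fun (fun i j => b (p i) j)) m
   = lval b (inv_fun b) (p m).
Proof.
move=> pI; rewrite /lval; congr (_ * _)%R; rewrite /perm3 /=.
move: (pI i0 i1) (pI i0 i2) (pI i1 i2).
by case: (p i0); case: (p i1); case: (p i2) => // P Q R;
  do ?[by have := P erefl|by have := Q erefl|by have := R erefl]; ring.
Qed.

Lemma lval_quad m r1 r2 : injective (triple m r1 r2) ->
  bt tB r1 r2 m * l m * l m + gm tB r1 r2 m * l m + al tB r1 r2 m * m_ = 0.
Proof.
move=> rI; pose p := triple m r1 r2; pose b' i j := b (p i) j.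
have b'0 : nonvanishing b' by move=> i j; apply: b0.
have HG : row_gram b' =2 fun i j => co_row_gram e (p i) (p j).
  move=> i j; rewrite eb /row_gram diag3_perm //.
have [H _ _ _] := row_struct b'0.
move: H; rewrite (mu_ext HG) mu_perm // lval_perm //.
rewrite !(alpha_ext _ _ _ HG, gamma_ext _ _ _ HG, alpha_ext _ _ _ (transp_ext HG)).
by rewrite /m_ /tC; have [-> _ _] := row_col_gram_at e0 (@oth_inj i0) rI.
Qed.

Hypothesis alpha0 : forall z, al tC (oth1 z) (oth2 z) z != 0.

Lemma alpha_neq0 z c1 c2 : injective (triple z c1 c2) -> al tC c1 c2 z != 0.
Proof. by case/triple_oth => -[-> ->] //; rewrite /al alpha_sym. Qed.

(** The root of alpha k^2 + gamma k + beta mu = 0 singled out by the square root [jinv]. *)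
Definition kval z : F := (jinv - gm tC (oth1 z) (oth2 z) z) / (2%:R * al tC (oth1 z) (oth2 z) z).

Lemma kval_jinv z c1 c2 : injective (triple z c1 c2) ->
  2%:R * al tC c1 c2 z * kval z + gm tC c1 c2 z = jinv.
Proof.
move=> H; have E : 2%:R * al tC (oth1 z) (oth2 z) z * kval z + gm tC (oth1 z) (oth2 z) z = jinv.
  by rewrite /kval mulrC divfK ?subrK // mulf_neq0.
by case/triple_oth: H => -[-> ->] //; rewrite /al /gm alpha_sym gamma_sym.
Qed.

(** Both 2 alpha k + gamma for columns and 2 beta l + gamma for rows equal [jinv], and the two gamma
    differ by 2 mu [uu]. *)
Lemma link_lin z c1 c2 m r1 r2 : injective (triple z c1 c2) -> injective (triple m r1 r2) ->
  al tC c1 c2 z * kval z = bt tB r1 r2 m * l m - m_ * uu z c1 c2 m r1 r2.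
Proof.
move=> cI rI; have [_ G _] := row_col_gram_at e0 cI rI.
have := kval_jinv cI; rewrite -(lval_jinv rI) => E.
apply: (mulfI two_neq0); apply: (addIr (gm tC c1 c2 z)); rewrite mulrA E.
by rewrite [gm tC c1 c2 z]G /bt /gm /m_ /uu; ring.
Qed.

(** Multiplied by alpha and reduced by [link_lin], the difference of the two sides is a combination
    of the quadratic equation of l and of the equality of discriminants. *)
Lemma link_prod z c1 c2 m r1 r2 : injective (triple z c1 c2) -> injective (triple m r1 r2) ->
  uu z c1 c2 m r1 r2 * (kval z * l m) = al tB r1 r2 m * kval z - bt tC c1 c2 z * l m.
Proof.
move=> cI rI; have [_ G D] := row_col_gram_at e0 cI rI.
have L := link_lin cI rI; have Q := lval_quad rI.
apply: (mulfI (alpha_neq0 cI)); apply/eqP; rewrite -subr_eq0; apply/eqP.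
transitivity ((uu z c1 c2 m r1 r2 * l m - al tB r1 r2 m) *
   (al tC c1 c2 z * kval z) + al tC c1 c2 z * bt tC c1 c2 z * l m); first by ring.
rewrite L.
transitivity (uu z c1 c2 m r1 r2 * (bt tB r1 r2 m * l m * l m + gm tB r1 r2 m * l m + al tB r1 r2 m * m_)
  - l m * (al tB r1 r2 m * bt tB r1 r2 m - al tC c1 c2 z * bt tC c1 c2 z
    + uu z c1 c2 m r1 r2 * (gm tC c1 c2 z - m_ * uu z c1 c2 m r1 r2))).
  by rewrite [gm tC c1 c2 z]G -/m_ -/(gm tB r1 r2 m) -/(uu z c1 c2 m r1 r2); ring.
by rewrite Q mulr0 sub0r; apply/eqP; rewrite oppr_eq0; apply/eqP; rewrite -[RHS](mulr0 (l m)); congr (_ * _).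
Qed.

(** The quadratic equation of l gives the square of [jinv] as the discriminant on the row side,
    which is also that of the columns. *)
Lemma kval_quad z c1 c2 : injective (triple z c1 c2) ->
  jinv * jinv = gm tC c1 c2 z * gm tC c1 c2 z - 4%:R * al tC c1 c2 z * bt tC c1 c2 z * m_.
Proof.
move=> cI; have rI := @oth_inj i0; have [_ G D] := row_col_gram_at e0 cI rI.
have Q := lval_quad rI; rewrite -(lval_jinv rI).
transitivity (gm tB (oth1 i0) (oth2 i0) i0 * gm tB (oth1 i0) (oth2 i0) i0
  - 4%:R * (al tB (oth1 i0) (oth2 i0) i0 * bt tB (oth1 i0) (oth2 i0) i0) * m_).
  apply/eqP; rewrite -subr_eq0; apply/eqP.
  by rewrite -[RHS](mulr0 (4%:R * bt tB (oth1 i0) (oth2 i0) i0)) -Q; ring.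
have -> : al tB (oth1 i0) (oth2 i0) i0 * bt tB (oth1 i0) (oth2 i0) i0 =
  al tC c1 c2 z * bt tC c1 c2 z
  - uu z c1 c2 i0 (oth1 i0) (oth2 i0) * (gm tC c1 c2 z - m_ * uu z c1 c2 i0 (oth1 i0) (oth2 i0)).
  have {}D : al tB (oth1 i0) (oth2 i0) i0 * bt tB (oth1 i0) (oth2 i0) i0
    - al tC c1 c2 z * bt tC c1 c2 z + uu z c1 c2 i0 (oth1 i0) (oth2 i0) *
      (gm tC c1 c2 z - m_ * uu z c1 c2 i0 (oth1 i0) (oth2 i0)) = 0 := D.
  by apply/eqP; rewrite -subr_eq0 -[X in _ == X]D; apply/eqP; ring.
by rewrite [gm tC c1 c2 z]G -/m_ -/(gm tB _ _ _) -/(uu _ _ _ _ _ _); ring.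
Qed.

(** The trace of L^T E R^T Eo^T, for Eo the entrywise inverse of E. Its vanishing makes the last
    diagonal entries of the operator of R orthogonal to the eigenvalues of L. *)
Definition tform e (R L : I3 -> I3 -> F) : F :=
  sum3 (A := A) (fun j => sum3 (A := A) (fun k => sum3 (A := A) (fun m =>
    sum3 (A := A) (fun n => R j k * L n m * (e n k * inv_fun e m j))))).

Lemma tform_coef e' tB' tC' (k1 k2 l1 l2 : A) :
  let c : I3 -> I3 -> F := pairing_coef e' (inv_fun e') tB' tC' in
  tform e' (rmat tC' (1 : A) k1 k2) (rmat (transp tB') (1 : A) l1 l2) =
  c i0 i0 + k1 * c i1 i0 + k2 * c i2 i0 + l1 * c i0 i1 + l2 * c i0 i2
  + k1 * l1 * c i1 i1 + k1 * l2 * c i1 i2 + k2 * l1 * c i2 i1 + k2 * l2 * c i2 i2.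
Proof.
rewrite /pairing_coef /pairing /lR0 /lR1 /lR2 /tform /sum3.
set rC := rmat0 tC'; set rB := rmat0 (transp tB').
rewrite /rmat -/rC -/rB.
move: rC rB => rC rB /=.
ring.
Qed.

Hypothesis u_neq0 : forall z m,
  uu z (oth1 z) (oth2 z) m (oth1 m) (oth2 m) != 0.

Lemma uu_neq0 z c1 c2 m r1 r2 : injective (triple z c1 c2) -> injective (triple m r1 r2) ->
  uu z c1 c2 m r1 r2 != 0.
Proof.
have E z' c1' c2' m' r1' r2' : uu z' c2' c1' m' r1' r2' = uu z' c1' c2' m' r1' r2'.
  by rewrite /uu /link /=; ring.
have E' z' c1' c2' m' r1' r2' : uu z' c1' c2' m' r2' r1' = uu z' c1' c2' m' r1' r2'.
  by rewrite /uu /link /=; ring.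
case/triple_oth => -[-> ->] /triple_oth[] [-> ->]; last 2 first.
- by rewrite E; apply: u_neq0.
- by rewrite E E'; apply: u_neq0.
- exact: u_neq0.
- by rewrite E'; apply: u_neq0.
Qed.

(** The relations between k and l hold for every column and row, so permuting [e] covers all four
    pairs of R and L. *)
Lemma tform_eq0 p q : injective p -> injective q ->
  let e' i j := e (p i) (q j) in
  tform e' (rmat (co_col_gram e') (1 : A) (kval (q i1)) (kval (q i2)))
           (rmat (transp (co_row_gram e')) (1 : A) (l (p i1)) (l (p i2))) = 0.
Proof.
move=> pI qI e'; rewrite tform_coef.
have e'0 : nonvanishing e' by move=> i j; apply: e0.
have HC : co_col_gram e' =2 fun i j => co_col_gram e (q i) (q j) by move=> i j; apply: co_col_gram_perm.
have HB : co_row_gram e' =2 fun i j => co_row_gram e (p i) (p j) by move=> i j; apply: co_row_gram_perm.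
have c1I : injective (triple (q i1) (q i0) (q i2)) by apply: triple_inj => /qI.
have c2I : injective (triple (q i2) (q i0) (q i1)) by apply: triple_inj => /qI.
have r1I : injective (triple (p i1) (p i0) (p i2)) by apply: triple_inj => /pI.
have r2I : injective (triple (p i2) (p i0) (p i1)) by apply: triple_inj => /pI.
have [v1 [v2 [v1' [v2' []]]]] := pairing_reduction e'0.
rewrite !(alpha_ext _ _ _ HC, alpha_ext _ _ _ HB, mu_ext HC,
  alpha_ext _ _ _ (transp_ext HC), alpha_ext _ _ _ (transp_ext HB)) mu_perm //.
move=> N1 N2 N1' N2' [S0 S1].
apply: (bilinear_elimination (uu_neq0 c1I r1I) (uu_neq0 c1I r2I) (uu_neq0 c2I r1I)
  (uu_neq0 c2I r2I) N1 N2 N1' N2' S0 S1).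
- exact: link_lin.
- exact: link_lin.
- exact: link_lin.
- exact: link_prod.
- exact: link_prod.
- exact: link_prod.
- exact: link_prod.
Qed.
End Pair.

(** * Two commuting operators attached to a Gram matrix *)

Definition swap01 (a : bool) : I3 -> I3 := if a then triple i1 i0 i2 else id.

Lemma swap01K a : involutive (swap01 a).
Proof. by case: a => -[]. Qed.

Definition swap01_inj a := inv_inj (swap01K a).

Section Gram.
Variable F : fieldType.
Hypothesis two_neq0 : (2%:R : F) != 0.
Local Notation A := (fops F).
Variables (t : I3 -> I3 -> A) (k : I3 -> A) (j : F).
Hypothesis tdiag : forall i, t i i = 3%:R.

(** [rmat] singles out the index [i0]; exchanging [i0] and [i1] gives the second operator. *)
Definition Rmx a : I3 -> I3 -> A := fun x y =>
  rmat (fun x y => t (swap01 a x) (swap01 a y)) (1 : A) (k (swap01 a i1)) (k (swap01 a i2))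
    (swap01 a x) (swap01 a y).

Lemma Rmx_swap a x y : Rmx a (swap01 a x) (swap01 a y) =
  rmat (fun x y => t (swap01 a x) (swap01 a y)) (1 : A) (k (swap01 a i1)) (k (swap01 a i2)) x y.
Proof. by rewrite /Rmx !(swap01K a). Qed.

Lemma Rmx_trace a : sum3 (fun x => Rmx a x x) = 0 :> F.
Proof. by case: a; rewrite /sum3 /Rmx /=; ring. Qed.

Lemma Rmx_diag a x : sum3 (fun y => Rmx a x y * t y x : A) = 0 :> F.
Proof.
by case: a; case: x; rewrite /sum3 /Rmx /= !tdiag; ring.
Qed.

Hypothesis alpha0 : forall z x y, injective (triple z x y) -> alpha t x y z != 0 :> F.
Hypothesis k_lin : forall z x y, injective (triple z x y) ->
  2%:R * alpha t x y z * k z + gamma t x y z = j :> F.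
Hypothesis j_quad : forall z x y, injective (triple z x y) ->
  j * j = gamma t x y z * gamma t x y z
          - 4%:R * alpha t x y z * alpha (transp t) x y z * mu t :> F.

(** The relations between values of k to which the commutator of the two operators reduces. *)
Definition krel x y z : F :=
  k x * k y * t z y - k x * (3%:R * t y x + t y z * t z x)
  + k y * (t x y * t x y - t x y * t x z * t z y) + mu t * t x z.

Lemma triple_swap x y z : injective (triple x y z) -> injective (triple y x z).
Proof.
move=> I; apply: triple_inj => E;
 [have := I i0 i1|have := I i1 i2|have := I i0 i2]; by rewrite /= E => /(_ erefl).
Qed.

(** Multiplying by both alpha and writing 2 alpha k as j - gamma leaves [t z y] times the difference
    of j^2 and the discriminant. *)
Lemma krel_eq0 x y z : injective (triple x y z) -> krel x y z = 0.
Proof.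
move=> xI; have yI := triple_swap xI.
have Ex := k_lin xI; have Ey := k_lin yI; have Jx := j_quad xI.
pose ax : F := alpha t y z x; pose ay : F := alpha t x z y.
have axay : 4%:R * ax * ay != 0.
  by rewrite !mulf_neq0 ?alpha0 // -[4%:R]/(2 * 2)%:R natrM mulf_neq0.
apply: (mulfI axay); rewrite mulr0.
transitivity (t z y * (2%:R * ax * k x) * (2%:R * ay * k y)
  - 2%:R * ay * (2%:R * ax * k x) * (3%:R * t y x + t y z * t z x)
  + 2%:R * ax * (2%:R * ay * k y) * (t x y * t x y - t x y * t x z * t z y)
  + 4%:R * ax * ay * mu t * t x z).
  by rewrite /krel; ring.
have -> : 2%:R * ax * k x = j - gamma t y z x by rewrite -Ex addrK.
have -> : 2%:R * ay * k y = j - gamma t x z y by rewrite -Ey addrK.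
have muE : mu t = 9%:R - (t x y * t y x + t x z * t z x + t y z * t z y)
    + (t x y * t y z * t z x + t x z * t z y * t y x) :> F.
  by rewrite -(mu_perm t xI) /mu /sig2 /sig3.
transitivity (t z y * (j * j - (gamma t y z x * gamma t y z x
  - 4%:R * ax * alpha (transp t) y z x * mu t)) : F).
  by rewrite muE /ax /ay /alpha /gamma /transp /=; ring.
by rewrite Jx subrr mulr0.
Qed.

Lemma Rmx_comm x y :
  sum3 (fun z => Rmx false x z * Rmx true z y : A) =
  sum3 (fun z => Rmx true x z * Rmx false z y : A) :> F.
Proof.
have Q a b c : a <> b -> a <> c -> b <> c -> krel a b c = 0.
  by move=> ab ac bc; apply/krel_eq0/triple_inj.
have Q01 : krel i0 i1 i2 = 0 by apply: Q.
have Q02 : krel i0 i2 i1 = 0 by apply: Q.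
have Q10 : krel i1 i0 i2 = 0 by apply: Q.
have Q12 : krel i1 i2 i0 = 0 by apply: Q.
have Q20 : krel i2 i0 i1 = 0 by apply: Q.
have Q21 : krel i2 i1 i0 = 0 by apply: Q.
apply/eqP; rewrite -subr_eq0; apply/eqP.
(* The entries of the commutator, as explicit combinations of the relations [krel]. *)
pose c : I3 -> I3 -> F := fun x y => match x, y with
  | i0, i0 => 9%:R * (t i1 i2 * krel i2 i0 i1 - t i2 i1 * krel i1 i0 i2)
  | i0, i1 => - 9%:R * (t i0 i2 * krel i2 i0 i1)
  | i0, i2 => 9%:R * (t i0 i1 * krel i1 i0 i2)
  | i1, i0 => 9%:R * (t i1 i2 * krel i2 i1 i0)
  | i1, i1 => 9%:R * (t i1 i0 * krel i0 i2 i1 - t i0 i1 * krel i1 i2 i0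
      - t i1 i2 * krel i2 i0 i1 + t i2 i1 * krel i1 i0 i2)
  | i1, i2 => - 9%:R * (t i1 i0 * krel i0 i1 i2)
  | i2, i0 => - 9%:R * (t i2 i1 * krel i1 i2 i0)
  | i2, i1 => 9%:R * (t i2 i0 * krel i0 i2 i1)
  | i2, i2 => 9%:R * (t i0 i1 * krel i1 i2 i0 - t i1 i0 * krel i0 i2 i1)
  end.
have c0 : c x y = 0.
  by case: x; case: y; rewrite /c ?Q01 ?Q02 ?Q10 ?Q12 ?Q20 ?Q21 !mulr0 ?subrr ?addr0 ?mulr0.
rewrite -[RHS]c0 /c; case: x {c0}; case: y;
  rewrite /krel /sum3 /Rmx /mu /sig2 /sig3 /=; ring.
Qed.
End Gram.

(** * Projectors from commuting operators of zero diagonal *)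

Definition ord_of_I3 (x : I3) : 'I_3 :=
  match x with
  | i0 => Ordinal (isT : 0 < 3)%N | i1 => Ordinal (isT : 1 < 3)%N
  | i2 => Ordinal (isT : 2 < 3)%N end.

Lemma ord_of_I3K (i : 'I_3) : ord_of_I3 (I3_of_nat i) = i.
Proof. by apply: val_inj; case: i => [[|[|[|]]]]. Qed.

Lemma I3_of_ordK x : I3_of_nat (ord_of_I3 x) = x.
Proof. by case: x. Qed.

Lemma big_ord3 (V : nmodType) (f : 'I_3 -> V) :
  \sum_i f i = f (ord_of_I3 i0) + f (ord_of_I3 i1) + f (ord_of_I3 i2).
Proof.
rewrite !big_ord_recl big_ord0 addr0 addrA.
by congr (f _ + f _ + f _); apply: val_inj.
Qed.

Lemma ord3P (P : 'I_3 -> Prop) : (forall x, P (ord_of_I3 x)) -> forall i, P i.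
Proof. by move=> H i; rewrite -(ord_of_I3K i). Qed.

(** The Gram determinant is 3 times the square of a 2 x 2 minor of [v] and [w]; so they span the
    plane orthogonal to (1,1,1), and [d] is a multiple of (1,1,1). *)
Lemma orthogonal_traceless_const (F : fieldType) (v w d : 'I_3 -> F) :
  \sum_i v i = 0 -> \sum_i w i = 0 ->
  (\sum_i v i * v i) * (\sum_i w i * w i) - (\sum_i v i * w i) ^+ 2 != 0 ->
  \sum_i v i * d i = 0 -> \sum_i w i * d i = 0 -> forall i j, d i = d j.
Proof.
rewrite !big_ord3; set x := ord_of_I3 i0; set y := ord_of_I3 i1; set z := ord_of_I3 i2.
move=> v0 w0 g0 vd wd.
have vz : v z = - (v x + v y) by apply/eqP; rewrite -addr_eq0 addrC v0.
have wz : w z = - (w x + w y) by apply/eqP; rewrite -addr_eq0 addrC w0.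
have D0 : v x * w y - v y * w x != 0.
  apply: contra_neq g0 => D0.
  rewrite vz wz; transitivity (3%:R * (v x * w y - v y * w x) ^+ 2); first by ring.
  by rewrite D0 expr0n mulr0.
have dxz : d x = d z.
  apply/eqP; rewrite -subr_eq0; apply/eqP/(mulfI D0); rewrite mulr0.
  transitivity (w y * (v x * d x + v y * d y + v z * d z) -
    v y * (w x * d x + w y * d y + w z * d z)); first by rewrite vz wz; ring.
  by rewrite vd wd !mulr0 subrr.
have dyz : d y = d z.
  apply/eqP; rewrite -subr_eq0; apply/eqP/(mulfI D0); rewrite mulr0.
  transitivity (v x * (w x * d x + w y * d y + w z * d z) -
    w x * (v x * d x + v y * d y + v z * d z)); first by rewrite vz wz; ring.
  by rewrite vd wd !mulr0 subrr.
have dE i : d i = d z by move: i; apply: ord3P; case.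
by move=> i j; rewrite !dE.
Qed.

Lemma rank1_sandwich (F : fieldType) n (p X : 'M[F]_n) :
  \rank p = 1%N -> p *m X *m p = \tr (X *m p) *: p.
Proof.
move=> p1; move: (col_base p) (row_base p) (mulmx_base p); rewrite p1 => c r <-.
have -> : c *m r *m X *m (c *m r) = c *m (r *m X *m c) *m r by rewrite !mulmxA.
have -> : \tr (X *m (c *m r)) = \tr (r *m X *m c).
  by rewrite mulmxA mxtrace_mulC mulmxA.
rewrite {1}[r *m X *m c]mx11_scalar mul_mx_scalar -scalemxAl.
by rewrite [in RHS]/mxtrace big_ord1.
Qed.

Lemma det_mx33 (R : comPzRingType) (M : 'M[R]_3) :
  let a x y := M (ord_of_I3 x) (ord_of_I3 y) in
  \det M = a i0 i0 * (a i1 i1 * a i2 i2 - a i1 i2 * a i2 i1)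
         - a i0 i1 * (a i1 i0 * a i2 i2 - a i1 i2 * a i2 i0)
         + a i0 i2 * (a i1 i0 * a i2 i1 - a i1 i1 * a i2 i0).
Proof.
move=> a; have aE i j : M i j = a (I3_of_nat i) (I3_of_nat j) by rewrite /a !ord_of_I3K.
rewrite (expand_det_row _ ord0) !big_ord_recl big_ord0 /cofactor.
rewrite !(expand_det_row _ ord0) !big_ord_recl !big_ord0 /cofactor !det_mx11 !mxE !aE /=.
rewrite /bump /=.
ring.
Qed.

Lemma cayley_hamilton33 (F : fieldType) (M : 'M[F]_3) : (2%:R : F) != 0 ->
  \tr M = 0 -> M *m M *m M = (2^-1 * \tr (M *m M)) *: M + (\det M)%:M.
Proof.
move=> two0 trM; pose a x y := M (ord_of_I3 x) (ord_of_I3 y).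
have aE i j : M i j = a (I3_of_nat i) (I3_of_nat j) by rewrite /a !ord_of_I3K.
have t0 : a i2 i2 = - (a i0 i0 + a i1 i1).
  by apply/eqP; rewrite -addr_eq0 addrC -trM /mxtrace big_ord3.
have -> : 2^-1 * \tr (M *m M) = a i0 i0 * a i0 i0 + a i1 i1 * a i1 i1 + a i0 i0 * a i1 i1
   + a i0 i1 * a i1 i0 + a i0 i2 * a i2 i0 + a i1 i2 * a i2 i1.
  apply: (mulfI two0); rewrite mulrA mulfV // mul1r /mxtrace big_ord3 !mxE !big_ord3 !aE !I3_of_ordK t0.
  by ring.
rewrite det_mx33 /= -/(a _ _) -!/(a _ _).
apply/matrixP; apply: ord3P => x; apply: ord3P => y.
rewrite !mxE !big_ord3 !mxE !big_ord3 !aE !I3_of_ordK.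
by case: x; case: y => /=; rewrite /= ?mulr1n ?mulr0n t0; ring.
Qed.

Section Spectral.
Variable F : closedFieldType.
Hypothesis charF : [pchar F] =i pred0.

Lemma depressed_cubic_roots (t d : F) : 2%:R * (4%:R * t ^+ 3 - 27%:R * d ^+ 2) != 0 ->
  exists l : 'I_3 -> F,
   [/\ forall i, l i ^+ 3 = t * l i + d,
       forall i j, i != j -> l i ^+ 2 + l i * l j + l j ^+ 2 = t,
       forall i j, i != j -> l i - l j != 0 & \sum_i l i = 0].
Proof.
move=> disc.
have [a aE] := solve_monicpoly (fun i : nat => if i is 0 then d else if i is 1 then t else 0)
  (isT : (0 < 3)%N).
(* [b] is a root of the cubic divided by x - a; the third root makes the sum zero. *)
have [b bE] := solve_monicpoly (fun i : nat => if i is 0 then t - a ^+ 2 else - a)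
  (isT : (0 < 2)%N).
move: aE bE; rewrite !big_ord_recl !big_ord0 /= expr0 !expr1 !mul0r mulr1 !addr0 => aE bE.
pose l i : F := match I3_of_nat (val (i : 'I_3)) with i0 => a | i1 => b | i2 => - a - b end.
have dE : d = a ^+ 3 - t * a by rewrite aE addrK.
have tE : t = a ^+ 2 + a * b + b ^+ 2 by rewrite bE; ring.
exists l; split.
- apply: ord3P => x; rewrite /l I3_of_ordK; case: x; rewrite dE tE; ring.
- by apply: ord3P => x; apply: ord3P => y; rewrite /l !I3_of_ordK tE; case: x; case: y => // _; ring.
- apply: ord3P => x; apply: ord3P => y; rewrite /l !I3_of_ordK => xy; apply: contra_neq disc => xy0.
  have -> : 2%:R * (4%:R * t ^+ 3 - 27%:R * d ^+ 2) =
      2%:R * ((a - b) * (a - (- a - b)) * (b - (- a - b))) ^+ 2.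
    by rewrite dE tE; ring.
  by case: x y xy xy0 => -[] //= _ /eqP; rewrite subr_eq0 => /eqP E;
    do [by rewrite E subrr ?(mul0r, mulr0) ?mul0r expr0n mulr0
      | by rewrite -E subrr ?(mul0r, mulr0) ?mul0r expr0n mulr0].
- by rewrite big_ord3 /l !I3_of_ordK /=; ring.
Qed.

(** The eigenvalues of [M] are distinct, so its spectral projectors have rank 1, and [N], commuting
    with them, acts on each eigenline by the scalar \tr (N p_i). *)
Lemma commuting_spectral (M N : 'M[F]_3) : \tr M = 0 ->
  \tr (M *m M) ^+ 3 - 54%:R * \det M ^+ 2 != 0 -> M *m N = N *m M ->
  exists l m : 'I_3 -> F, exists p : 'I_3 -> 'M[F]_3,
   [/\ forall i, p i *m p i = p i, forall i j, i != j -> p i *m p j = 0,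
       \sum_i p i = 1%:M, forall i, \tr (p i) = 1
     & M = \sum_i l i *: p i /\ N = \sum_i m i *: p i].
Proof.
move=> trM disc MN.
have two0 : 2%:R != 0 :> F by apply: natF_neq0.
set t := 2^-1 * \tr (M *m M); set d := \det M.
have M3 : M *m M *m M = t *: M + d%:M by apply: cayley_hamilton33.
have tE : \tr (M *m M) = 2%:R * t by rewrite /t mulrA mulfV ?mul1r.
have {}disc : 2%:R * (4%:R * t ^+ 3 - 27%:R * d ^+ 2) != 0.
  by apply: contra_neq disc => disc0; rewrite tE -/d -[RHS]disc0; ring.
have [l [l3 ll ld ls]] := depressed_cubic_roots disc.
(* With chi = x^3 - t x - d, [Q i] is the value at [M] of chi / (x - l i), and [D i] is chi'(l
   i). *)
pose D i := 3%:R * l i ^+ 2 - t.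
pose Q i := M *m M + l i *: M + (l i ^+ 2 - t)%:M.
have D0 i : D i != 0.
  have [j [k [ij ik kj]]] : exists j k, [/\ i != j, i != k & k != j].
    by move: i; apply: ord3P => -[]; [exists (ord_of_I3 i1), (ord_of_I3 i2)
      | exists (ord_of_I3 i0), (ord_of_I3 i2) | exists (ord_of_I3 i0), (ord_of_I3 i1)].
  have sk : l k = - (l i + l j).
    apply: (mulIf (ld i j ij)).
    apply/eqP; rewrite -subr_eq0; apply/eqP.
    transitivity ((l k ^+ 2 + l k * l i + l i ^+ 2) - (l k ^+ 2 + l k * l j + l j ^+ 2)); first by ring.
    by rewrite !ll ?subrr // eq_sym.
  have -> : D i = (l i - l j) * (l i - l k) by rewrite /D -(ll i j ij) sk; ring.
  by rewrite mulf_neq0 ?ld.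
have MQ i : M *m Q i = l i *: Q i.
  rewrite /Q !mulmxDr mulmxA M3 -scalemxAr mul_mx_scalar !scalerDr scalerA -expr2.
  have -> : l i *: (l i ^+ 2 - t)%:M = d%:M :> 'M_3.
    rewrite scale_scalar_mx; congr (_%:M); rewrite mulrBr -exprS l3; ring.
  rewrite scalerBl [t *: M + _]addrC -!addrA [RHS]addrA [RHS]addrC; congr (_ + _).
  by rewrite addrCA [t *: M + _]addrC subrK.
have QQ i j : Q i *m Q j = (l j ^+ 2 + l i * l j + l i ^+ 2 - t) *: Q j.
  rewrite {1}/Q !mulmxDl -mulmxA MQ -scalemxAr MQ scalerA -scalemxAl MQ scalerA.
  by rewrite mul_scalar_mx -!scalerDl addrA expr2.
pose p i := (D i)^-1 *: Q i.
have Mp i : M *m p i = l i *: p i by rewrite -scalemxAr MQ !scalerA mulrC.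
have pp i : p i *m p i = p i.
  rewrite -scalemxAl -scalemxAr QQ !scalerA; congr (_ *: _).
  have -> : l i ^+ 2 + l i * l i + l i ^+ 2 - t = D i by rewrite /D; ring.
  by rewrite mulfVK.
have pp0 i j : i != j -> p i *m p j = 0.
  move=> ij; rewrite -scalemxAl -scalemxAr QQ [l i * _]mulrC.
  by rewrite (ll j i) 1?eq_sym // subrr scale0r !scaler0.
have trp i : \tr (p i) = 1.
  rewrite mxtraceZ !mxtraceD mxtraceZ trM mulr0 addr0 tE mxtrace_scalar.
  have -> : 2%:R * t + (l i ^+ 2 - t) *+ 3 = D i by rewrite /D; ring.
  by rewrite mulVf.
have rp i : \rank (p i) = 1%N by apply: idem_rank.
have sp : \sum_i p i = 1%:M.
  (* The defect is an idempotent of trace 0, hence 0 in characteristic zero. *)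
  pose r : 'M[F]_3 := 1%:M - \sum_i p i.
  have rr : r *m r = r.
    apply: idem_compl; rewrite mulmx_suml; apply: eq_bigr => i _.
    by rewrite mulmx_sumr (bigD1 i) //= pp big1 ?addr0 // => j ji; rewrite pp0 // eq_sym.
  apply/eqP; rewrite eq_sym -subr_eq0 -mxrank_eq0; apply/eqP.
  apply: (idem_rank charF rr); rewrite /r raddfB /= mxtrace1.
  have -> : \tr (\sum_i p i) = \sum_i \tr (p i) by apply: raddf_sum.
  by rewrite big_ord3 !trp; ring.
exists l, (fun i => \tr (N *m p i)), p; split=> //; split.
  rewrite -[LHS]mulmx1 -sp mulmx_sumr; apply: eq_bigr => i _; exact: Mp.
rewrite -[LHS]mulmx1 -sp mulmx_sumr; apply: eq_bigr => i _.
rewrite -rank1_sandwich //.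
have QN : Q i *m N = N *m Q i.
  rewrite /Q !mulmxDl !mulmxDr -scalemxAl -scalemxAr MN mul_scalar_mx mul_mx_scalar.
  by rewrite -mulmxA MN !mulmxA MN.
by rewrite -[p i *m N]scalemxAl QN scalemxAr -mulmxA pp.
Qed.
End Spectral.

Lemma idem_sub (K : fieldType) n (A B : 'M[K]_n) :
  A *m A = A -> B *m B = B -> A *m B = B -> B *m A = B -> (A - B) *m (A - B) = A - B.
Proof. by move=> AA BB AB BA; rewrite mulmxBl !mulmxBr AA BB AB BA subrr subr0. Qed.

(** * From the operators on F^3 to the projectors on F^6 *)

Section Complement.
Variable F : closedFieldType.
Hypothesis charF : [pchar F] =i pred0.
Variables (E B Eo Bo : 'M[F]_3).
Hypotheses (EEo : forall i j, Eo i j * E i j = 1) (BBo : forall i j, Bo i j * B i j = 1).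
Hypothesis orth : E *m Eo^T + B *m Bo^T = 6%:R%:M.
Let G : 'M[F]_3 := 6%:R%:M - E^T *m Eo.
Hypotheses (Gunit : G \in unitmx) (GBunit : B *m Bo^T \in unitmx).
Variables (R L : bool -> 'M[F]_3) (w : bool -> 'I_3 -> F).
Hypotheses (R_tr : forall a, \tr (R a) = 0) (L_tr : forall b, \tr (L b) = 0).
Hypothesis R_diag : forall a i, (R a *m G) i i = 0.
Hypothesis R_comm : R false *m R true = R true *m R false.
Hypothesis L_eig : forall b, L b *m Bo = Bo *m diag_mx (\row_j w b j).
Hypothesis RL : forall a b, \tr ((L b)^T *m E *m (R a)^T *m Eo^T) = 0.
Let gram (M N : 'M[F]_3) :=
  \tr (M *m M) * \tr (N *m N) - \tr (M *m N) ^+ 2.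
Hypotheses (gramL : gram (L false) (L true) != 0) (gramR : gram (R false) (R true) != 0).
Hypothesis discR :
  \tr (R false *m R false) ^+ 3 - 54%:R * \det (R false) ^+ 2 != 0.

Let X : 'M[F]_(3, 3 + 3) := row_mx E B.
Let Xo : 'M[F]_(3, 3 + 3) := row_mx Eo Bo.
Let P : 'M[F]_(3 + 3) := 6%:R^-1 *: (Xo^T *m X).
Let Q : 'M[F]_(3 + 3) := 1%:M - P.
Let J : 'M[F]_(3 + 3, 3) := col_mx 1%:M 0.
Let J' : 'M[F]_(3 + 3, 3) := col_mx 0 1%:M.
Let D : 'M[F]_3 := J^T *m Q *m J.

Let six0 : 6%:R != 0 :> F. Proof. exact: natF_neq0. Qed.
Let three0 : 3%:R != 0 :> F. Proof. exact: natF_neq0. Qed.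

Let XXo : X *m Xo^T = 6%:R%:M.
Proof. by rewrite /X /Xo tr_row_mx mul_row_col orth. Qed.

Let PP : P *m P = P.
Proof.
rewrite /P -scalemxAl -scalemxAr mulmxA -(mulmxA _ X) XXo mul_mx_scalar -scalemxAl.
by rewrite !scalerA; congr (_ *: _); field; rewrite six0.
Qed.

Let QQ : Q *m Q = Q. Proof. exact: idem_compl. Qed.

Let XJ : X *m J = E. Proof. by rewrite /X /J mul_row_col mulmx1 mulmx0 addr0. Qed.
Let XJ' : X *m J' = B. Proof. by rewrite /X /J' mul_row_col mulmx1 mulmx0 add0r. Qed.
Let XoJ : Xo *m J = Eo. Proof. by rewrite /Xo /J mul_row_col mulmx1 mulmx0 addr0. Qed.
Let XoJ' : Xo *m J' = Bo. Proof. by rewrite /Xo /J' mul_row_col mulmx1 mulmx0 add0r. Qed.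
Let JJ : J^T *m J = 1%:M.
Proof. by rewrite /J tr_col_mx mul_row_col trmx1 mulmx1 trmx0 mulmx0 addr0. Qed.
Let JJ' : J^T *m J' = 0.
Proof. by rewrite /J /J' tr_col_mx mul_row_col trmx0 mul0mx addr0 mulmx0. Qed.
Let J'J : J'^T *m J = 0.
Proof. by rewrite /J /J' tr_col_mx mul_row_col trmx0 mul0mx add0r mulmx0. Qed.

Let block (U V : 'M[F]_(3 + 3, 3)) :
  U^T *m Q *m V = U^T *m V - 6%:R^-1 *: ((Xo *m U)^T *m (X *m V)).
Proof.
by rewrite /Q /P mulmxBr mulmx1 mulmxBl -scalemxAr -scalemxAl trmx_mul !mulmxA.
Qed.

Let GT : G^T = 6%:R%:M - Eo^T *m E.
Proof. by rewrite /G linearB /= tr_scalar_mx trmx_mul trmxK. Qed.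

Let DE : D = 6%:R^-1 *: G^T.
Proof.
rewrite /D block JJ XJ XoJ GT scalerBr.
by rewrite scale_scalar_mx mulVf.
Qed.

Let Dunit : D \in unitmx.
Proof. by rewrite DE unitmxZ ?unitmx_tr // unitfE invr_eq0. Qed.

(* iota and rho identify F^3 with the image of Q.                              *)
Let iota := Q *m J.
Let rho := invmx D *m J^T *m Q.

Let rho_iota : rho *m iota = 1%:M.
Proof.
by rewrite /rho /iota !mulmxA -(mulmxA _ Q Q) QQ -!mulmxA (mulmxA J^T) mulVmx.
Qed.

Let Ptr : \tr P = 3%:R.
Proof.
by rewrite /P mxtraceZ mxtrace_mulC XXo mxtrace_scalar mulrnAr mulVf.
Qed.

(** The difference is an idempotent of trace 3 - 3, hence zero. *)
Let iota_rho : iota *m rho = Q.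
Proof.
pose S := Q - iota *m rho.
have QS : Q *m iota = iota by rewrite /iota mulmxA QQ.
have SQ : rho *m Q = rho by rewrite /rho -mulmxA QQ.
have II : iota *m rho *m (iota *m rho) = iota *m rho.
  by rewrite mulmxA -(mulmxA iota) rho_iota mulmx1.
have SS : S *m S = S.
  by apply: idem_sub => //; [rewrite mulmxA QS|rewrite -mulmxA SQ].
apply/esym/eqP; rewrite -subr_eq0 -mxrank_eq0; apply/eqP.
apply: (idem_rank charF SS); rewrite /S raddfB /= mxtrace_mulC rho_iota mxtrace1.
rewrite /Q raddfB /= mxtrace1 Ptr; ring.
Qed.

(** Because of the transpose, the upper left block is (R G)^T / 6, whose diagonal is zero by
    [R_diag]. *)
Let K a := iota *m (R a)^T *m rho.

Let Jiota : J^T *m iota = D. Proof. by rewrite /iota mulmxA. Qed.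
Let rhoJ : rho *m J = 1%:M. Proof. by rewrite /rho -mulmxA -mulmxA (mulmxA J^T) mulVmx. Qed.

(* The operators K commute, are supported on the image of Q = 1 - P and have     *)
(* zero diagonal; hence the diagonals of their spectral projectors are constant. *)
Let KJJ a i : (J^T *m K a *m J) i i = 0.
Proof.
have -> : J^T *m K a *m J = (J^T *m iota) *m (R a)^T *m (rho *m J) by rewrite !mulmxA.
rewrite Jiota rhoJ mulmx1 DE -scalemxAl mxE.
by rewrite -trmx_mul mxE R_diag mulr0.
Qed.

Let Bo_unit : Bo \in unitmx.
Proof.
by move: GBunit; rewrite unitmx_mul unitmx_tr => /andP[].
Qed.

Let L_conj b : L b = Bo *m diag_mx (\row_j w b j) *m invmx Bo.
Proof. by rewrite -L_eig mulmxK. Qed.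

Let tr_LL b c : \tr (L b *m L c) = \sum_i w b i * w c i.
Proof.
rewrite !L_conj !mulmxA mulmxKV // mxtrace_mulC !mulmxA mulVmx // mul1mx mulmx_diag.
by rewrite mxtrace_diag; apply: eq_bigr => i _; rewrite !mxE.
Qed.

Let w_sum b : \sum_i w b i = 0.
Proof.
have := L_tr b; rewrite L_conj mxtrace_mulC !mulmxA mulVmx // mul1mx mxtrace_diag => H.
by rewrite -[RHS]H; apply: eq_bigr => i _; rewrite !mxE.
Qed.

Let KJ'J' a : J'^T *m K a *m J' = 36%:R^-1 *: (Bo^T *m E *m (R a)^T *m (invmx D *m (Eo^T *m B))).
Proof.
have -> : J'^T *m K a *m J' = (J'^T *m Q *m J) *m (R a)^T *m (invmx D *m (J^T *m Q *m J')).
  by rewrite /K /iota /rho !mulmxA.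
rewrite !block J'J JJ' !sub0r XoJ' XJ XoJ XJ' mulmxN mulNmx mulNmx mulmxN opprK.
by rewrite -!scalemxAr -!scalemxAl scalerA -invfM -natrM !mulmxA.
Qed.

(** By [orth], Eo^T (6 - E Eo^T) = (6 - Eo^T E) Eo^T, and the first factor on the right is 6 D; this
    removes the inverse of D from the trace. *)
Let DEo : invmx D *m (Eo^T *m (B *m Bo^T)) = 6%:R *: Eo^T.
Proof.
have -> : B *m Bo^T = 6%:R%:M - E *m Eo^T by rewrite -orth addrC addKr.
have -> : Eo^T *m (6%:R%:M - E *m Eo^T) = 6%:R *: (D *m Eo^T).
  rewrite DE -scalemxAl scalerA mulfV // scale1r GT.
  by rewrite mulmxBr mulmxBl mul_scalar_mx mul_mx_scalar mulmxA.
by rewrite -scalemxAr mulKmx.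
Qed.

(** Weighting the diagonal by an eigenvalue vector of [L b] gives, after [L_eig] and [DEo], a
    multiple of the trace in [RL]. So the diagonal is constant, and the total trace with the first
    block known makes it zero. *)
Let KJ'J'_diag a i : (J'^T *m K a *m J') i i = 0.
Proof.
set d := fun i => (J'^T *m K a *m J') i i.
have dw b : \sum_i w b i * d i = 0.
  transitivity (\tr (diag_mx (\row_j w b j) *m (J'^T *m K a *m J'))).
    by rewrite /mxtrace; apply: eq_bigr => j _; rewrite mul_diag_mx mxE [in RHS]mxE.
  rewrite KJ'J' -scalemxAr mxtraceZ.
  have -> : diag_mx (\row_j w b j) *m (Bo^T *m E *m (R a)^T *m (invmx D *m (Eo^T *m B)))
    = (Bo^T *m ((L b)^T *m E *m (R a)^T *m (invmx D *m (Eo^T *m B)))).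
    have := congr1 trmx (L_eig b); rewrite !trmx_mul tr_diag_mx => LE.
    by rewrite !mulmxA LE.
  rewrite mxtrace_mulC -!mulmxA.
  have -> : invmx D *m (Eo^T *m (B *m Bo^T)) = 6%:R *: Eo^T by exact: DEo.
  by rewrite -!scalemxAr mxtraceZ !mulmxA RL !mulr0.
have dE j : d i = d j.
  by apply: (orthogonal_traceless_const (w_sum false) (w_sum true)) => //; rewrite -!tr_LL.
have dsum : \sum_i d i = 0.
  have : \tr (K a) = 0 by rewrite /K mxtrace_mulC mulmxA rho_iota mul1mx mxtrace_tr R_tr.
  have <- : \tr (J^T *m K a *m J) + \tr (J'^T *m K a *m J') = \tr (K a).
    have -> : \tr (J^T *m K a *m J) = \tr (J *m J^T *m K a).
      by rewrite mxtrace_mulC mulmxA.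
    have -> : \tr (J'^T *m K a *m J') = \tr (J' *m J'^T *m K a).
      by rewrite mxtrace_mulC mulmxA.
    rewrite -mxtraceD -mulmxDl.
    suff -> : J *m J^T + J' *m J'^T = 1%:M by rewrite mul1mx.
    rewrite /J /J' !tr_col_mx !trmx1 !trmx0 !mul_col_row !mul1mx !mul0mx.
    by rewrite add_block_mx !addr0 !add0r -scalar_mx_block.
  by rewrite [X in X + _]big1 ?add0r // => j _; apply: KJJ.
apply: (mulfI three0); rewrite mulr0 -dsum.
by rewrite -(eq_bigr _ (fun j _ => dE j)) sumr_const card_ord mulr_natl.
Qed.

Let K_diag a i : K a i i = 0.
Proof.
have HJ : J^T *m K a *m J = ulsubmx (K a).
  rewrite -{1}[K a](submxK (K a)) /J tr_col_mx trmx1 trmx0.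
  by rewrite mul_row_block !mul1mx !mul0mx !addr0 mul_row_col mulmx1 mulmx0 addr0.
have HJ' : J'^T *m K a *m J' = drsubmx (K a).
  rewrite -{1}[K a](submxK (K a)) /J' tr_col_mx trmx1 trmx0.
  by rewrite mul_row_block !mul1mx !mul0mx !add0r mul_row_col mulmx1 mulmx0 add0r.
rewrite -(splitK i); case: split => j /=.
  by have := KJJ a j; rewrite HJ !mxE.
by have := KJ'J'_diag a j; rewrite HJ' !mxE.
Qed.

Lemma complementary_projectors : exists p : 'I_3 -> 'M[F]_(3 + 3),
  [/\ forall i, p i *m p i = p i, forall i j, i != j -> p i *m p j = 0,
      forall i, \tr (p i) = 1, \sum_i p i = 1%:M - P & forall i j, p i j j = 6%:R^-1].
Proof.
have tr_T (M N : 'M[F]_3) : \tr (M^T *m N^T) = \tr (M *m N).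
  by rewrite -trmx_mul mxtrace_tr mxtrace_mulC.
have [||| l [m [p [pp pp0 sp trp [lE mE]]]]] :=
  @commuting_spectral F charF (R false)^T (R true)^T.
- by rewrite mxtrace_tr R_tr.
- by rewrite tr_T det_tr.
- by rewrite -!trmx_mul R_comm.
pose p' i := iota *m p i *m rho.
have p'M i j : p' i *m p' j = iota *m (p i *m p j) *m rho.
  have -> : p' i *m p' j = iota *m p i *m (rho *m iota) *m (p j *m rho).
    by rewrite /p' !mulmxA.
  by rewrite rho_iota mulmx1 !mulmxA.
have trp' i : \tr (p' i) = 1 by rewrite /p' mxtrace_mulC mulmxA rho_iota mul1mx.
have sp' : \sum_i p' i = 1%:M - P.
  have -> : 1%:M - P = iota *m 1%:M *m rho by rewrite mulmx1 iota_rho.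
  by rewrite -sp mulmx_sumr mulmx_suml.
exists p'; split=> //.
- by move=> i; rewrite p'M pp.
- by move=> i j ij; rewrite p'M pp0 // mulmx0 mul0mx.
move=> i j.
have tr_comb (x y : 'I_3 -> F) :
    \tr ((\sum_i x i *: p i) *m (\sum_i y i *: p i)) = \sum_i x i * y i.
  rewrite mulmx_suml raddf_sum; apply: eq_bigr => k _ /=.
  rewrite mulmx_sumr (bigD1 k) //= big1 => [|h hk]; last first.
    by rewrite -scalemxAl -scalemxAr pp0 ?scaler0 // eq_sym.
  by rewrite addr0 -scalemxAl -scalemxAr pp !mxtraceZ trp mulr1.
have sum0 a (x : 'I_3 -> F) : (R a)^T = \sum_i x i *: p i -> \sum_i x i = 0.
  move=> xE; have := R_tr a; rewrite -mxtrace_tr xE raddf_sum => H; rewrite -[RHS]H.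
  by apply: eq_bigr => k _; rewrite /= mxtraceZ trp mulr1.
have dot0 a (x : 'I_3 -> F) : (R a)^T = \sum_i x i *: p i -> \sum_i x i * p' i j j = 0.
  move=> xE; rewrite -[RHS](K_diag a j) /K xE mulmx_sumr mulmx_suml summxE.
  by apply: eq_bigr => k _; rewrite -scalemxAr -scalemxAl [RHS]mxE.
have dE k : p' i j j = p' k j j.
  apply: (orthogonal_traceless_const (sum0 _ _ lE) (sum0 _ _ mE) _ (dot0 _ _ lE) (dot0 _ _ mE)).
  by rewrite -!tr_comb -lE -mE !tr_T.
(* The diagonal of P is 3/6, since entries of X and Xo are mutually inverse. *)
have : \sum_k p' k j j = 2%:R^-1.
  rewrite -summxE sp' !mxE eqxx /= (eq_bigr (fun=> 1)) => [|k _].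
    rewrite sumr_const card_ord.
    by apply: (mulfI six0); rewrite mulrBr mulr1 mulrA mulfV // mul1r; apply: (mulIf (natF_neq0 charF 1));
       rewrite mulfVK ?natF_neq0 //; ring.
  rewrite !mxE -(splitK j); case: split => h /=;
   by rewrite ?(row_mxEl, row_mxEr) ?EEo ?BBo.
rewrite -(eq_bigr _ (fun k _ => dE k)) sumr_const card_ord => H.
apply: (mulfI three0); rewrite mulr_natl H.
by apply: (mulIf six0); rewrite mulfVK // -[6%:R]/((2 * 3)%:R) natrM mulKf ?natF_neq0.
Qed.
End Complement.

(** * Complementary projectors *)

Section Assemble.
Variable F : closedFieldType.
Hypothesis charF : [pchar F] =i pred0.
Local Notation A := (fops F).
Implicit Types (f g : I3 -> I3 -> A).

Definition mx3 f : 'M[F]_3 := \matrix_(i, j) f (I3_of_nat i) (I3_of_nat j).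

Lemma mx3E f x y : mx3 f (ord_of_I3 x) (ord_of_I3 y) = f x y.
Proof. by rewrite mxE !I3_of_ordK. Qed.

Lemma mx3P f (M : 'M[F]_3) : (forall x y, M (ord_of_I3 x) (ord_of_I3 y) = f x y) -> M = mx3 f.
Proof. by move=> H; apply/matrixP => i j; rewrite mxE -H !ord_of_I3K. Qed.

Lemma mx3_mul f g : mx3 f *m mx3 g = mx3 (fun x y => sum3 (fun z => f x z * g z y : A)).
Proof. by apply: mx3P => x y; rewrite mxE big_ord3 !mx3E. Qed.

Lemma mx3_tr f : (mx3 f)^T = mx3 (transp f).
Proof. by apply: mx3P => x y; rewrite mxE mx3E. Qed.

Lemma mx3_trace f : \tr (mx3 f) = sum3 (fun x => f x x).
Proof. by rewrite /mxtrace big_ord3 !mx3E. Qed.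

Lemma mx3_det f : \det (mx3 f) = det3 f.
Proof. by rewrite det_mx33 !mx3E. Qed.

Lemma mx3_dot f g : \tr (mx3 f *m mx3 g) = dot2 f g.
Proof. by rewrite mx3_mul mx3_trace. Qed.

Lemma gdet_det3 f : (forall x, f x x = 3%:R) -> det3 f = gdet f.
Proof. by move=> f3; rewrite /det3 /gdet /sig2 /sig3 /= !f3; ring. Qed.

Variables (e b : I3 -> I3 -> A).
Hypotheses (e0 : nonvanishing e) (b0 : nonvanishing b) (eb : co_row_gram e =2 row_gram b).
Let l := lval b (inv_fun b).
Let k : I3 -> A := kval e b.
Let R := Rmx (co_col_gram e) k.
Let L := Rmx (transp (co_row_gram e)) l.
Hypothesis alpha0 : forall z, alpha (co_col_gram e) (oth1 z) (oth2 z) z != 0 :> F.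
Hypothesis u0 : forall z m,
  link e (inv_fun e) z (oth1 z) (oth2 z) m (oth1 m) (oth2 m) != 0 :> F.
Hypotheses (detC : gdet (co_col_gram e) != 0 :> F) (detB : gdet (co_row_gram e) != 0 :> F).
Hypotheses (gramL : gram2 (L false) (L true) != 0 :> F)
  (gramR : gram2 (R false) (R true) != 0 :> F) (discR : disc3 (R false) != 0 :> F).

Let two0 : 2%:R != 0 :> F. Proof. exact: natF_neq0. Qed.

Let gBd f x : co_row_gram f x x = 3%:R. Proof. by case: x. Qed.
Let mulVe f x y : nonvanishing f -> f x y * inv_fun f x y = 1 :> F.
Proof. by move=> f0; rewrite /inv_fun /= mulfV ?f0. Qed.

Lemma diag3_id f : (forall x, f x x = 3%:R) -> diag3 f =2 f.
Proof. by move=> f3; case=> -[] /=; rewrite ?f3. Qed.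

Lemma rowgram_diag f x : nonvanishing f -> rowgram f (inv_fun f) x x = 3%:R :> F.
Proof. by move=> f0; rewrite /rowgram /sum3 /= !mulVe //; ring. Qed.

Lemma row_gramE f : nonvanishing f -> row_gram f =2 rowgram f (inv_fun f).
Proof. by move=> f0; apply: diag3_id => x; apply: rowgram_diag. Qed.

Lemma co_row_gramE f : nonvanishing f -> co_row_gram f =2 fun x y =>
  (6%:R *+ (ord_of_I3 x == ord_of_I3 y) - rowgram f (inv_fun f) x y)%R.
Proof.
move=> f0 x y; case: x; case: y; rewrite ?rowgram_diag // /= ?mulr0n ?sub0r //;
  by rewrite mulr1n; ring.
Qed.

Lemma scalar_mx3 (c : F) : c%:M = mx3 (fun x y => c *+ (ord_of_I3 x == ord_of_I3 y)).
Proof. by apply: mx3P => x y; rewrite mxE. Qed.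

Lemma mx3_ext f g : f =2 g -> mx3 f = mx3 g.
Proof. by move=> fg; apply/matrixP => i j; rewrite !mxE fg. Qed.

Lemma mx3_gram f : nonvanishing f -> 6%:R%:M - mx3 f *m (mx3 (inv_fun f))^T = mx3 (co_row_gram f).
Proof.
move=> f0; rewrite mx3_tr mx3_mul scalar_mx3; apply: mx3P => x y.
by rewrite mxE [X in _ + X]mxE !mx3E co_row_gramE.
Qed.

Let E := mx3 e.
Let Eo := mx3 (inv_fun e).
Let B := mx3 b.
Let Bo := mx3 (inv_fun b).

Let e0' : nonvanishing (transp e). Proof. by move=> x y; apply: e0. Qed.

Let GE : 6%:R%:M - E^T *m Eo = mx3 (co_col_gram e).
Proof. by rewrite /E /Eo -[mx3 (inv_fun e)]trmxK mx3_tr [in X in _ *m X]mx3_tr -mx3_gram. Qed.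

Let BBE : B *m Bo^T = mx3 (co_row_gram e).
Proof.
rewrite (mx3_ext eb) (mx3_ext (row_gramE b0)) /B /Bo mx3_tr mx3_mul; exact: mx3_ext.
Qed.

Let orth : E *m Eo^T + B *m Bo^T = 6%:R%:M.
Proof. by rewrite BBE -mx3_gram // addrC subrK. Qed.

Let R_diag a i : (mx3 (R a) *m mx3 (co_col_gram e)) i i = 0.
Proof.
by move: i; apply: ord3P => x; rewrite mx3_mul mx3E; apply: Rmx_diag => y; case: y.
Qed.

Let R_comm : mx3 (R false) *m mx3 (R true) = mx3 (R true) *m mx3 (R false).
Proof.
rewrite !mx3_mul; apply: mx3_ext => x y; apply: (Rmx_comm two0 (j := jinv e b)).
- by move=> z x' y' I; apply: alpha_neq0 I.
- by move=> z x' y' I; apply: kval_jinv.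
- by move=> z x' y' I; apply: kval_quad.
Qed.

Let wt c : 'I_3 -> F := fun i => let y := I3_of_nat i in
  sum3 (fun m => L c (swap01 c i0) (swap01 c m) * b (swap01 c i0) y * inv_fun b (swap01 c m) y : A).

(** [L true] is the operator of [b] with its first two rows exchanged, so [row_struct] is applied to
    that matrix. *)
Let L_eig c : mx3 (L c) *m Bo = Bo *m diag_mx (\row_j wt c j).
Proof.
apply/matrixP; apply: ord3P => x; apply: ord3P => y.
rewrite mul_mx_diag /Bo mx3_mul mx3E [RHS]mxE mx3E.
pose p := swap01 c; have pI : injective p := @swap01_inj c.
pose b' i j := b (p i) j; have b'0 : nonvanishing b' by move=> i j; apply: b0.
have HG : transp (row_gram b') =2 fun i j => transp (co_row_gram e) (p i) (p j).
  by move=> i j; rewrite /transp eb /row_gram diag3_perm.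
have [_ _ _ W] := row_struct b'0.
have RE i j : rmat (transp (row_gram b')) (1 : A) (lval b' (inv_fun b') i1) (lval b' (inv_fun b') i2) i j
    = L c (p i) (p j).
  have El m : lval b' (inv_fun b') m = lval b (inv_fun b) (p m) := lval_perm b m pI.
  rewrite /L /p Rmx_swap !El.
  exact: (rmat_hom (@id_hom F) HG).
have px : p (p x) = x := swap01K c x.
have -> : inv_fun b x y = inv_fun b' (p x) y by rewrite /inv_fun /b' px.
rewrite [X in _ * X]mxE /wt I3_of_ordK mulrC.
rewrite -(@sum3_perm F p (fun z => L c x z * inv_fun b z y : A) pI) /sum3.
by have := W (p x) y; rewrite /sum3 !RE px.
Qed.

Let RL c a : \tr ((mx3 (L c))^T *m E *m (mx3 (R a))^T *m Eo^T) = 0.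
Proof.
have := tform_eq0 two0 e0 b0 eb alpha0 u0 (@swap01_inj c) (@swap01_inj a).
pose p := swap01 c; pose q := swap01 a.
have pI : injective p := @swap01_inj c. have qI : injective q := @swap01_inj a.
pose e' i j := e (p i) (q j).
have HC : co_col_gram e' =2 fun i j => co_col_gram e (q i) (q j) by move=> i j; apply: co_col_gram_perm.
have HB : transp (co_row_gram e') =2 fun i j => transp (co_row_gram e) (p i) (p j) by move=> i j; apply: co_row_gram_perm.
have RE i j : rmat (co_col_gram e') (1 : A) (k (q i1)) (k (q i2)) i j = R a (q i) (q j).
  rewrite /R /q Rmx_swap; exact: (rmat_hom (@id_hom F) HC).
have LE i j : rmat (transp (co_row_gram e')) (1 : A) (l (p i1)) (l (p i2)) i j = L c (p i) (p j).
  rewrite /L /p Rmx_swap; exact: (rmat_hom (@id_hom F) HB).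
rewrite /= -/p -/q -/e' /tform /sum3 !RE !LE /e' => T0.
rewrite !mx3_tr !mx3_mul mx3_trace -[RHS]T0 /sum3 /transp /inv_fun.
move: (R a) (L c) => Ra Lc.
rewrite /p /q => {HC RE qI T0 e' HB LE pI p q}.
by case: a; case: c; rewrite /=; ring.
Qed.

Theorem complement_of_struct : exists p : 'I_3 -> 'M[F]_(3 + 3),
  [/\ forall i, p i *m p i = p i, forall i j, i != j -> p i *m p j = 0,
      forall i, \tr (p i) = 1,
      \sum_i p i = 1%:M - 6%:R^-1 *: ((row_mx Eo Bo)^T *m row_mx E B)
    & forall i j, p i j j = 6%:R^-1].
Proof.
apply: (@complementary_projectors F charF E B Eo Bo _ _ _ _ _
  (fun a => mx3 (R a)) (fun c => mx3 (L c)) wt).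
- by apply: ord3P => x; apply: ord3P => y; rewrite !mx3E mulrC mulVe.
- by apply: ord3P => x; apply: ord3P => y; rewrite !mx3E mulrC mulVe.
- exact: orth.
- by rewrite GE unitmxE unitfE mx3_det gdet_det3 // => x; apply: gBd.
- by rewrite BBE unitmxE unitfE mx3_det gdet_det3.
- by move=> a; rewrite mx3_trace; apply: Rmx_trace.
- by move=> c; rewrite mx3_trace; apply: Rmx_trace.
- by move=> a i; rewrite GE; apply: R_diag.
- exact: R_comm.
- exact: L_eig.
- by move=> a c; apply: RL.
- by rewrite !mx3_dot.
- by rewrite !mx3_dot.
- rewrite mx3_dot mx3_det exprSr !expr2; exact: discR.
Qed.
End Assemble.

(** * Genericity as the nonvanishing of one polynomial *)

Section Generic.
Variable A : ops.
Local Open Scope ops_scope.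
Variables (e ei b bi : I3 -> I3 -> A).

Definition gen_row := diag3 (opp_fun (rowgram e ei)).
Definition gen_col := diag3 (opp_fun (rowgram (transp e) (transp ei))).
Definition gen_j := onat A 2 * alpha (transp gen_row) i1 i2 i0 * lval b bi i0 + gamma gen_row i1 i2 i0.
Definition gen_kden z := onat A 2 * alpha gen_col (oth1 z) (oth2 z) z.
Definition gen_knum z := gen_j - gamma gen_col (oth1 z) (oth2 z) z.
(** The denominators of [kval] are cleared through the homogenising factor of [rmat]: the condition
    must be polynomial in the entries and their inverses to define a regular function. *)
Definition gen_R a : I3 -> I3 -> A := fun x y =>
  let y1 := swap01 a i1 in let y2 := swap01 a i2 in
  rmat (fun x y => gen_col (swap01 a x) (swap01 a y)) (gen_kden y1 * gen_kden y2)
    (gen_knum y1 * gen_kden y2) (gen_knum y2 * gen_kden y1) (swap01 a x) (swap01 a y).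
Definition gen_L a : I3 -> I3 -> A := fun x y =>
  rmat (fun x y => transp gen_row (swap01 a x) (swap01 a y)) (onat A 1)
    (lval b bi (swap01 a i1)) (lval b bi (swap01 a i2)) (swap01 a x) (swap01 a y).
Definition gen_u z m := link e ei z (oth1 z) (oth2 z) m (oth1 m) (oth2 m).
Definition prod3 (f : I3 -> A) := f i0 * f i1 * f i2.
Definition generic : A :=
  prod3 (fun z => alpha gen_col (oth1 z) (oth2 z) z) * prod3 (fun z => prod3 (gen_u z))
  * (gdet gen_col * gdet gen_row)
  * (gram2 (gen_L false) (gen_L true) * gram2 (gen_R false) (gen_R true) * disc3 (gen_R false)).
End Generic.

Section GenericHom.
Variables (A B : ops) (h : A -> B).
Hypothesis hh : hom h.
Variables (e ei b bi : I3 -> I3 -> A) (e' ei' b' bi' : I3 -> I3 -> B).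
Hypotheses (He : img h e e') (Hei : img h ei ei') (Hb : img h b b') (Hbi : img h bi bi').

Let HB : img h (gen_row e ei) (gen_row e' ei').
Proof. exact/(diag3_hom hh)/(opp_fun_hom hh)/(rowgram_hom hh). Qed.
Let HC : img h (gen_col e ei) (gen_col e' ei').
Proof. exact/(diag3_hom hh)/(opp_fun_hom hh)/(rowgram_hom hh)/transp_hom/Hei/transp_hom. Qed.

Lemma generic_hom : h (generic e ei b bi) = generic e' ei' b' bi'.
Proof.
case: (hh) => hD hM hN hc.
have Hl m : h (lval b bi m) = lval b' bi' m by apply: lval_hom.
have Hj : h (gen_j e ei b bi) = gen_j e' ei' b' bi'.
  by rewrite /gen_j hD hM Hl hM hc (alpha_hom hh (transp_hom HB)) (gamma_hom hh HB).
have Ha x y z : h (alpha (gen_col e ei) x y z) = alpha (gen_col e' ei') x y z by apply: alpha_hom.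
have Hd z : h (gen_kden e ei z) = gen_kden e' ei' z by rewrite /gen_kden hM hc Ha.
have Hn z : h (gen_knum e ei b bi z) = gen_knum e' ei' b' bi' z.
  by rewrite /gen_knum hD hN Hj (gamma_hom hh HC).
have HR a : img h (gen_R e ei b bi a) (gen_R e' ei' b' bi' a).
  move=> x y; rewrite /gen_R -!(Hd, Hn) -!hM.
  by apply: (rmat_hom hh) => i j; apply: HC.
have HL a : img h (gen_L e ei b bi a) (gen_L e' ei' b' bi' a).
  move=> x y; rewrite /gen_L -!Hl -hc.
  by apply: (rmat_hom hh) => i j; apply: HB.
have Hu z m : h (gen_u e ei z m) = gen_u e' ei' z m by exact: (link_hom hh _ _ _ _ _ _ He Hei).
have H3 f f' : (forall z, h (f z) = f' z) -> h (prod3 f) = prod3 f'.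
  by move=> H; rewrite /prod3 !hM !H.
have h2 x y x' y' : h x = x' -> h y = y' -> h (omul x y) = omul x' y'.
  by move=> <- <-; apply: hM.
apply: (h2); first by apply: (h2); [apply: (h2); apply: (H3) => z; [|apply: (H3)]
  | apply: (h2); apply: (gdet_hom hh)].
by apply: (h2); [apply: (h2); apply: (gram2_hom hh) | apply: (disc3_hom hh)].
Qed.
End GenericHom.

Section GenericField.
Variable F : closedFieldType.
Hypothesis charF : [pchar F] =i pred0.
Local Notation A := (fops F).
Variables (e b : I3 -> I3 -> A).
Hypotheses (e0 : nonvanishing e) (b0 : nonvanishing b) (eb : co_row_gram e =2 row_gram b).

Lemma rmat_scale (t : I3 -> I3 -> A) (s k1 k2 : A) x y :
  rmat t s (s * k1)%R (s * k2)%R x y = s * rmat t (1 : A) k1 k2 x y :> F.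
Proof. by case: x; case: y; rewrite /rmat /=; ring. Qed.

Lemma dot2_scale (s s' : F) (f g : I3 -> I3 -> A) :
  dot2 (fun x y => s * f x y : A) (fun x y => s' * g x y : A) = s * s' * dot2 f g :> F.
Proof. by rewrite /dot2 /sum3 /=; ring. Qed.

Lemma gram2_scale (s s' : F) (f g f' g' : I3 -> I3 -> A) :
  f' =2 (fun x y => s * f x y) -> g' =2 (fun x y => s' * g x y) ->
  gram2 f' g' = s ^+ 2 * s' ^+ 2 * gram2 f g :> F.
Proof.
move=> ff gg; rewrite (gram2_hom (@id_hom F) ff gg) /gram2 !dot2_scale /=; ring.
Qed.

Lemma disc3_scale (s : F) (f f' : I3 -> I3 -> A) : f' =2 (fun x y => s * f x y) ->
  disc3 f' = s ^+ 6 * disc3 f :> F.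
Proof.
by move=> ff; rewrite (disc3_hom (@id_hom F) ff) /disc3 !dot2_scale /det3 /=; ring.
Qed.

Lemma omul_neq0 (x y : A) : (omul x y != 0 :> F) -> x != 0 :> F /\ y != 0 :> F.
Proof. by rewrite mulf_eq0 negb_or => /andP. Qed.

Lemma prod3_neq0 (f : I3 -> A) : prod3 f != 0 :> F -> forall z, f z != 0 :> F.
Proof. by move=> /omul_neq0[/omul_neq0[? ?] ?] []. Qed.

(** [gen_R] is R times the scalar [s c], and [gram2] and [disc3] are homogeneous, so their
    nonvanishing passes to R. *)
Lemma complement_of_generic : generic e (inv_fun e) b (inv_fun b) != 0 :> F ->
  exists p : 'I_3 -> 'M[F]_(3 + 3),
  [/\ forall i, p i *m p i = p i, forall i j, i != j -> p i *m p j = 0,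
      forall i, \tr (p i) = 1,
      \sum_i p i = 1%:M - 6%:R^-1 *:
        ((row_mx (mx3 (inv_fun e)) (mx3 (inv_fun b)))^T *m row_mx (mx3 e) (mx3 b))
    & forall i j, p i j j = 6%:R^-1].
Proof.
have two0 : 2%:R != 0 :> F by apply: natF_neq0.
move=> /omul_neq0[/omul_neq0[/omul_neq0[/prod3_neq0 a0 /prod3_neq0 u0]]].
move=> /omul_neq0[dC dB] /omul_neq0[/omul_neq0[gL gR] dR].
have {}u0 z m := prod3_neq0 (u0 z) m.
have d0 z : gen_kden e (inv_fun e) z != 0 :> F by apply: mulf_neq0.
have nE z : gen_knum e (inv_fun e) b (inv_fun b) z = gen_kden e (inv_fun e) z * kval e b z :> F.
  by rewrite /kval mulrC divfK //; apply: d0.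
pose s c : F := gen_kden e (inv_fun e) (swap01 c i1) * gen_kden e (inv_fun e) (swap01 c i2).
have hRE c : gen_R e (inv_fun e) b (inv_fun b) c =2 fun x y => s c * Rmx (co_col_gram e) (kval e b) c x y.
  move=> x y; rewrite /gen_R !nE.
  have mE (x' y' k : F) : x' * k * y' = y' * x' * k by ring.
  have -> : (gen_kden e (inv_fun e) (swap01 c i1) * kval e b (swap01 c i1) * gen_kden e (inv_fun e) (swap01 c i2))%O
    = s c * kval e b (swap01 c i1) by exact: mulrAC.
  have -> : (gen_kden e (inv_fun e) (swap01 c i2) * kval e b (swap01 c i2) * gen_kden e (inv_fun e) (swap01 c i1))%O
    = s c * kval e b (swap01 c i2) by exact: mE.
  exact: rmat_scale.
apply: complement_of_struct => //.
- by apply: contra_neq gR => H; rewrite (gram2_scale (hRE _) (hRE _)) H mulr0.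
- by apply: contra_neq dR => H; rewrite (disc3_scale (hRE _)) H mulr0.
Qed.
End GenericField.

(** * A point in general position *)

Definition qops : ops := @Ops QArith_base.Q
  (fun x y => Qreduction.Qred (QArith_base.Qplus x y))
  (fun x y => Qreduction.Qred (QArith_base.Qmult x y))
  QArith_base.Qopp (fun n => QArith_base.inject_Z (Z.of_nat n)).

(* The rows (1,1,1,1,1,1), (4,-1,-2,-4,1,2), (-15,-1,3,5,3,5), divided by their  *)
(* first entries.                                                               *)
Definition qpt (right : bool) : I3 -> I3 -> qops := fun x y =>
  let p n d := QArith_base.Qmake (Z.of_nat n) (Pos.of_nat d) in
  let m n d := QArith_base.Qmake (Z.opp (Z.of_nat n)) (Pos.of_nat d) in
  match x, y, right with
  | i0, _, _ | _, i0, false => p 1 1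
  | i1, i1, false => m 1 4 | i1, i2, false => m 1 2
  | i1, i0, true => m 1 1 | i1, i1, true => p 1 4 | i1, i2, true => p 1 2
  | i2, i1, false => p 1 15 | i2, i2, false => m 1 5
  | i2, i1, true => m 1 5 | i2, _, true => m 1 3
  end%N.
Definition qpti right : I3 -> I3 -> qops := fun x y => QArith_base.Qinv (qpt right x y).

(** Decided over the rationals; characteristic zero keeps a nonzero rational nonzero in F. *)
Lemma generic_qpt :
  QArith_base.Qnum (generic (qpt false) (qpti false) (qpt true) (qpti true)) <> Z0.
Proof. by vm_compute. Qed.

Section RatMap.
Variable F : closedFieldType.
Hypothesis charF : [pchar F] =i pred0.
Local Notation Z_to_F := (@Z_to_F F).

Lemma Z_to_F_neq0 z : z <> Z0 -> Z_to_F z != 0.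
Proof.
have nat0 n : (n%:R == 0 :> F) = (n == 0%N) by move/pcharf0P: charF => ->.
case: z => [//|p|p] _; rewrite /Z_to_F /=.
  by rewrite -pmulrn nat0; case: (Pos2Nat.is_succ p) => n ->.
by rewrite NegzE mulrNz oppr_eq0 -pmulrn nat0.
Qed.

Definition Q_to_F (x : qops) : fops F :=
  Z_to_F (QArith_base.Qnum x) / Z_to_F (Zpos (QArith_base.Qden x)).

Let den0 p : Z_to_F (Zpos p) != 0. Proof. exact: Z_to_F_neq0. Qed.

Lemma Q_to_F_Qeq x y : QArith_base.Qeq x y -> Q_to_F x = Q_to_F y.
Proof.
move=> xy; apply/eqP; rewrite /Q_to_F eqr_div ?den0 //; apply/eqP.
by rewrite -!Z_to_FM; congr Z_to_F; exact: xy.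
Qed.

Lemma Q_to_F_hom : hom Q_to_F.
Proof.
split=> [x y|x y|x|n].
- rewrite (Q_to_F_Qeq (Qreduction.Qred_correct _)) /Q_to_F /= Pos2Z.inj_mul.
  by rewrite [Z_to_F (Z.add _ _)]Z_to_FD ![Z_to_F (Z.mul _ _)]Z_to_FM; field; rewrite !den0.
- rewrite (Q_to_F_Qeq (Qreduction.Qred_correct _)) /Q_to_F /= Pos2Z.inj_mul.
  by rewrite ![Z_to_F (Z.mul _ _)]Z_to_FM; field; rewrite !den0.
- by rewrite /Q_to_F /= [Z_to_F (Z.opp _)]Z_to_FN mulNr.
- rewrite /Q_to_F /= {2}/Z_to_F /= divr1 /Z_to_F; case: n => //= n.
  by rewrite SuccNat2Pos.id_succ.
Qed.

Lemma Q_to_F_neq0 x : QArith_base.Qnum x <> Z0 -> Q_to_F x != 0 :> F.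
Proof. by move=> x0; rewrite mulf_neq0 ?invr_eq0 ?den0 // Z_to_F_neq0. Qed.

Definition pt_mx (right : bool) : I3 -> I3 -> fops F := fun x y =>
  Q_to_F (qpt right x y).

Lemma pt_mx_neq0 right : nonvanishing (pt_mx right).
Proof. by case: right => -[] []; apply: Q_to_F_neq0. Qed.

Lemma qpti_img right : img Q_to_F (qpti right) (inv_fun (pt_mx right)).
Proof.
move=> x y; apply: (mulIf (pt_mx_neq0 right x y)); rewrite [RHS]mulVf ?pt_mx_neq0 //.
have hM : forall a c : qops, Q_to_F (omul a c) = Q_to_F a * Q_to_F c by case: Q_to_F_hom.
by rewrite -hM; case: right; case: x; case: y; rewrite /Q_to_F /= {2}/Z_to_F /= divr1.
Qed.

Lemma generic_pt : generic (pt_mx false) (inv_fun (pt_mx false))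
  (pt_mx true) (inv_fun (pt_mx true)) != 0 :> F.
Proof.
rewrite -(generic_hom Q_to_F_hom (e := qpt false) (ei := qpti false) (b := qpt true)
  (bi := qpti true)) //; try exact: qpti_img.
exact/Q_to_F_neq0/generic_qpt.
Qed.

Lemma pt_orth : co_row_gram (pt_mx false) =2 row_gram (pt_mx true).
Proof.
move=> x y.
have qI right : img Q_to_F (qpt right) (pt_mx right) by [].
have -> : co_row_gram (pt_mx false) x y = Q_to_F (diag3 (opp_fun (rowgram (qpt false) (qpti false))) x y).
  by symmetry; apply: (diag3_hom Q_to_F_hom (opp_fun_hom Q_to_F_hom (rowgram_hom Q_to_F_hom (qI _) (qpti_img _)))).
have -> : row_gram (pt_mx true) x y = Q_to_F (diag3 (rowgram (qpt true) (qpti true)) x y).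
  by symmetry; apply: (diag3_hom Q_to_F_hom (rowgram_hom Q_to_F_hom (qI _) (qpti_img _))).
by congr Q_to_F; case: x; case: y; vm_compute.
Qed.
End RatMap.

(** * Normal form of representations *)

Section Normal.
Variable F : closedFieldType.
Hypothesis charF : [pchar F] =i pred0.

Let six0 : 6%:R != 0 :> F. Proof. exact: natF_neq0. Qed.

Definition diag_tuple (p : 'I_3 -> 'M[F]_6) : 'I_3 + 'I_6 -> 'M[F]_6 :=
  fun x => match x with inl i => p i | inr j => delta_mx j j end.

(** For q = E_jj and p of rank 1, q p q = p_jj q and p q p = \tr (q p) p = p_jj p, so a diagonal
    equal to 1/6 gives both mixed relations. *)
Lemma diag_tuple_rep (p : 'I_3 -> 'M[F]_6) :
  (forall i, p i *m p i = p i) -> (forall i j, i != j -> p i *m p j = 0) ->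
  (forall i, \tr (p i) = 1) -> (forall i j, p i j j = 6%:R^-1) ->
  B36_rep (diag_tuple p).
Proof.
move=> pp pp0 tp pd.
have rp i : \rank (p i) = 1%N by apply: (idem_rank charF).
have tdp i j : \tr (delta_mx j j *m p i) = 6%:R^-1.
  rewrite /mxtrace (bigD1 j) //= big1 => [|k kj].
    rewrite addr0 mxE (bigD1 j) //= big1 => [|k kj].
      by rewrite mxE !eqxx mul1r addr0 pd.
    by rewrite mxE (negPf kj) andbF mul0r.
  by rewrite mxE big1 // => h _; rewrite mxE (negPf kj) mul0r.
have dp j (M : 'M[F]_6) : delta_mx j j *m M *m delta_mx j j = M j j *: delta_mx j j.
  apply/matrixP => a b; rewrite mxE (bigD1 j) //= big1 => [|k kj].
    rewrite addr0 mxE (bigD1 j) //= big1 => [|k kj].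
      by rewrite !mxE !eqxx /= andbT addr0; case: (a == j); case: (b == j); rewrite ?mulr1 ?mulr0 ?mul0r ?mul1r.
    by rewrite mxE (negPf kj) andbF mul0r.
  by rewrite [delta_mx _ _ k b]mxE (negPf kj) mulr0.
split=> /=.
- split=> // j; by rewrite mul_delta_mx.
- by split=> // j j' jj'; rewrite mul_delta_mx_0.
- split=> [i j|i j]; first by rewrite rank1_sandwich // tdp.
  by rewrite dp pd.
- apply/matrixP => a b; rewrite summxE (bigD1 a) //= big1 => [|k ka].
    by rewrite !mxE eqxx addr0 /=; case: eqP => [->|/eqP/negPf]; rewrite ?eqxx // eq_sym => ->.
  by rewrite mxE eq_sym (negPf ka).
- by split=> // j; rewrite mxrank_delta.
Qed.

Lemma conj_rep (x : 'I_3 + 'I_6 -> 'M[F]_6) (u : 'M[F]_6) : u \in unitmx ->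
  B36_rep x -> B36_rep (fun a => u *m x a *m invmx u).
Proof.
move=> uU [[pp qq] [pp0 qq0] [pqp qpq] sq [rp rq]].
have cM a b : u *m a *m invmx u *m (u *m b *m invmx u) = u *m (a *m b) *m invmx u.
  by rewrite !mulmxA mulmxKV.
have cZ c a : u *m (c *: a) *m invmx u = c *: (u *m a *m invmx u).
  by rewrite -scalemxAr -scalemxAl.
have cr a : \rank (u *m a *m invmx u) = \rank a.
  rewrite mxrankMfree ?row_free_unit ?unitmx_inv //.
  by rewrite (eqmxMfull a) // row_full_unit.
split=> /=.
- by split=> i; rewrite cM ?pp ?qq.
- by split=> i j ij; rewrite cM ?pp0 ?qq0 // mulmx0 mul0mx.
- by split=> i j; rewrite !cM ?pqp ?qpq cZ.
- by rewrite -conjmx_sum sq conjmx1.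
- by split=> i; rewrite cr.
Qed.

Lemma rank1_idem_factor n (p : 'M[F]_n) : p *m p = p -> \rank p = 1%N ->
  exists (c : 'cV[F]_n) (r : 'rV[F]_n), p = c *m r /\ r *m c = 1%:M.
Proof.
move=> pp p1; have tp : \tr p = 1 by rewrite mxtrace_idem // p1.
move: (col_base p) (row_base p) (mulmx_base p); rewrite p1 => c r cr.
exists c, r; split=> //; rewrite [r *m c]mx11_scalar; congr (_%:M).
by rewrite -tp -cr mxtrace_mulC /mxtrace big_ord1.
Qed.

Section NormalForm.
Variables (x : 'I_3 + 'I_6 -> 'M[F]_6) (Bx : B36_rep x).
Let p i := x (inl i).
Let q j := x (inr j).
Let i0' : 'I_3 := ord_of_I3 i0.

(* If p_i = (x_ik / (6 x_ij))_jk and q_j = E_jj then nX i j is x_ij, normalised  *)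
(* so that the first row and column are 1.                                      *)
Definition nX i j : F := 36%:R * \tr (x (inl (ord_of_I3 i0)) *m x (inr ord0) *m x (inl i) *m x (inr j)).
Definition nXi i j : F := 36%:R * \tr (x (inl i) *m x (inr ord0) *m x (inl (ord_of_I3 i0)) *m x (inr j)).

Definition std_p i : 'M[F]_6 := \matrix_(j, k) (6%:R^-1 * (nXi i j * nX i k)).

(** Writing p_i = c_i r_i turns the traces into products of scalars r q c. These scalars depend on
    the factorisation, the traces do not; each product [al i j * be i j] is 1/36, whence the factor
    36. *)
Lemma normal_form :
  [/\ forall i j, nX i j * nXi i j = 1,
      forall i i', \sum_j nX i j * nXi i' j = 6%:R *+ (i == i') &
      exists2 u : 'M[F]_6, u \in unitmx &
        (forall i, p i = u *m std_p i *m invmx u) /\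
        (forall j, q j = u *m delta_mx j j *m invmx u)].
Proof.
have [[pp qq] [pp0 qq0] [pqp qpq] sq [rp rq]] := Bx.
have /fin_all_exists[c /fin_all_exists[r cr]] : forall i, exists ci, exists ri,
    p i = ci *m ri /\ ri *m ci = 1%:M := fun i => rank1_idem_factor (pp i) (rp i).
have pE i : p i = c i *m r i by case: (cr i).
have rc i : r i *m c i = 1%:M by case: (cr i).
pose c0 := c i0'; pose r0 := r i0'.
pose al i j := (r0 *m q j *m c i) 0 0; pose be i j := (r i *m q j *m c0) 0 0.
have alE i j : r0 *m q j *m c i = (al i j)%:M by apply: mx11_scalar.
have beE i j : r i *m q j *m c0 = (be i j)%:M by apply: mx11_scalar.
have rc0 i i' : i != i' -> r i *m c i' = 0.
  move=> ii'; have := congr1 (fun M => r i *m M *m c i') (pp0 _ _ ii').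
  by rewrite /= -/(p i) -/(p i') !pE !mulmxA rc mul1mx -mulmxA rc mulmx1 mulmx0 mul0mx.
have qE j : r0 *m q j *m c0 = (6%:R^-1)%:M.
  have := congr1 (fun M => r0 *m M *m c0) (pqp i0' j).
  rewrite /= -/(p i0') -/(q j) !pE -/c0 -/r0 !mulmxA rc mul1mx -mulmxA rc mulmx1 => ->.
  by rewrite -scalemxAr -scalemxAl !mulmxA rc mul1mx rc scalemx1.
have al_be i j : al i j * be i j = 36%:R^-1.
  have : r0 *m (q j *m p i *m q j) *m c0 = (al i j * be i j)%:M.
    by rewrite pE !mulmxA alE -(mulmxA _ (r i)) -(mulmxA _ (r i *m _)) beE -scalar_mxM.
  rewrite [q j *m _ *m _]qpq -scalemxAr -scalemxAl qE scale_scalar_mx -invfM -natrM.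
  by move=> /matrixP/(_ 0 0); rewrite !mxE eqxx.
have be_al i i' : \sum_j be i j * al i' j = (6%:R^-1) *+ (i == i').
  have E : r i *m (\sum_j q j *m p i0' *m q j) *m c i' = (\sum_j be i j * al i' j)%:M.
    rewrite mulmx_sumr mulmx_suml raddf_sum; apply: eq_bigr => j _ /=.
    by rewrite pE !mulmxA beE -(mulmxA _ r0) -(mulmxA _ (r0 *m _)) alE -scalar_mxM.
  move: E; rewrite (eq_bigr (fun j => 6%:R^-1 *: q j)) => [|j _]; last exact: qpq.
  rewrite -scaler_sumr sq -scalemxAr -scalemxAl mulmx1.
  have -> : r i *m c i' = (i == i')%:R%:M.
    by case: eqP => [->|/eqP/rc0->]; rewrite ?rc // raddf0.
  rewrite scale_scalar_mx => /matrixP/(_ 0 0); rewrite !mxE eqxx !mulr1n => <-.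
  by rewrite mulr_natr.
have tr2E (M N : 'M[F]_6) i i' : \tr (p i *m M *m p i' *m N) =
   (r i *m M *m c i') 0 0 * (r i' *m N *m c i) 0 0.
  have -> : p i *m M *m p i' *m N = c i *m ((r i *m M *m c i') *m (r i' *m N)).
    by rewrite !pE !mulmxA.
  move: (r i *m M *m c i') => s.
  rewrite mxtrace_mulC {1}[s]mx11_scalar mul_scalar_mx -scalemxAl mxtraceZ.
  by rewrite /mxtrace big_ord1.
have nXE i j : nX i j = 36%:R * (al i ord0 * be i j) by rewrite /nX -/(p _) -/(p _) tr2E.
have nXiE i j : nXi i j = 36%:R * (be i ord0 * al i j) by rewrite /nXi -/(p _) -/(p _) tr2E.
have s36 : 36%:R != 0 :> F by apply: natF_neq0.
split.
- move=> i j; rewrite nXE nXiE.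
  transitivity (36%:R * 36%:R * (al i ord0 * be i ord0) * (al i j * be i j)); first by ring.
  by rewrite !al_be; field.
- move=> i i'; transitivity (\sum_j 36%:R * 36%:R * (al i ord0 * be i' ord0) * (be i j * al i' j)).
    by apply: eq_bigr => j _; rewrite nXE nXiE; ring.
  rewrite -mulr_sumr be_al; case: eqP => [<-|_]; last by rewrite !mulr0n mulr0.
  by rewrite al_be !mulr1n; field; rewrite six0.
(* The vectors q_j c0 form a basis adapted to the q_j; the rows 6 r0 q_j are dual to it because r0
   q_j c0 = 1/6. *)
pose u : 'M[F]_6 := \matrix_(a, j) (q j *m c0) a 0.
pose w : 'M[F]_6 := \matrix_(j, a) (6%:R * (r0 *m q j) 0 a).
have colu j : col j u = q j *m c0 by apply/matrixP => a b; rewrite !mxE (ord1 b).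
have roww j : row j w = 6%:R *: (r0 *m q j).
  by apply/matrixP => a b; rewrite !mxE (ord1 a).
have wMu (M : 'M[F]_6) j k : (w *m M *m u) j k = 6%:R * (r0 *m q j *m M *m q k *m c0) 0 0.
  transitivity ((row j w *m M *m col k u) 0 0).
    rewrite -row_mul [LHS]mxE [RHS]mxE; apply: eq_bigr => l _.
    by rewrite [row _ _ _ _]mxE [col _ _ _ _]mxE.
  by rewrite roww colu -!scalemxAl mxE !mulmxA.
have wu : w *m u = 1%:M.
  apply/matrixP => j k; rewrite -(mulmx1 w) wMu mulmx1 -(mulmxA r0) [RHS]mxE.
  have [<-|jk] := eqVneq j k.
    by rewrite [q j *m q j]qq qE mxE eqxx mulr1n mulfV.
  by rewrite [q j *m q k]qq0 // mulmx0 mul0mx mxE mulr0.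
have [wU uU] := mulmx1_unit wu.
have wE : w = invmx u by rewrite -[LHS]mulmx1 -(mulmxV uU) mulmxA wu mul1mx.
have conjE (M N : 'M[F]_6) : w *m M *m u = N -> M = u *m N *m invmx u.
  by move=> <-; rewrite wE !mulmxA mulmxV // mul1mx mulmxK.
exists u => //; split=> [i|j]; apply: conjE; apply/matrixP => a b; rewrite wMu [RHS]mxE.
  rewrite pE !mulmxA alE -!mulmxA mul_scalar_mx mxE !mulmxA beE mxE eqxx mulr1n.
  rewrite nXE nXiE.
  transitivity (6%:R^-1 * (36%:R * 36%:R * (al i ord0 * be i ord0) * (al i a * be i b)));
    last by ring.
  by rewrite [al i ord0 * _]al_be; field; rewrite ?six0 ?s36.
rewrite -(mulmxA r0); have [->|aj] := eqVneq a j; last first.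
  by rewrite [q a *m q j]qq0 // mulmx0 !mul0mx mxE mulr0.
rewrite [q j *m q j]qq -(mulmxA r0); have [->|bj] := eqVneq b j; last first.
  by rewrite [q j *m q b]qq0 1?eq_sym // mulmx0 mul0mx mxE mulr0.
by rewrite [q j *m q j]qq qE mxE eqxx mulr1n mulfV.
Qed.

Definition half (right : bool) (f : 'I_3 -> 'I_6 -> F) : I3 -> I3 -> fops F := fun a c =>
  f (ord_of_I3 a) (if right then @rshift 3 3 (ord_of_I3 c) else @lshift 3 3 (ord_of_I3 c)).

Lemma row_mx_half (f : 'I_3 -> 'I_6 -> F) i j :
  row_mx (mx3 (half false f)) (mx3 (half true f)) i j = f i j.
Proof.
rewrite -(@splitK 3 3 j); case: (@split 3 3 j) => h /=;
  by rewrite ?row_mxEl ?row_mxEr mxE /half !ord_of_I3K.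
Qed.

Lemma complement_rep :
  generic (half false nX) (half false nXi) (half true nX) (half true nXi) != 0 :> F ->
  exists y, [/\ B36_rep y, forall j, y (inr j) = x (inr j) &
    \sum_i y (inl i) = 1%:M - \sum_i x (inl i)].
Proof.
have [XXi Xorth [u uU [pu qu]]] := normal_form.
have X0 r : nonvanishing (half r nX).
  move=> a c; have := XXi (ord_of_I3 a) (if r then @rshift 3 3 (ord_of_I3 c) else @lshift 3 3 (ord_of_I3 c)).
  by apply: contra_eq_neq => H; rewrite -[nX _ _]/(half r nX a c) H mul0r eq_sym oner_eq0.
have Xi r : half r nXi =2 inv_fun (half r nX).
  by move=> a c; apply: (mulfI (X0 r a c)); rewrite [LHS]XXi mulfV ?X0.
rewrite (generic_hom (@id_hom F) (e := half false nX) (fun _ _ => erefl) (Xi false)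
  (fun _ _ => erefl) (Xi true)) => gen.
have rowE a a' : rowgram (half false nX) (inv_fun (half false nX)) a a' +
    rowgram (half true nX) (inv_fun (half true nX)) a a' = 6%:R *+ (ord_of_I3 a == ord_of_I3 a') :> F.
  rewrite -Xorth (@big_split_ord _ _ _ 3 3) !big_ord3 /rowgram /sum3 -!Xi.
  by [].
have orth : co_row_gram (half false nX) =2 row_gram (half true nX).
  move=> a a'; have := rowE a a'; case: a; case: a' => //= H;
    by apply/eqP; rewrite eq_sym -addr_eq0 addrC; apply/eqP.
have [p' [pp pp0 tp sp dp]] := complement_of_generic charF (X0 false) (X0 true) orth gen.
exists (fun a => u *m diag_tuple p' a *m invmx u); split.
- exact/(conj_rep uU)/diag_tuple_rep.
- by move=> j; rewrite /= -qu.
rewrite -conjmx_sum /= sp conjmxB conjmx1 //; congr (_ - _).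
rewrite (eq_bigr _ (fun i _ => pu i)) -conjmx_sum; congr (_ *m _ *m _).
apply/matrixP => a c; rewrite summxE mxE [X in _ * X]mxE mulr_sumr; apply: eq_bigr => i _.
rewrite [RHS]mxE; congr (_ * (_ * _)).
  by rewrite mxE -(mx3_ext (Xi false)) -(mx3_ext (Xi true)) row_mx_half.
exact: row_mx_half.
Qed.
End NormalForm.
End Normal.

(** * Regular functions and birational maps *)

Section Varieties.
Variable F : closedFieldType.
Implicit Types X Y : variety F.

Definition reg_ring X :=
  [/\ forall c : F, @reg F X (fun=> c),
      forall f g, @reg F X f -> reg g -> @reg F X (fun x => f x + g x)
    & forall f g, @reg F X f -> reg g -> @reg F X (fun x => f x * g x)].

Lemma reg_ring_quotient X orb : reg_ring X -> reg_ring (@quotient F X orb).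
Proof.
case=> rC rD rM; split=> [c|f g [rf f_orb] [rg g_orb]|f g [rf f_orb] [rg g_orb]].
- by split=> //; apply: (rC).
- by split=> [|x y xy]; [apply: (rD) | rewrite (f_orb x y) // (g_orb x y)].
- by split=> [|x y xy]; [apply: (rM) | rewrite (f_orb x y) // (g_orb x y)].
Qed.

Lemma reg_ring_X36 : reg_ring (X36 F).
Proof.
by apply: reg_ring_quotient; split=> *; [apply: gen_const|apply: gen_add|apply: gen_mul].
Qed.

Lemma reg_ring_X36_S3 : reg_ring (X36_S3 F).
Proof. exact/reg_ring_quotient/reg_ring_X36. Qed.

Lemma zopen_nz X f : @reg F X f -> zopen (fun x => f x <> 0).
Proof.
move=> rf; exists (fun g => g = f); split=> [g -> //|x].
by split=> [fx|[g -> //]]; exists f.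
Qed.

Lemma zopenI X (U V : X -> Prop) : reg_ring X -> zopen U -> zopen V ->
  zopen (fun x => U x /\ V x).
Proof.
move=> [_ _ rM] [D [Dr DU]] [D' [Dr' DV]].
exists (fun h => exists f g, [/\ D f, D' g & h = fun x => f x * g x]); split.
  by move=> _ [f [g [Df Dg ->]]]; apply: (rM); [apply: Dr|apply: Dr'].
move=> x; split=> [[/DU[f Df fx] /DV[g Dg gx]]|[_ [f [g [Df Dg ->]]] /eqP]].
  exists (fun x => f x * g x); first by exists f, g.
  by apply/eqP; rewrite mulf_neq0 //; apply/eqP.
rewrite mulf_eq0 negb_or => /andP[/eqP fx /eqP gx].
by split; [apply/DU; exists f|apply/DV; exists g].
Qed.

Lemma zopen_eqpt X (U : X -> Prop) x y : zopen U -> eqpt x y -> U x -> U y.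
Proof.
move=> [D [Dr DU]] xy /DU[f Df fx]; apply/DU; exists f => //.
by rewrite -(xy f (Dr f Df)).
Qed.

(* A point with the same image as a point of U is that point: a function on   *)
(* U is a quotient of functions pulled back along h, and this persists on X.  *)
Lemma iso_onto_image_inj X Y (U : X -> Prop) (h : X -> Y) x y :
  reg_ring X -> irreducible X -> zopen U -> morphism h -> iso_onto_image U h ->
  U x -> eqpt (h y) (h x) -> eqpt y x.
Proof.
move=> rX [_ irr] oU mh [_ [k [rk kU kh]]] Ux yx f rf.
have hU z : U z -> image_of h U (h z) by move=> Uz; exists z.
have [a [b [ra rb bx fE]]] := rk f rf (h x) (hU x Ux).
have fab z : U z -> b (h z) <> 0 -> f z * b (h z) = a (h z).
  move=> Uz bz; rewrite -(kh z Uz f rf) (fE _ (hU z Uz) bz).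
  by rewrite divfK //; apply/eqP.
pose g z := f z * b (h z) + (-1) * a (h z).
have rg : reg g.
  case: rX => rC rD rM; apply: (rD); first by apply: (rM) => //; apply: mh.
  by apply: (rM); [apply: (rC) | apply: mh].
have g0 z : g z = 0.
  apply/eqP; apply/negP => /negP/eqP gz.
  have [w [gw [Uw bw]]] := irr _ _ (zopen_nz rg)
    (zopenI rX oU (zopen_nz (mh b rb))) (ex_intro _ z gz) (ex_intro _ x (conj Ux bx)).
  by apply: gw; rewrite /g fab // mulN1r subrr.
have gE z : f z * b (h z) = a (h z).
  by have /eqP := g0 z; rewrite /g mulN1r subr_eq0 => /eqP.
by apply: (mulIf (introN eqP bx)); rewrite -{1}(yx b rb) !gE (yx a ra).
Qed.

(** Near a point the pulled back function is a quotient a / b, so the locus where f, a and b are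
    nonzero is a neighbourhood inside the set. *)
Lemma zopen_preim X (U V : X -> Prop) (h : X -> X) : reg_ring X ->
  zopen U -> zopen V -> regular_on U h -> zopen (fun x => U x /\ V (h x)).
Proof.
move=> [rC rD rM] [D [Dr DU]] [D' [Dr' DV]] rh.
exists (fun g => reg g /\ forall x, g x <> 0 -> U x /\ V (h x)); split; first by move=> f [].
move=> x; split=> [[Ux /DV[g Dg gx]]|[g [_ gW] /gW //]].
have [f Df fx] := proj1 (DU x) Ux.
have [a [b [ra rb bx gE]]] := rh g (Dr' g Dg) x Ux.
have nzM (c d : F) : c * d <> 0 <-> c <> 0 /\ d <> 0.
  split=> [/eqP|[/eqP c0 /eqP d0]]; last by apply/eqP; rewrite mulf_neq0.
  by rewrite mulf_eq0 negb_or => /andP[/eqP c0 /eqP d0].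
exists (fun z => f z * (a z * b z)).
  split; first by apply: (rM); [apply: Dr|apply: (rM)].
  move=> z /nzM[fz /nzM[az bz]]; have Uz : U z by apply/DU; exists f.
  split=> //; apply/DV; exists g => //; rewrite gE //.
  by apply/eqP; rewrite mulf_neq0 ?invr_eq0 //; apply/eqP.
apply/nzM; split=> //; apply/nzM; split=> // ax.
by apply: gx; rewrite gE // ax mul0r.
Qed.

Lemma irreducible_prod X (I : Type) (r : seq I) (f : I -> X -> F) :
  reg_ring X -> irreducible X ->
  (forall i, reg (f i)) -> (forall i, exists x, f i x <> 0) ->
  let g := foldr (fun i g x => f i x * g x) (fun=> 1) r in
  reg g /\ exists x, g x <> 0.
Proof.
move=> [rC rD rM] [[x0 _] irr] rf fn; elim: r => [|i r [rg gn]] /=.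
  by split; [apply: (rC) | exists x0; apply/eqP/oner_neq0].
split; first exact: rM.
have [x [fx gx]] := irr _ _ (zopen_nz (rf i)) (zopen_nz rg) (fn i) gn.
by exists x; apply/eqP; rewrite mulf_neq0 //; apply/eqP.
Qed.

Lemma foldr_prod (T I : Type) (r : seq I) (f : I -> T -> F) x :
  foldr (fun i g x => f i x * g x) (fun=> 1) r x = \prod_(i <- r) f i x.
Proof. by elim: r => [|i r IH] /=; rewrite ?big_nil // big_cons IH. Qed.
End Varieties.

(** * The genericity condition as an invariant regular function *)

Section Moduli.
Variable F : closedFieldType.

(** Elements carry their proof of regularity, so evaluating [generic] here yields a regular function
    at once. It lives on [X36], as the traces depend on the numbering of the p_i. *)
Definition reg_ops : ops := @Ops {f : X36 F -> F | reg f}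
  (fun f g => exist _ _ (let: And3 _ rD _ := reg_ring_X36 F in rD _ _ (proj2_sig f) (proj2_sig g)))
  (fun f g => exist _ _ (let: And3 _ _ rM := reg_ring_X36 F in rM _ _ (proj2_sig f) (proj2_sig g)))
  (fun f => exist _ _ (let: And3 rC _ rM := reg_ring_X36 F in rM _ _ (rC (-1)) (proj2_sig f)))
  (fun n => exist _ _ (let: And3 rC _ _ := reg_ring_X36 F in rC n%:R)).

Definition reg_eval (x : X36 F) (f : reg_ops) : fops F := sval f x.

Lemma reg_eval_hom x : hom (reg_eval x).
Proof. by split=> // f; rewrite /reg_eval /= mulN1r. Qed.

Lemma trace4_reg (s : F) (a b c d : 'I_3 + 'I_6) : @reg F (X36 F) (fun x =>
  s * \tr (sval x a *m sval x b *m sval x c *m sval x d)).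
Proof.
have gM (G : ({x : 'I_3 + 'I_6 -> 'M[F]_6 | B36_rep x} -> F) -> Prop) (M N : _ -> 'M[F]_6) :
    (forall i j, gen_alg G (fun x => M x i j)) -> (forall i j, gen_alg G (fun x => N x i j)) ->
    forall i j, gen_alg G (fun x => (M x *m N x) i j).
  move=> HM HN i j.
  apply: (gen_ext _ (gen_alg_sum (index_enum 'I_6) (fun k => gen_mul (HM i k) (HN k j)))).
  by move=> x; rewrite mxE.
have gx h i j : gen_alg (@entry F _ (@B36_rep F)) (fun x => sval x h i j).
  by apply: gen_in; exists h, i, j.
split.
  apply: (gen_mul (gen_const _ _)); apply: gen_alg_sum => k.
  by apply: (gM) => //; apply: (gM) => //; apply: (gM).
move=> x y [u uU yE]; rewrite !yE; congr (_ * _).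
move: (sval x a) (sval x b) (sval x c) (sval x d) => A B C D.
have -> : u *m A *m invmx u *m (u *m B *m invmx u) *m (u *m C *m invmx u)
    *m (u *m D *m invmx u) = u *m (A *m B *m C *m D) *m invmx u.
  by rewrite !mulmxA !mulmxKV.
by rewrite [RHS]mxtrace_mulC !mulmxA mulVmx // mul1mx.
Qed.

Definition rhalf (f : 'I_3 -> 'I_6 -> reg_ops) right : I3 -> I3 -> reg_ops := fun a c =>
  f (ord_of_I3 a) (if right then @rshift 3 3 (ord_of_I3 c) else @lshift 3 3 (ord_of_I3 c)).

Definition rX i j : reg_ops := exist _ _
  (trace4_reg 36%:R (inl (ord_of_I3 i0)) (inr ord0) (inl i) (inr j)).
Definition rXi i j : reg_ops := exist _ _
  (trace4_reg 36%:R (inl i) (inr ord0) (inl (ord_of_I3 i0)) (inr j)).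

Definition rgeneric : reg_ops :=
  generic (rhalf rX false) (rhalf rXi false) (rhalf rX true) (rhalf rXi true).

Lemma rgenericE (x : X36 F) : sval rgeneric x =
  generic (half false (nX (sval x))) (half false (nXi (sval x)))
    (half true (nX (sval x))) (half true (nXi (sval x))).
Proof. exact: (generic_hom (reg_eval_hom x)). Qed.

Lemma X36_S3_irreducible : irreducible (X36 F) -> irreducible (X36_S3 F).
Proof.
have oX (U : X36_S3 F -> Prop) : zopen U -> @zopen F (X36 F) U.
  by move=> [D [Dr DU]]; exists D; split=> // f /Dr[].
by case=> ne irr; split=> // U V /oX oU /oX oV; apply: irr.
Qed.

Lemma permute_rep (s : 'S_3) (x : X36 F) : B36_rep (fun a =>
  match a with inl i => sval x (inl (s i)) | inr j => sval x (inr j) end).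
Proof.
case: (proj2_sig x) => -[pp qq] [pp0 qq0] [pqp qpq] sq [rp rq].
by split=> //; split=> // i i' ii'; apply: pp0; rewrite (inj_eq perm_inj).
Qed.

Definition permute (s : 'S_3) (x : X36 F) : X36 F := exist _ _ (permute_rep s x).

Lemma permute_morphism s : morphism (permute s).
Proof.
apply: rep_moduli_morphism => [c a b|x y [u uU yE]].
  by case: c => c; apply: gen_in; [exists (inl (s c)), a, b|exists (inr c), a, b].
by exists u => // -[i|j] /=; rewrite yE.
Qed.

Section Symmetrize.
Variable f : X36 F -> F.
Hypothesis rf : reg f.

(** The product over S_3 is invariant, and where it is nonzero so is [f]; a sum would not give the
    latter. *)
Definition symmetrize : X36 F -> F :=
  foldr (fun s g x => f (permute s x) * g x) (fun=> 1) (index_enum 'S_3).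

Lemma symmetrize_reg : @reg F (X36_S3 F) symmetrize.
Proof.
have rg s : @reg F (X36 F) (fun x => f (permute s x)) by apply: permute_morphism.
split.
  have [rC rD rM] := reg_ring_X36 F.
  rewrite /symmetrize; elim: (index_enum _) => [|s r IH] /=; first exact: rC.
  exact: (rM _ _ (rg s) IH).
move=> x y [s [py qy]]; rewrite /symmetrize !foldr_prod.
rewrite (reindex_inj (mulIg s)) /=; apply: eq_bigr => t _.
by apply: eqpt_rep rf; case=> i /=; rewrite ?py ?permM ?qy.
Qed.

Lemma symmetrize_neq0 x : symmetrize x <> 0 -> f x <> 0.
Proof.
move=> H f0; apply: H; rewrite /symmetrize foldr_prod (bigD1 (1%g : 'S_3)) //=.
have -> : f (permute 1 x) = f x by apply: eqpt_rep rf; case=> i /=; rewrite ?perm1.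
by rewrite f0 mul0r.
Qed.

Lemma symmetrize_ex : irreducible (X36 F) -> (exists x, f x <> 0) ->
  exists x, symmetrize x <> 0.
Proof.
move=> irr [x fx]; rewrite /symmetrize.
apply: (irreducible_prod _ (reg_ring_X36 F) irr _ _).2 => s; first exact: permute_morphism.
exists (permute s^-1 x).
have -> // : f (permute s (permute s^-1 x)) = f x.
by apply: eqpt_rep rf; case=> i //=; rewrite permK.
Qed.
End Symmetrize.
End Moduli.

Section Point.
Variable F : closedFieldType.
Hypothesis charF : [pchar F] =i pred0.
Let six0 : 6%:R != 0 :> F. Proof. exact: natF_neq0. Qed.

Lemma std_rep (X Xi : 'I_3 -> 'I_6 -> F) :
  (forall i j, Xi i j * X i j = 1) ->
  (forall i i', \sum_j X i j * Xi i' j = 6%:R *+ (i == i')) ->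
  B36_rep (diag_tuple (fun i => \matrix_(j, k) (6%:R^-1 * (Xi i j * X i k)) : 'M[F]_6)).
Proof.
move=> XiX Xorth; set p := fun i => _.
have pM i i' : p i *m p i' = \matrix_(j, k) (36%:R^-1 * (6%:R *+ (i == i')) * (Xi i j * X i' k)).
  apply/matrixP => a b; rewrite !mxE -Xorth mulr_sumr mulr_suml; apply: eq_bigr => l _.
  by rewrite !mxE; field; rewrite six0 natF_neq0.
have pd i j : p i j j = 6%:R^-1 by rewrite mxE XiX mulr1.
apply: diag_tuple_rep => // [i|i i' ii'|i].
- rewrite pM; apply/matrixP => a b; rewrite !mxE eqxx mulr1n.
  by field; rewrite six0 natF_neq0.
- by rewrite pM; apply/matrixP => a b; rewrite !mxE (negPf ii') mulr0 mul0r.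
- rewrite /mxtrace (eq_bigr _ (fun j _ => pd i j)) sumr_const card_ord.
  by rewrite -[LHS]mulr_natr mulVf.
Qed.

Lemma trace_delta n (M N : 'M[F]_n) a b :
  \tr (M *m delta_mx a a *m N *m delta_mx b b) = M b a * N a b.
Proof.
have D (K : 'M[F]_n) c : \tr (K *m delta_mx c c) = K c c.
  rewrite /mxtrace (bigD1 c) //= big1 => [|k kc].
    rewrite addr0 mxE (bigD1 c) //= big1 => [|k kc]; first by rewrite mxE !eqxx mulr1 addr0.
    by rewrite mxE (negPf kc) mulr0.
  by rewrite mxE big1 // => h _; rewrite mxE (negPf kc) andbF mulr0.
rewrite D mxE (bigD1 a) //= big1 => [|k ka].
  rewrite addr0; congr (_ * _); rewrite mxE (bigD1 a) //= big1 => [|k ka].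
    by rewrite mxE !eqxx mulr1 addr0.
  by rewrite mxE (negPf ka) mulr0.
by rewrite mxE big1 ?mul0r // => h _; rewrite mxE (negPf ka) andbF mulr0.
Qed.

Let X := row_mx (mx3 (pt_mx F false)) (mx3 (pt_mx F true)) : 'M[F]_(3, 3 + 3).
Let Xi := row_mx (mx3 (inv_fun (pt_mx F false))) (mx3 (inv_fun (pt_mx F true))) : 'M[F]_(3, 3 + 3).

Let XiX i j : Xi i j * X i j = 1.
Proof.
by rewrite -(splitK j); case: split => h; rewrite /= ?row_mxEl ?row_mxEr !mxE /inv_fun mulVf //
  pt_mx_neq0.
Qed.

Let Xorth i i' : \sum_j X i j * Xi i' j = 6%:R *+ (i == i').
Proof.
move: i i'; apply: ord3P => a; apply: ord3P => c; rewrite big_split_ord !big_ord3.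
rewrite !row_mxEl !row_mxEr !mx3E.
have := pt_orth charF a c.
rewrite (co_row_gramE (pt_mx_neq0 charF _)) (row_gramE (pt_mx_neq0 charF _)) => /eqP.
by rewrite subr_eq => /eqP ->; apply: addrC.
Qed.

Lemma rgeneric_ex : exists x : X36 F, sval (rgeneric F) x <> 0.
Proof.
exists (exist _ _ (std_rep XiX Xorth)); rewrite rgenericE; apply/eqP.
(* The point has first row and column 1, so the normalisation in [nX] returns its entries
   unchanged. *)
have X1 i : X i (@lshift 3 3 (ord_of_I3 i0)) = 1.
  by rewrite row_mxEl mxE; case: (I3_of_nat i); rewrite /pt_mx /Q_to_F /= /Z_to_F /= divr1.
have X0 j : X (ord_of_I3 i0) j = 1.
  rewrite -(splitK j); case: split => h; rewrite /= ?row_mxEl ?row_mxEr mxE;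
    by rewrite /pt_mx /Q_to_F /= /Z_to_F /= divr1.
have Xi1 i : Xi i (@lshift 3 3 (ord_of_I3 i0)) = 1.
  by apply: (mulIf (oner_neq0 F)); rewrite -{1}(X1 i) XiX mulr1.
have Xi0 j : Xi (ord_of_I3 i0) j = 1.
  by apply: (mulIf (oner_neq0 F)); rewrite -{1}(X0 j) XiX mulr1.
have j0 : (ord0 : 'I_6) = @lshift 3 3 (ord_of_I3 i0) by apply: val_inj.
have s36 : 36%:R != 0 :> F by apply: natF_neq0.
set x := sval _.
have nXE i j : nX x i j = X i j.
  rewrite /nX /x /= trace_delta [X in _ * (X * _)]mxE [X in _ * (_ * X)]mxE j0 X1 Xi1 Xi0 !mul1r !mulr1; field; rewrite six0.
  by [].
have nXiE i j : nXi x i j = Xi i j.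
  by rewrite /nXi /x /= trace_delta [X in _ * (X * _)]mxE [X in _ * (_ * X)]mxE j0 X1 Xi1 X0 !mul1r !mulr1; field; rewrite six0.
have hX r : half r (nX x) =2 pt_mx F r.
  move=> a c; rewrite /half nXE; case: r; rewrite ?row_mxEl ?row_mxEr mx3E //.
have hXi r : half r (nXi x) =2 inv_fun (pt_mx F r).
  move=> a c; rewrite /half nXiE; case: r; rewrite ?row_mxEl ?row_mxEr mx3E //.
rewrite (generic_hom (@id_hom F) (hX false) (hXi false) (hX true) (hXi true)).
exact: generic_pt.
Qed.
End Point.

(** * The complement as the image under the involution *)

Section Main.
Variable F : closedFieldType.
Hypothesis charF : [pchar F] =i pred0.

Lemma eqpt_Y_x_Y (z z' : Y_x_Y charF) :
  eqpt (sval z).1 (sval z').1 -> eqpt (sval z).2 (sval z').2 -> eqpt z z'.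
Proof.
move=> e1 e2 f; elim=> {f} [f|c|f g _ fE _ gE|f g _ fE _ gE|f g fg _ fE] //.
- by case=> -[u ru fE]; rewrite !fE; [apply: e1|apply: e2].
- by rewrite fE gE.
- by rewrite fE gE.
- by rewrite -!fg.
Qed.

(** The complement has the same q_j and exactly the opposite projector 1 - P, so both equalities
    already hold between representatives. *)
Lemma complement_point (x : X36_S3 F) : sval (rgeneric F) x <> 0 ->
  exists y : X36_S3 F, eqpt (phi0 charF y) (sigma_sigma (phi0 charF x)) /\
    eqpt (g_map charF y) (sigma' charF (g_map charF x)).
Proof.
move/eqP; rewrite rgenericE => /(complement_rep charF (proj2_sig x))[y [By qy py]].
exists (exist _ y By); split; [apply: eqpt_Y_x_Y|];
  by apply: eqpt_rep; case=> [j|] /=; rewrite ?qy.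
Qed.

End Main.

Theorem proposition16 (F : closedFieldType) (charF : [pchar F] =i pred0)
    (X36_irr : irreducible (X36 F))
    (phi0_iso : exists U0 : X36_S3 F -> Prop,
      [/\ zopen U0, nonempty U0 & iso_onto_image U0 (phi0 charF)])
    (phi0_image : exists W0 : Y_x_Y charF -> Prop,
      [/\ open_in (image_of (phi0 charF) (fun=> True)) W0, nonempty W0
        & forall z, W0 z -> W0 (sigma_sigma z)])
    (U : X36_S3 F -> Prop) (U_open : zopen U) (U_nonempty : nonempty U)
    (pi : X36_S3 F -> X36_S3 F) (pi_inv : involution_on U pi)
    (phi0_pi : forall x, U x ->
      eqpt (phi0 charF (pi x)) (sigma_sigma (phi0 charF x))) :
  eq_ratmap U (fun x => g_map charF (pi x)) (fun x => sigma' charF (g_map charF x)).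
Proof.
have [U0 [oU0 U0ne iso]] := phi0_iso; have [pi_reg piU pipi] := pi_inv.
have rX := reg_ring_X36_S3 F; have irrS := X36_S3_irreducible X36_irr.
have rg := proj2_sig (rgeneric F).
pose gen := symmetrize (sval (rgeneric F)).
have oW1 := zopen_preim rX U_open oU0 pi_reg.
have W1ne : nonempty (fun x => U x /\ U0 (pi x)).
  (* For z in both open sets, [pi z] is the witness, because [pi (pi z)] is z. *)
  have [z [Uz U0z]] := proj2 irrS _ _ U_open oU0 U_nonempty U0ne.
  exists (pi z); split; first exact: piU.
  by apply: (zopen_eqpt oU0 _ U0z) => f rf; rewrite (pipi z Uz).
have ogen := zopen_nz (symmetrize_reg rg).
(* The point [pi x], rather than x, is required to lie in [U0], because [phi0] is inverted there. *)
exists (fun x => (U x /\ U0 (pi x)) /\ gen x <> 0); split.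
- exact: zopenI.
- by apply: (proj2 irrS) => //; apply: symmetrize_ex (rgeneric_ex charF).
- by move=> x [[]].
move=> x [[Ux U0pi] gx].
have [y [yphi yg]] := complement_point charF (symmetrize_neq0 rg gx).
have ypi : eqpt y (pi x).
  (* The complement y is not known to lie in [U0]; it is enough that [pi x] does. *)
  apply: (iso_onto_image_inj rX irrS oU0 (@phi0_morphism F charF) iso U0pi).
  by move=> f rf; rewrite (yphi f rf) (phi0_pi x Ux).
move=> f rf; rewrite -(yg f rf); apply/esym.
exact: (morphism_eqpt (@g_map_morphism F charF) ypi).
Qed.
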